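(* Let $\mathbb{T}=\mathbb{R}/\mathbb{Z}$, $\mu\in W^{1,\infty}(\mathbb{T})$, $\sigma\in W^{2,\infty}(\mathbb{T}\times\mathbb{T})$ (real-valued), and $\nu\ge 0$. Let $\{w^{(n)}\}_{n\in\mathbb{N}}$ be a sequence of matrices $w^{(n)}\in\mathbb{R}^{N_n\times N_n}$ and let $\{X^{(n)}_0\}_{n\in\mathbb{N}}$ be a sequence of initial data $X^{(n)}_0\in\mathbb{T}^{N_n}$. Assume that $N_n\to\infty$, $\sup_n\sup_{i,j}|w^{(n)}_{i,j}|<\infty$, and that the $X^{(n)}_0$ are deterministic. Then the following hold. (Well-posedness) For each $n\in\mathbb{N}$ there exists a unique solution $X^{(n)}(t)=(X^{(n)}_i(t))_{i\in[N_n]}$, $t\ge 0$, of $$\mathrm{d}X^{(n)}_i=\mu(X^{(n)}_i)\,\mathrm{d}t+\frac{1}{N_n}\sum_{j\in[N_n]}w^{(n)}_{i,j}\,\sigma(X^{(n)}_i,X^{(n)}_j)\,\mathrm{d}t+\nu\,\mathrm{d}B^{(n)}_i,\qquad i\in[N_n],$$ with $X^{(n)}(0)=X^{(n)}_0$. (When $\nu>0$ the $X^{(n)}(t)$ are stochastic processes depending on the randomness of the independent Brownian motions $(B^{(n)}_i)_{i\in[N_n]}$.) (Compactness) There exists a subsequence of $(w^{(n)},X^{(n)}_0)$ (still indexed by $n$) which is Cauchy in the sense that $$\lim_{n\to\infty}\sup_{n_1,n_2\ge n}d_{L^2\to L^2,W_1}\big[(w^{(n_1)},X^{(n_1)}_0),(w^{(n_2)},X^{(n_2)}_0)\big]=0.$$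 (Stability) If the sequence $(w^{(n)},X^{(n)}_0)$ is Cauchy in this sense, then at any later time $t>0$, $$\lim_{n\to\infty}\sup_{n_1,n_2\ge n}\mathbb{E}\Big(d_{L^2\to L^2,W_1}\big[(w^{(n_1)},X^{(n_1)}(t)),(w^{(n_2)},X^{(n_2)}(t))\big]\Big)=0.$$
   Context: $[N]=\{1,\dots,N\}$. $|x-y|$ for $x,y\in\mathbb{T}$ is the distance on the torus. For each $n$, $(B^{(n)}_i)_{i\in[N_n]}$ are independent standard Brownian motions (projected to $\mathbb{T}$); all processes are defined on a common probability space. When $\nu=0$ the system is a system of ODEs. An $(N_1,N_2)$-coupling is a matrix $\gamma\in\mathbb{R}^{N_1\times N_2}$ with entries $\gamma_{i_1,i_2}\ge 0$, $\sum_{i_1\in[N_1]}\gamma_{i_1,i_2}=1/N_2$ for all $i_2\in[N_2]$, and $\sum_{i_2\in[N_2]}\gamma_{i_1,i_2}=1/N_1$ for all $i_1\in[N_1]$; the set of all of them is $\Pi(N_1,N_2)$. For $w^{(n)}\in\mathbb{R}^{N_n\times N_n}$ and $X^{(n)}\in\mathbb{T}^{N_n}$, $n=1,2$, the bi-coupling distance is $$d_{L^2\to L^2,W_1}\big[(w^{(1)},X^{(1)}),(w^{(2)},X^{(2)})\big]=\inf_{\gamma\in\Pi(N_1,N_2)}\bigg[\sum_{i_1\in[N_1]}\sum_{i_2\in[N_2]}|X^{(1)}_{i_1}-X^{(2)}_{i_2}|\,\gamma_{i_1,i_2}+\frac{1}{\sqrt{N_1N_2}}\Big(\|N_2\,w^{(1)}\gamma-N_1\,\gamma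 w^{(2)}\|_{\ell^2\to\ell^2}+\|N_2\,\gamma^Tw^{(1)}-N_1\,w^{(2)}\gamma^T\|_{\ell^2\to\ell^2}\Big)\bigg],$$ with ordinary matrix products, $\gamma^T$ the transpose, and $\|\cdot\|_{\ell^2\to\ell^2}$ the Euclidean operator norm. *)

(* Defs.v *)
From HB Require Import structures.
From mathcomp Require Import all_boot all_order all_algebra.
From mathcomp Require Import all_classical all_reals all_analysis.

Set Implicit Arguments.
Unset Strict Implicit.
Unset Printing Implicit Defensive.

Import Order.TTheory GRing.Theory Num.Theory.
Import numFieldNormedType.Exports.

Local Open Scope classical_set_scope.
Local Open Scope ring_scope.

Definition torus (R : realType) : Type :=
  Quotient.quot ((@Num.int_num_subdef R : {pred R}) : zmodClosed R).

HB.instance Definition _ (R : realType) := GRing.Zmodule.on (torus R).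
HB.instance Definition _ (R : realType) := Quotient.on (torus R).

Definition torus_pi (R : realType) (r : R) : torus R :=
  (\pi_(torus R) r)%qT.

(* This is the topology of [quotient_topology (torus R)], rebuilt because that
   alias carries another choice structure than the one underlying the group
   structure of the quotient. *)
Definition torus_open (R : realType) : set (set (torus R)) :=
  [set U | open (@torus_pi R @^-1` U)].

Lemma torus_openT (R : realType) : @torus_open R setT.
Proof. exact: openT. Qed.

Lemma torus_openI (R : realType) (U V : set (torus R)) :
  torus_open U -> torus_open V -> torus_open (U `&` V).
Proof. exact: openI. Qed.

Lemma torus_open_bigU (R : realType) (I : Type) (f : I -> set (torus R)) :
  (forall i, torus_open (f i)) -> torus_open (\bigcup_i f i).
Proof. by move=> fo; apply: bigcup_open => i _; exact: fo. Qed.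

HB.instance Definition _ (R : realType) :=
  isOpenTopological.Build (torus R)
    (@torus_openT R) (@torus_openI R) (@torus_open_bigU R).

(* The quotient metric, i.e. the distance from a representative of x - y to
   the nearest integer. *)
Definition torus_dist (R : realType) (x y : torus R) : R :=
  inf [set `|r| | r in [set r : R | torus_pi r = x - y]].

Definition torus_borel (R : realType) : set (set (torus R)) :=
  <<s @open (torus R) >>.

(* Sobolev spaces W^{k,oo}. A domain E is presented by a covering map from a
   normed space V, here R -> torus and R * R -> torus * torus, so that functions
   on E are periodic functions on V and need no boundary condition. A word s in
   the basis vectors of V stands for the multi-index counting its letters; the
   weak derivative along s is required to be in L^oo for all words of length at
   most k. This only depends on the a.e. class of f: that a given f is the
   continuous representative has to be said separately. *)

Definition iter_derive (R : realType) (V : normedModType R)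
    (s : seq V) (f : V -> R) : V -> R :=
  foldr (fun v g => 'D_v g) f s.

Definition smooth (R : realType) (V : normedModType R) (f : V -> R) : Prop :=
  forall (s : seq V) (x : V), differentiable (iter_derive s f) x.

Definition is_weak_derivative (R : realType) (V : normedModType R) (E : Type)
    (cover : V -> E) (integral : (V -> R) -> R) (s : seq V) (f g : E -> R) :=
  forall phi : E -> R, smooth (phi \o cover) ->
    integral (fun x => f (cover x) * iter_derive s (phi \o cover) x) =
    (-1) ^+ size s * integral (fun x => g (cover x) * phi (cover x)).

Definition in_sobolev_oo (R : realType) (V : normedModType R) (E : Type)
    (cover : V -> E) (integral : (V -> R) -> R) (Loo : set (E -> R))
    (basis : seq V) (k : nat) (f : E -> R) : Prop :=
  Loo f /\
  forall s : seq V, {subset s <= basis} -> (size s <= k)%N ->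
    exists2 g, Loo g & is_weak_derivative cover integral s f g.

Definition in_Loo_torus (R : realType) : set (torus R -> R) :=
  [set f : torus R -> R |
     measurable_fun setT (f \o @torus_pi R) /\
     ('N[@lebesgue_measure R]_+oo[EFin \o (f \o @torus_pi R)] < +oo)%E].

Definition in_Wkoo_torus (R : realType) (k : nat) (f : torus R -> R) : Prop :=
  @in_sobolev_oo R R (torus R) (@torus_pi R)
    (fun F => \int[lebesgue_measure]_(x in `[0, 1]) F x)
    (@in_Loo_torus R) [:: 1] k f.

Definition torus_pi2 (R : realType) (z : R * R) : torus R * torus R :=
  (torus_pi z.1, torus_pi z.2).

Definition lebesgue_measure2 (R : realType) :=
  (@lebesgue_measure R \x @lebesgue_measure R)%E.

Definition in_Loo_torus2 (R : realType) : set (torus R * torus R -> R) :=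
  [set f : torus R * torus R -> R |
     measurable_fun setT (f \o @torus_pi2 R) /\
     ('N[@lebesgue_measure2 R]_+oo[EFin \o (f \o @torus_pi2 R)] < +oo)%E].

Definition in_Wkoo_torus2 (R : realType) (k : nat)
    (f : torus R * torus R -> R) : Prop :=
  @in_sobolev_oo R (R * R)%type (torus R * torus R) (@torus_pi2 R)
    (fun F => \int[@lebesgue_measure2 R]_(z in `[0, 1] `*` `[0, 1]) F z)
    (@in_Loo_torus2 R) [:: (1, 0); (0, 1)] k f.

Definition l2norm (R : realType) (n : nat) (x : 'cV[R]_n) : R :=
  Num.sqrt (\sum_i (x i 0) ^+ 2).

Definition l2_opnorm (R : realType) (m n : nat) (A : 'M[R]_(m, n)) : R :=
  sup [set l2norm (A *m x) | x in [set x : 'cV[R]_n | l2norm x <= 1]].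

Definition coupling (R : realType) (N1 N2 : nat) : set 'M[R]_(N1, N2) :=
  [set g | [/\ forall i1 i2, 0 <= g i1 i2,
               forall i2, \sum_i1 g i1 i2 = N2%:R^-1
             & forall i1, \sum_i2 g i1 i2 = N1%:R^-1]].

Definition bicoupling_cost (R : realType) (N1 N2 : nat)
    (w1 : 'M[R]_N1) (X1 : 'I_N1 -> torus R)
    (w2 : 'M[R]_N2) (X2 : 'I_N2 -> torus R) (g : 'M[R]_(N1, N2)) : R :=
  \sum_i1 \sum_i2 torus_dist (X1 i1) (X2 i2) * g i1 i2
  + (Num.sqrt (N1%:R * N2%:R))^-1 *
    (l2_opnorm (N2%:R *: (w1 *m g) - N1%:R *: (g *m w2))
     + l2_opnorm (N2%:R *: (g^T *m w1) - N1%:R *: (w2 *m g^T))).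

Definition bicoupling_dist (R : realType) (N1 N2 : nat)
    (w1 : 'M[R]_N1) (X1 : 'I_N1 -> torus R)
    (w2 : 'M[R]_N2) (X2 : 'I_N2 -> torus R) : R :=
  inf [set bicoupling_cost w1 X1 w2 X2 g | g in @coupling R N1 N2].

Definition bicoupling_cauchy (R : realType) (N : nat -> nat)
    (w : forall n, 'M[R]_(N n)) (X : forall n, 'I_(N n) -> torus R) : Prop :=
  (fun n => ereal_sup
     [set (bicoupling_dist (w p.1) (X p.1) (w p.2) (X p.2))%:E
        | p in [set p : nat * nat | (n <= p.1)%N /\ (n <= p.2)%N]])
    @ \oo --> 0%E.

Section stochastic.
Context (R : realType) (d : measure_display) (Omega : measurableType d).
Variable P : probability Omega R.

Definition mutually_independent (I : finType) (E : I -> set (set Omega)) :=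
  forall (J : {set I}) (A : I -> set Omega),
    (forall j, j \in J -> E j (A j)) ->
    P (\bigcap_(j in [set` J]) A j) = (\prod_(j in J) P (A j))%E.

Definition rv_events (Y : Omega -> R) : set (set Omega) :=
  preimage_set_system setT Y (@measurable _ (measurableTypeR R)).

(* Processes are indexed by R, only times t >= 0 being meaningful. *)
Definition process_events (W : R -> Omega -> R) : set (set Omega) :=
  <<s \bigcup_(t in [set t : R | 0 <= t]) rv_events (W t) >>.

Record brownian_motion (W : R -> Omega -> R) : Prop := BrownianMotion {
  bm_measurable : forall t, 0 <= t -> measurable_fun setT (W t) ;
  bm_start : {ae P, forall omega, W 0 omega = 0} ;
  bm_increments : forall s t, 0 <= s -> s < t ->
    forall U : set (measurableTypeR R), measurable U ->
    P ((fun omega => W t omega - W s omega) @^-1` U) =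
      normal_prob 0 (Num.sqrt (t - s)) U ;
  bm_independent_increments : forall (k : nat) (t : nat -> R),
    0 <= t 0 -> {homo t : i j / (i <= j)%N >-> i <= j} ->
    mutually_independent
      (fun i : 'I_k => rv_events (fun omega => W (t i.+1) omega - W (t i) omega)) ;
  bm_continuous : {ae P, forall omega,
    {within `[0, +oo[, continuous (fun t => W t omega)}}
}.

Definition independent_brownian_motions (N : nat)
    (B : 'I_N -> R -> Omega -> R) : Prop :=
  (forall i, brownian_motion (B i)) /\
  mutually_independent (fun i => process_events (B i)).

(* Completed natural filtration of the driving Brownian motions. *)
Definition bm_filtration (N : nat) (B : 'I_N -> R -> Omega -> R) (t : R) :
    set (set Omega) :=
  <<s [set A | (exists i, exists2 s, 0 <= s <= t & rv_events (B i s) A)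
               \/ (measurable A /\ P A = 0)] >>.

Definition drift (mu : torus R -> R) (sigma : torus R * torus R -> R)
    (N : nat) (w : 'M[R]_N) (x : 'I_N -> torus R) (i : 'I_N) : R :=
  mu (x i) + N%:R^-1 * \sum_j w i j * sigma (x i, x j).

(* The noise is additive, so that the equation makes sense path by path, with
   no stochastic integral; it is an identity in the additive group of the
   torus. *)
Record is_solution (mu : torus R -> R) (sigma : torus R * torus R -> R) (nu : R)
    (N : nat) (w : 'M[R]_N) (B : 'I_N -> R -> Omega -> R)
    (X0 : 'I_N -> torus R) (X : 'I_N -> R -> Omega -> torus R) : Prop :=
  IsSolution {
  sol_measurable : forall i t, 0 <= t ->
    forall A, @torus_borel R A -> measurable (X i t @^-1` A) ;
  sol_continuous : {ae P, forall omega i,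
    {within `[0, +oo[, continuous (fun t => X i t omega)}} ;
  sol_start : {ae P, forall omega i, X i 0 omega = X0 i} ;
  sol_equation : {ae P, forall omega i t, 0 <= t ->
    X i t omega = X0 i + torus_pi
      (\int[lebesgue_measure]_(s in `[0, t])
          drift mu sigma w (fun j => X j s omega) i
       + nu * B i t omega)}
}.

Definition adapted (N : nat) (B : 'I_N -> R -> Omega -> R)
    (X : 'I_N -> R -> Omega -> torus R) : Prop :=
  forall i t, 0 <= t ->
  forall A, @torus_borel R A -> bm_filtration B t (X i t @^-1` A).

Definition indistinguishable (N : nat) (X Y : 'I_N -> R -> Omega -> torus R) :=
  {ae P, forall omega i t, 0 <= t -> X i t omega = Y i t omega}.

End stochastic.

(* Main.v *)
Require Import Defs.
From HB Require Import structures.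
From mathcomp Require Import all_boot all_order all_algebra.
From mathcomp Require Import all_classical all_reals all_analysis.
From mathcomp Require Import ess_sup_inf measurable_realfun zify ring lra.
Import Order.TTheory GRing.Theory Num.Theory.
Import numFieldNormedType.Exports.

Local Open Scope classical_set_scope.
Local Open Scope ring_scope.

(** The Sobolev hypotheses enter only through the Lipschitz continuity of [mu] and
    [sigma] ([W1oo_lipschitz], [W2oo_lipschitz]), which is obtained by testing the weak
    derivatives against trigonometric polynomials.

    Well-posedness. As the noise is additive, the equation is solved path by path by
    Picard iteration ([picard_lim_fix], [solution_unique]). The iterates are limits of
    Riemann sums, hence measurable with respect to the past of the noise
    ([measurable_picard_iter]). The distance of a solution to the [k]-th iterate is
    bounded by [picard_err], which does not depend on the size of the system.

    Compactness. In normalized form, the terms of the distance that involve the weights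
    are the operator norms of commutators of the operator of the coupling with the
    integral operators [w / N]. Up to an error that is small in operator norm, [w / N] is
    given by a step kernel with a bounded number of types of particles and bounded values
    ([weak_regularity]). Two systems with the same step kernel and close frequencies of
    types are close, because one can couple particles of the same type
    ([same_kernel_dist]); at each accuracy there are finitely many classes of such
    systems, and a diagonal argument concludes ([cauchy_subsequence]).

    Stability. A coupling that is nearly optimal at time 0 pairs particles driven by
    independent noises, so it is useless later on. But particles of the same type are
    interchangeable up to a small operator norm, and the types are deterministic. By the
    law of large numbers, the particles of any type that is not rare carry discretized
    noise paths distributed nearly according to the same Gaussian law in both systems
    ([mean_label_deviation]). Hence a new, random coupling can match the noise paths while
    preserving the law of the pairs of types, on which the transport cost at time 0 and the
    commutators depend up to small errors ([relabelled_coupling]).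

    It remains to propagate closeness in time under a fixed coupling that nearly commutes
    with the weights. The kernel averages of two functions that are close on average are
    close in mean square ([kernel_average_sqr]): expanding the square produces the
    commutators. Freezing the first variable of [sigma] in finitely many positions, one
    deduces the closeness of the drifts ([drift_stability]), and then that of finitely many
    Picard iterates ([picard_stability]). The resulting bound holds on almost every sample
    path ([random_bound_ae]), and its expectation is small by the law of large numbers and
    by the tail bound for the increments of the noise ([pair_expectation]). *)

(** * The torus *)

Section torus_theory.
Variable R : realType.
Implicit Types (r s : R) (x y z : torus R).

Lemma torus_piB r s : torus_pi (r - s) = torus_pi r - torus_pi s.
Proof. exact: (raddfB (\pi_(torus R) : R -> torus R)%qT). Qed.

Lemma torus_pi0 : torus_pi (0 : R) = 0.
Proof. by rewrite -[X in torus_pi X](subrr 0) torus_piB subrr. Qed.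

Lemma torus_piN r : torus_pi (- r) = - torus_pi r.
Proof. by rewrite -sub0r torus_piB torus_pi0 sub0r. Qed.

Lemma torus_piD r s : torus_pi (r + s) = torus_pi r + torus_pi s.
Proof. by rewrite -{1}[s]opprK torus_piB torus_piN opprK. Qed.

Lemma torus_pi_surj x : exists r, torus_pi r = x.
Proof. by exists (repr x); rewrite /torus_pi reprK. Qed.

Lemma torus_pi_eqP r s : torus_pi r = torus_pi s <-> exists k : int, r = s + k%:~R.
Proof.
rewrite (_ : torus_pi r = torus_pi s <-> r - s \is a Num.int); last first.
  split=> [/eqP|h]; last first.
    by apply/eqP; rewrite /torus_pi -Quotient.idealrBE.
  by rewrite /torus_pi -Quotient.idealrBE.
split=> [/intrP[k rsk]|[k ->]].
  by exists k; rewrite -rsk addrC subrK.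
by rewrite addrC addKr intr_int.
Qed.

Lemma torus_pi_int r (k : int) : torus_pi (r + k%:~R) = torus_pi r.
Proof. by apply/torus_pi_eqP; exists k. Qed.

Lemma torus_dist_has_inf x y :
  has_inf [set `|r| | r in [set r : R | torus_pi r = x - y]].
Proof.
split; first by have [r h] := torus_pi_surj (x - y); exists `|r|, r.
by exists 0 => _ [r _ <-].
Qed.

Lemma torus_dist_ge0 x y : 0 <= torus_dist x y.
Proof.
apply: lb_le_inf; first by case: (torus_dist_has_inf x y).
by move=> _ [r _ <-].
Qed.

Lemma torus_dist_le r x y : torus_pi r = x - y -> torus_dist x y <= `|r|.
Proof.
move=> h; apply: ge_inf; first by case: (torus_dist_has_inf x y).
by exists r.
Qed.

Lemma torus_dist_adherent x y e : 0 < e ->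
  exists2 r, torus_pi r = x - y & `|r| < torus_dist x y + e.
Proof.
move=> e0; have [_ [r rxy <-] h] := inf_adherent e0 (torus_dist_has_inf x y).
by exists r.
Qed.

Lemma torus_dist_pi r s : torus_dist (torus_pi r) (torus_pi s) <= `|r - s|.
Proof. by apply: torus_dist_le; rewrite torus_piB. Qed.

Lemma torus_distxx x : torus_dist x x = 0.
Proof.
apply/eqP; rewrite eq_le torus_dist_ge0 andbT -(normr0 R).
by apply: torus_dist_le; rewrite torus_pi0 subrr.
Qed.

Lemma torus_distD x y x' y' :
  torus_dist (x + x') (y + y') <= torus_dist x y + torus_dist x' y'.
Proof.
apply/ler_addgt0Pr => e e0; have e20 : 0 < e / 2 by rewrite divr_gt0.
have [r rxy hr] := torus_dist_adherent x y _ e20.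
have [s sxy hs] := torus_dist_adherent x' y' _ e20.
apply: (@le_trans _ _ `|r + s|).
  by apply: torus_dist_le; rewrite torus_piD rxy sxy opprD addrACA.
by apply: (le_trans (ler_normD _ _)); rewrite [e]splitr; lra.
Qed.

Lemma torus_distC x y : torus_dist x y = torus_dist y x.
Proof.
wlog suff : x y / torus_dist x y <= torus_dist y x.
  by move=> h; apply/eqP; rewrite eq_le !h.
apply/ler_addgt0Pr => e e0; have [r rxy hr] := torus_dist_adherent y x _ e0.
apply: (le_trans _ (ltW hr)); rewrite -normrN; apply: torus_dist_le.
by rewrite torus_piN rxy opprB.
Qed.

Lemma torus_dist_triangle y x z :
  torus_dist x z <= torus_dist x y + torus_dist y z.
Proof.
have := torus_distD x y y z.
suff -> : torus_dist (x + y) (y + z) = torus_dist x z by [].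
by rewrite /torus_dist addrKA.
Qed.

Lemma torus_distB x y : torus_dist (x - y) 0 = torus_dist x y.
Proof. by rewrite /torus_dist subr0. Qed.

Lemma torus_dist_le1 x y : torus_dist x y <= 1.
Proof.
have [r rxy] := torus_pi_surj (x - y).
apply: (@le_trans _ _ `|r - (Num.floor r)%:~R|).
  by apply: torus_dist_le; rewrite -mulrNz torus_pi_int.
have /andP[] := floor_itv r; rewrite intrD => h1 h2.
by rewrite ger0_norm ?subr_ge0// lerBlDl ltW.
Qed.

(** Lifts of two points can be chosen at a distance as close as desired to their
    quotient distance, so that the bound descends from the line. *)
Lemma torus_lipschitz L (f : torus R -> R) :
  (forall r s, `|f (torus_pi r) - f (torus_pi s)| <= L * `|r - s|) ->
  forall x y, `|f x - f y| <= L * torus_dist x y.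
Proof.
move=> fL x y; have L0 : 0 <= L.
  by have := fL 1 0; rewrite subr0 normr1 mulr1; apply: le_trans.
apply/ler_addgt0Pr => e e0.
have L10 : 0 < L + 1 by lra.
have e10 : 0 < e / (L + 1) by rewrite divr_gt0.
have [r rxy hr] := torus_dist_adherent x y _ e10.
have [s sy] := torus_pi_surj y.
have sx : torus_pi (s + r) = x by rewrite torus_piD sy rxy addrC subrK.
rewrite -sx -sy; apply: (le_trans (fL _ _)).
have -> : s + r - s = r by rewrite addrC addKr.
rewrite sx sy.
apply: (@le_trans _ _ (L * (torus_dist x y + e / (L + 1)))).
  by rewrite ler_wpM2l// ltW.
rewrite mulrDr lerD2l mulrCA ger_pMr// ler_pdivrMr// mul1r; lra.
Qed.

Definition torus_cell (K : nat) (x : torus R) : 'I_K.+1 :=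
  inord (Num.truncn (K.+1%:R * (repr x - (Num.floor (repr x))%:~R))).

Lemma torus_cell_repr K x : exists k : int,
  k%:~R + (torus_cell K x)%:R / K.+1%:R <= repr x
    < k%:~R + (torus_cell K x).+1%:R / K.+1%:R.
Proof.
exists (Num.floor (repr x)); set r := repr x.
have /andP[] := floor_itv r; rewrite intrD => h1 h2.
have K0 : 0 < K.+1%:R :> R by rewrite ltr0n.
set u := K.+1%:R * (r - (Num.floor r)%:~R).
have u0 : 0 <= u by rewrite mulr_ge0 ?ler0n// subr_ge0.
have uK : (Num.truncn u < K.+1)%N.
  rewrite truncn_lt_nat// /u gtr_pMr//; lra.
rewrite /torus_cell -/r -/u inordK//.
have lo : (Num.truncn u)%:R <= u by rewrite -truncn_ge_nat.
have hi : u < (Num.truncn u).+1%:R by rewrite -truncn_lt_nat.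
have E : r = (Num.floor r)%:~R + u / K.+1%:R.
  by rewrite /u mulrC mulKf ?gt_eqF// addrC subrK.
clearbody u; move: (Num.floor r) E => q ->; rewrite lerD2l ltrD2l ler_pM2r ?invr_gt0// ltr_pM2r ?invr_gt0//.
by rewrite lo hi.
Qed.

Lemma torus_cell_dist K x y :
  torus_cell K x = torus_cell K y -> torus_dist x y <= K.+1%:R^-1.
Proof.
move=> xy; have [k /andP[k1 k2]] := torus_cell_repr K x.
have [l /andP[l1 l2]] := torus_cell_repr K y; rewrite -xy in l1 l2.
rewrite -[(torus_cell K x).+1%:R]natr1 mulrDl mul1r in k2 l2.
apply: (@le_trans _ _ `|(repr x - repr y) + (l - k)%:~R|).
  by apply: torus_dist_le; rewrite torus_pi_int torus_piB /torus_pi !reprK.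
rewrite intrB ler_norml; move: k1 k2 l1 l2; move: (K.+1%:R^-1) => q; move: (_ * q) => p *.
by apply/andP; split; lra.
Qed.

Lemma torus_cellP K r (c : 'I_K.+1) : torus_cell K (torus_pi r) = c <->
  exists k : int, k%:~R + c%:R / K.+1%:R <= r < k%:~R + c.+1%:R / K.+1%:R.
Proof.
have [k /andP[k1 k2]] := torus_cell_repr K (torus_pi r).
have /torus_pi_eqP[l hl] : torus_pi r = torus_pi (repr (torus_pi r)).
  by rewrite {2}/torus_pi reprK.
have K0 : 0 < K.+1%:R :> R by rewrite ltr0n.
have : K.+1%:R^-1 * K.+1%:R = 1 :> R by rewrite mulVf// gt_eqF.
move: k1 k2 hl; set c' := torus_cell K _; set q := repr _.
move: (K.+1%:R^-1) => iK k1 k2 hl iKK.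
split=> [<-|[m /andP[m1 m2]]].
  by exists (k + l); rewrite hl intrD; apply/andP; split; lra.
have ints (a b : int) (p p' : nat) :
    a%:~R + p%:R * iK < b%:~R + p'.+1%:R * iK :> R ->
    a * K.+1 + p < b * K.+1 + p'.+1.
  rewrite -(ltr_pM2r K0) !(mulrDl _ _ K.+1%:R) -!(mulrA _ iK) iKK !mulr1 => h.
  by rewrite -(ltr_int R) !intrD !intrM.
have h1 : (k + l) * K.+1 + c' < m * K.+1 + c.+1.
  by apply: ints; rewrite intrD; lra.
have h2 : m * K.+1 + c < (k + l) * K.+1 + c'.+1.
  by apply: ints; rewrite intrD; lra.
have := ltn_ord c; have := ltn_ord c' => h3 h4.
apply/val_inj => /=.
have [E|E|E] := ltgtP m (k + l).
- have : (m + 1) * K.+1%:Z <= (k + l) * K.+1%:Z by rewrite ler_pM2r// lezD1.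
  by move: h1 h3 h4; rewrite (mulrDl m) mul1r; move: (_ * _) (_ * _) => a b; lia.
- have : (k + l + 1) * K.+1%:Z <= m * K.+1%:Z by rewrite ler_pM2r// lezD1.
  by move: h2 h3 h4; rewrite (mulrDl _ 1) mul1r; move: (_ * _) (_ * _) => a b; lia.
by move: h1 h2; rewrite E; move: (_ * _) => a; lia.
Qed.

Lemma measurable_torus_cell K (c : 'I_K.+1) :
  measurable [set r : R | torus_cell K (torus_pi r) = c].
Proof.
rewrite (_ : mkset _ = \bigcup_(k in [set: int])
  [set` `[k%:~R + c%:R / K.+1%:R, k%:~R + c.+1%:R / K.+1%:R[]).
  by apply: countable_bigcupT_measurable => [|k]; [exact: countableP|]; exact: measurable_itv.
apply/seteqP; split=> [r /torus_cellP[k h]|r [k _ /=]].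
  by exists k => //=; rewrite in_itv.
by rewrite in_itv/= => h; apply/torus_cellP; exists k.
Qed.

End torus_theory.

(** * Integrals of continuous functions over compact intervals *)

Section interval_integral.
Variable R : realType.
Implicit Types (a b c : R) (f g F : R -> R).

Local Notation "'II' a b f" := (\int[@lebesgue_measure R]_(x in `[a, b]) f x)
  (at level 10, a, b, f at level 9).

Lemma continuous_integrable f a b : continuous f ->
  (@lebesgue_measure R).-integrable `[a, b] (EFin \o f).
Proof.
move=> cf; apply: continuous_compact_integrable; first exact: segment_compact.
exact: continuous_subspaceT.
Qed.
#[local] Hint Resolve continuous_integrable : core.

Lemma continuous_normr f : continuous f -> continuous (fun x => `|f x|).
Proof. by move=> cf x; apply: cvg_norm; exact: cf. Qed.

Lemma Rintegral_itvD f g a b : continuous f -> continuous g ->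
  II a b (fun x => f x + g x) = II a b f + II a b g.
Proof. by move=> cf cg; rewrite RintegralD//; exact: continuous_integrable. Qed.

Lemma Rintegral_itvN f g a b : continuous f -> continuous g ->
  II a b (fun x => f x - g x) = II a b f - II a b g.
Proof. by move=> cf cg; rewrite RintegralB//; exact: continuous_integrable. Qed.

Lemma Rintegral_itvZ f k a b : continuous f ->
  II a b (fun x => k * f x) = k * II a b f.
Proof. by move=> cf; rewrite RintegralZl//; exact: continuous_integrable. Qed.

Lemma Rintegral_itv_le f g a b : continuous f -> continuous g ->
  (forall x, a <= x -> x <= b -> f x <= g x) -> II a b f <= II a b g.
Proof.
move=> cf cg fg; apply: le_Rintegral => //; try exact: continuous_integrable.
by move=> x /=; rewrite in_itv/= => /andP[]; exact: fg.
Qed.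

Lemma Rintegral_itv_cst k a b : a <= b -> II a b (fun _ => k) = k * (b - a).
Proof.
move=> ab; rewrite Rintegral_cst//; congr (_ * _).
transitivity (fine (b - a)%:E) => //; congr fine.
apply: (etrans (@lebesgue_measure_itv R `[a, b])); rewrite /= lte_fin.
by case: ltgtP ab => // ->; rewrite subrr.
Qed.

Lemma Rintegral_itv_norm f a b : continuous f ->
  `|II a b f| <= II a b (fun x => `|f x|).
Proof. by move=> cf; apply: le_normr_Rintegral => //; exact: continuous_integrable. Qed.

Lemma Rintegral_itv_ge0 f a b :
  (forall x, a <= x -> x <= b -> 0 <= f x) -> 0 <= II a b f.
Proof.
move=> f0; apply: Rintegral_ge0 => x /=.
by rewrite in_itv/= => /andP[]; exact: f0.
Qed.

Lemma Rintegral_itv1 f a : II a a f = 0.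
Proof. by rewrite set_itv1 Rintegral_set1. Qed.

Lemma Rintegral_itv_gt f a b : b < a -> II a b f = 0.
Proof. by move=> ba; rewrite set_itv_ge ?Rintegral_set0// -ltNge. Qed.

Lemma Rintegral_itv_cat f a b c : continuous f -> a <= b -> b <= c ->
  II a c f = II a b f + II b c f.
Proof.
move=> cf ab bc; rewrite -[II b c f]Rintegral_itv_obnd_cbnd; last first.
  apply: integrableS (continuous_integrable f b c cf) => //.
  by apply: subset_itvr; rewrite bnd_simp.
rewrite -(@Rintegral_itvB _ f (BLeft a) (BRight c) b)//; last first.
  exact: continuous_integrable.
by rewrite addrC subrK.
Qed.

Lemma continuous_sum (T : topologicalType) (I : Type) (r : seq I) (P : pred I)
    (h : I -> T -> R) :
  (forall i, continuous (h i)) -> continuous (fun x => \sum_(i <- r | P i) h i x).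
Proof. by move=> ch; apply: continuous_big => //; exact: add_continuous. Qed.

Lemma Rintegral_itv_sum (I : Type) (r : seq I) (h : I -> R -> R) a b :
  (forall i, continuous (h i)) ->
  II a b (fun x => \sum_(i <- r) h i x) = \sum_(i <- r) II a b (h i).
Proof.
move=> ch; elim: r => [|i r IH].
  rewrite big_nil; under eq_Rintegral do rewrite big_nil.
  by rewrite Rintegral_cst// mul0r.
rewrite big_cons -IH -Rintegral_itvD//.
  by apply: eq_Rintegral => x _; rewrite big_cons.
exact: continuous_sum.
Qed.

(** Differentiability on the whole line spares one-sided derivatives at the
    endpoints. *)
Lemma Rintegral_itv_derive F f a b : a <= b ->
  continuous f -> (forall x : R, is_derive x 1 F (f x)) -> II a b f = F b - F a.
Proof.
rewrite le_eqVlt => /predU1P[-> _ _|ab cf dF]; first by rewrite Rintegral_itv1 subrr.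
have cF : continuous F.
  move=> x; apply: differentiable_continuous; apply/derivable1_diffP.
  by have := dF x => -[].
rewrite /Rintegral (@continuous_FTC2 _ f F)//.
- exact: continuous_subspaceT.
- split=> [x _||]; first by have := dF x => -[].
  + by apply: cvg_at_right_filter; exact: cF.
  + by apply: cvg_at_left_filter; exact: cF.
- by move=> x _; rewrite derive1E; have := dF x => -[].
Qed.

Lemma Rintegral_itv_bound f a b M : continuous f -> a <= b ->
  (forall x, a <= x -> x <= b -> `|f x| <= M) -> `|II a b f| <= M * (b - a).
Proof.
move=> cf ab fM; apply: (le_trans (Rintegral_itv_norm _ _ _ cf)).
rewrite -Rintegral_itv_cst//; apply: Rintegral_itv_le => //.
  exact: continuous_normr.
exact: cst_continuous.
Qed.

Lemma continuous_bounded_itv f a b : continuous f ->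
  exists2 M, 0 <= M & forall x, a <= x -> x <= b -> `|f x| <= M.
Proof.
move=> cf; have [ab|ba] := leP a b; last first.
  by exists 0 => // x ax xb; have := le_lt_trans (le_trans ax xb) ba; rewrite ltxx.
have [|c _ hc] := @EVT_max R (fun x => `|f x|) a b ab.
  by apply: continuous_subspaceT; exact: continuous_normr.
exists `|f c| => // x ax xb; apply: hc; by rewrite in_itv/= ax xb.
Qed.

(** The primitive is extended by 0 to the left of the origin. *)
Lemma continuous_Rintegral_itv f : continuous f ->
  continuous (fun t : R => II 0 t f).
Proof.
move=> cf t.
have [M M0 fM] := continuous_bounded_itv f 0 (`|t| + 1) cf.
have key s s' : s <= `|t| + 1 -> s' <= `|t| + 1 -> s <= s' ->
    `|II 0 s' f - II 0 s f| <= M * (s' - s).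
  move=> st s't ss'; have [s0|s0] := leP 0 s.
    rewrite (Rintegral_itv_cat f 0 s s')// addrC addKr.
    apply: Rintegral_itv_bound => // x sx xs'; apply: fM.
      exact: le_trans sx.
    exact: le_trans xs' s't.
  rewrite (Rintegral_itv_gt f 0 s)// subr0.
  have [s'0|s'0] := leP 0 s'.
    apply: (@le_trans _ _ (M * (s' - 0))).
      apply: Rintegral_itv_bound => // x sx xs'; apply: fM => //.
      exact: le_trans xs' s't.
    by rewrite ler_wpM2l//; lra.
  by rewrite Rintegral_itv_gt// normr0 mulr_ge0// subr_ge0.
have key2 s : `|s - t| <= 1 -> `|II 0 t f - II 0 s f| <= M * `|t - s|.
  move=> st; have t1 : t <= `|t| + 1 by have := ler_norm t; lra.
  have s1 : s <= `|t| + 1.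
    by have := ler_norm t; have := ler_norm (s - t); lra.
  have [ts|ts] := leP t s.
    by rewrite distrC (ler0_norm (_ : t - s <= 0)) ?subr_le0// opprB; apply: key.
  have -> : `|t - s| = t - s by rewrite ger0_norm// subr_ge0 ltW.
  exact: key (ltW ts).
apply/cvgrPdist_le => e e0; near=> s.
apply: (@le_trans _ _ (M * `|t - s|)).
  apply: key2; near: s; apply/nbhs_ballP; exists 1 => //= s.
  by rewrite /ball/= distrC => /ltW.
apply: (@le_trans _ _ ((M + 1) * `|t - s|)); first by rewrite ler_wpM2r//; lra.
rewrite mulrC -ler_pdivlMr; last lra.
near: s; apply/nbhs_ballP; exists (e / (M + 1)); first by rewrite /= divr_gt0//; lra.
by move=> s; rewrite /ball/= => /ltW.
Unshelve. all: by end_near. Qed.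

Lemma continuous_unif_itv f a b : continuous f -> forall e, 0 < e ->
  exists2 dl : R, 0 < dl & forall x y,
    a <= x <= b -> a <= y <= b -> `|x - y| < dl -> `|f x - f y| <= e.
Proof.
move=> cf e e0.
have /compact_near_coveringP ncov := @segment_compact R a b.
have e20 : 0 < e / 2 by rewrite divr_gt0.
have [] := ncov R (0^'+) (fun dl x => forall y, `|x - y| < dl -> `|f x - f y| <= e).
  move=> x _; have /cvgrPdist_le/(_ _ e20) := cf x.
  move=> /nbhs_ballP[dl /= dl0 hdl].
  have dl20 : 0 < dl / 2 by rewrite divr_gt0.
  exists (ball x (dl / 2), [set r | r < dl / 2]) => /=.
    split; first by apply/nbhs_ballP; exists (dl / 2).
    by apply: nbhs_right_lt.
  move=> [z r] /= [xz rdl] y zy.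
  have h1 : `|f x - f z| <= e / 2.
    by apply: hdl; apply: lt_le_trans xz _; lra.
  have h2 : `|f x - f y| <= e / 2.
    apply: hdl; rewrite /ball /= in xz *.
    have := ler_distD z x y; lra.
  have := ler_distD (f x) (f z) (f y); rewrite (distrC (f z) (f x)); lra.
move=> r /= r0 hr; exists (r / 2); first by rewrite divr_gt0.
move=> x y xab _ xy; apply: (hr (r / 2)) => //=.
- by rewrite sub0r normrN ger0_norm; lra.
- by rewrite divr_gt0.
Qed.

Definition riemann_sum f a b (n : nat) :=
  (b - a) / n.+1%:R * \sum_(j < n.+1) f (a + j%:R * ((b - a) / n.+1%:R)).

Lemma cvg_riemann_sum f a b : a <= b -> continuous f ->
  riemann_sum f a b n @[n --> \oo] --> II a b f.
Proof.
move=> ab cf.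
have uc := continuous_unif_itv f a b cf.
apply/cvgrPdist_le => e e0.
have e1 : 0 < e / (b - a + 1) by rewrite divr_gt0//; lra.
have [dl dl0 hdl] := uc _ e1.
near=> n; set h := (b - a) / n.+1%:R.
have h0 : 0 <= h by rewrite divr_ge0// subr_ge0.
have hdlt : h < dl.
  rewrite /h ltr_pdivrMr// -ltr_pdivrMl// mulrC.
  have : (b - a) / dl < n%:R by near: n; exact: nbhs_infty_gtr.
  by move=> /lt_trans; apply; rewrite ltr_nat.
have nh : n.+1%:R * h = b - a by rewrite /h mulrC divfK// gt_eqF.
have hE : (b - a) / n.+1%:R = h by [].
clearbody h.
have part (m : nat) : (m <= n.+1)%N ->
    II a (a + m%:R * h) f = \sum_(j < m) II (a + j%:R * h) (a + j.+1%:R * h) f.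
  elim: m => [_|m IH mn]; first by rewrite big_ord0 mul0r addr0 Rintegral_itv1.
  rewrite big_ord_recr/= -IH ?(ltnW mn)// -Rintegral_itv_cat//.
    by rewrite lerDl mulr_ge0.
  by rewrite lerD2l ler_wpM2r// ler_nat.
have := part n.+1 (leqnn _); rewrite {1}nh addrC subrK => ->.
rewrite /riemann_sum hE mulr_sumr -sumrB.
apply: (le_trans (ler_norm_sum _ _ _)).
apply: (@le_trans _ _ (\sum_(j < n.+1) e / (b - a + 1) * h)); last first.
  rewrite sumr_const card_ord -mulr_natl mulrCA nh mulrAC ler_pdivrMr; nra.
apply: ler_sum => j _.
have j1h : a + j.+1%:R * h = a + j%:R * h + h by rewrite -natr1; ring.
have jh0 : 0 <= j%:R * h by rewrite mulr_ge0.
have jhn : j%:R * h + h <= b - a.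
  by rewrite -nh -[in leLHS](mul1r h) mulrA mulr1 -mulrDl ler_wpM2r// natr1 ler_nat.
have -> : h * f (a + j%:R * h) =
    II (a + j%:R * h) (a + j.+1%:R * h) (fun=> f (a + j%:R * h)).
  by rewrite Rintegral_itv_cst j1h; [rewrite mulrC; congr (_ * _); ring|lra].
rewrite -Rintegral_itvN//; last exact: cst_continuous.
rewrite j1h; set c := a + _; have hc : h = c + h - c by ring.
rewrite [in leRHS]hc; apply: Rintegral_itv_bound; [|lra|].
  by move=> x; apply: cvgB; [exact: cf|exact: cvg_cst].
move=> x cx xc; apply: hdl; rewrite /c in cx xc *.
- by apply/andP; split; lra.
- by apply/andP; split; lra.
- by rewrite ger0_norm; lra.
Unshelve. all: by end_near. Qed.
End interval_integral.

(** * Bounded weak derivatives and Lipschitz functions *)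

Section cosine_kernel.
Variable R : realType.
Implicit Types (u x y : R) (n : nat).

Local Notation "'II' a b f" := (\int[@lebesgue_measure R]_(x in `[a, b]) f x)
  (at level 10, a, b, f at level 9).

(** The even powers of [cos (pi u)], normalized by their mean [cosmass n] over a
    period, form an approximate identity; [cosprim] and [cosprim2] are a first
    and a second primitive, obtained by integrating by parts. *)
Definition coskernel n u := cos (pi * u) ^+ n.*2.

Fixpoint cosmass n : R :=
  if n is m.+1 then (m.*2.+1)%:R / (m.*2.+2)%:R * cosmass m else 1.

Fixpoint cosprim n u : R :=
  if n is m.+1 then
    (m.*2.+1)%:R / (m.*2.+2)%:R * cosprim m u
    + (pi * (m.*2.+2)%:R)^-1 * (cos (pi * u) ^+ m.*2.+1 * sin (pi * u))
  else u.

Fixpoint cosprim2 n u : R :=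
  if n is m.+1 then
    (m.*2.+1)%:R / (m.*2.+2)%:R * cosprim2 m u
    - (pi * (m.*2.+2)%:R) ^- 2 * cos (pi * u) ^+ m.*2.+2
  else u ^+ 2 / 2.

Lemma cosmass_gt0 n : 0 < cosmass n.
Proof. by elim: n => //= n IH; rewrite mulr_gt0// divr_gt0. Qed.

Lemma cosmassS n : cosmass n - cosmass n.+1 = (n.*2.+2)%:R^-1 * cosmass n.
Proof.
rewrite /= -{1}[cosmass n]mul1r -mulrBl; congr (_ * _).
have E : n.*2.+2%:R = n.*2.+1%:R + 1 :> R by rewrite natr1.
have N0 : n.*2.+2%:R != 0 :> R by rewrite pnatr_eq0.
by apply: (mulIf N0); rewrite mulrBl divfK// mulVf// mul1r E addrC addKr.
Qed.

Lemma coskernel_ge0 n u : 0 <= coskernel n u.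
Proof. by rewrite /coskernel -mul2n exprM exprn_ge0// sqr_ge0. Qed.

Lemma is_derive_cospi u : is_derive u 1 (fun u => cos (pi * u)) (- (pi * sin (pi * u))).
Proof.
have h : is_derive u 1 (fun u : R => pi * u) pi.
  by apply: (is_derive_eq (is_deriveZ pi (is_derive_id u 1))); rewrite /GRing.scale/= mulr1.
by have := is_derive1_comp (is_derive_cos (pi * u)) h; rewrite mulNr mulrC.
Qed.

Lemma is_derive_sinpi u : is_derive u 1 (fun u => sin (pi * u)) (pi * cos (pi * u)).
Proof.
have h : is_derive u 1 (fun u : R => pi * u) pi.
  by apply: (is_derive_eq (is_deriveZ pi (is_derive_id u 1))); rewrite /GRing.scale/= mulr1.
by have := is_derive1_comp (is_derive_sin (pi * u)) h; rewrite mulrC.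
Qed.

Lemma is_derive_expr (f : R -> R) n u df : is_derive u 1 f df ->
  is_derive u 1 (fun x => f x ^+ n) (n%:R * f u ^+ n.-1 * df).
Proof. by move=> /(is_deriveX n); rewrite exprfctE. Qed.

Lemma is_derive_cosprim n u : is_derive u 1 (cosprim n) (coskernel n u).
Proof.
elim: n => [|n IH]; first by rewrite /coskernel/=; exact: is_derive_id.
have hc := is_derive_cospi u; have hs := is_derive_sinpi u.
have hX := is_derive_expr _ n.*2.+1 _ _ hc.
have hM := is_deriveM hX hs.
have h1 := is_deriveZ (pi * (n.*2.+2)%:R)^-1 hM.
have h2 := is_deriveZ ((n.*2.+1)%:R / (n.*2.+2)%:R) IH.
have h := is_deriveD h2 h1.
rewrite /= ; apply: (is_derive_eq h).
rewrite /coskernel doubleS /GRing.scale/=.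
set c := cos _; set s := sin _.
have cs : s ^+ 2 = 1 - c ^+ 2 by rewrite /c /s -(cos2Dsin2 (pi * u)) addrC addKr.
have E : n.*2.+2%:R = n.*2.+1%:R + 1 :> R by rewrite natr1.
have N0 : n.*2.+1%:R + 1 != 0 :> R by rewrite -E pnatr_eq0.
have p0 : pi != 0 :> R by rewrite gt_eqF// pi_gt0.
have -> : s * (n.*2.+1%:R * c ^+ n.*2 * - (pi * s)) =
  - (pi * n.*2.+1%:R * c ^+ n.*2 * (1 - c ^+ 2)) by rewrite -cs; ring.
rewrite E !exprS; clearbody c s; move: (n.*2.+1%:R) N0 => q N0.
by move: (pi : R) p0 => p p0; field; rewrite N0 p0.
Qed.

Lemma is_derive_cosprim2 n u : is_derive u 1 (cosprim2 n) (cosprim n u).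
Proof.
elim: n => [|n IH].
  by apply: is_derive_eq; rewrite /= /GRing.scale/=; lra.
have hc := is_derive_cospi u.
have hX := is_derive_expr _ n.*2.+2 _ _ hc.
have h1 := is_deriveZ ((pi * (n.*2.+2)%:R) ^- 2) hX.
have h2 := is_deriveZ ((n.*2.+1)%:R / (n.*2.+2)%:R) IH.
have h := is_deriveB h2 h1.
rewrite /= ; apply: (is_derive_eq h).
rewrite /GRing.scale/= /cst; congr (_ + _).
have N0 : n.*2.+2%:R != 0 :> R by rewrite pnatr_eq0.
have p0 : pi != 0 :> R by rewrite gt_eqF// pi_gt0.
move: (n.*2.+2%:R) N0 (sin _) (cos _) => q N0 sn cs.
by move: (pi : R) p0 => p p0; field; rewrite N0 p0.
Qed.

Lemma cospiD1 u : cos (pi * (u + 1)) = - cos (pi * u).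
Proof. by rewrite mulrDr mulr1 cosDpi. Qed.

Lemma sinpiD1 u : sin (pi * (u + 1)) = - sin (pi * u).
Proof. by rewrite mulrDr mulr1 sinDpi. Qed.

Lemma exprNdouble n (c : R) : (- c) ^+ n.*2 = c ^+ n.*2.
Proof. by rewrite exprNn -mul2n exprM sqrrN expr1n expr1n mul1r. Qed.

Lemma coskernelD1 n u : coskernel n (u + 1) = coskernel n u.
Proof. by rewrite /coskernel cospiD1 exprNdouble. Qed.

Lemma cosprimD1 n u : cosprim n (u + 1) = cosprim n u + cosmass n.
Proof.
elim: n => //= n IH; rewrite IH cospiD1 sinpiD1 !exprS exprNdouble; ring.
Qed.

Lemma cosprim2D1 n : exists b, forall u,
  cosprim2 n (u + 1) = cosprim2 n u + cosmass n * u + b.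
Proof.
elim: n => [|n [b IH]]; first by exists (1 / 2) => u /=; lra.
exists (n.*2.+1%:R / n.*2.+2%:R * b) => u /=.
by rewrite IH cospiD1 -[n.*2.+2]doubleS exprNdouble; ring.
Qed.

Lemma continuous_cospi_reflect x : continuous (fun y : R => cos (pi * (x - y))).
Proof.
move=> y; apply: (@continuous_comp _ _ _ (fun y => pi * (x - y)) cos).
  by apply: cvgM; [exact: cvg_cst|apply: cvgB; [exact: cvg_cst|exact: cvg_id]].
exact: continuous_cos.
Qed.

Lemma continuous_coskernel n x : continuous (fun y : R => coskernel n (x - y)).
Proof.
move=> y; apply: (@continuous_comp _ _ _ (fun y => cos (pi * (x - y))) (fun c => c ^+ n.*2)).
  exact: continuous_cospi_reflect.
exact: exprn_continuous.
Qed.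

Lemma is_derive_reflect (F : R -> R) f x y : is_derive (x - y) 1 F f ->
  is_derive y 1 (fun y : R => F (x - y)) (- f).
Proof.
move=> dF; have h : is_derive y 1 (fun y : R => x - y) (-1).
  by apply: (is_derive_eq (is_deriveB (is_derive_cst x y 1) (is_derive_id y 1))); rewrite add0r.
by have := @is_derive1_comp _ F (fun y => x - y) _ _ _ dF h; rewrite mulrN1.
Qed.

Lemma continuous_cosprim n x : continuous (fun y : R => cosprim n (x - y)).
Proof.
move=> y; apply: differentiable_continuous; apply/derivable1_diffP.
by have := is_derive_reflect _ _ x y (is_derive_cosprim n (x - y)) => -[].
Qed.

Lemma integral_coskernel n x :
  II 0 1 (fun y => coskernel n (x - y)) = cosmass n.
Proof.
have dF y : is_derive y 1 (fun y => - cosprim n (x - y)) (coskernel n (x - y)).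
  have := is_derive_reflect _ _ x y (is_derive_cosprim n (x - y)).
  by move=> /is_deriveN; rewrite opprK.
rewrite (Rintegral_itv_derive _ _ _ _ _ ler01 (continuous_coskernel n x) dF).
rewrite subr0 -[in cosprim n x](subrK 1 x) cosprimD1; ring.
Qed.

Lemma integral_cosprim n x x' :
  II 0 1 (fun y => cosprim n (x' - y) - cosprim n (x - y)) = cosmass n * (x' - x).
Proof.
have dF y : is_derive y 1 (fun y => cosprim2 n (x - y) - cosprim2 n (x' - y))
    (cosprim n (x' - y) - cosprim n (x - y)).
  have h := is_derive_reflect _ _ x y (is_derive_cosprim2 n (x - y)).
  have h' := is_derive_reflect _ _ x' y (is_derive_cosprim2 n (x' - y)).
  apply: (is_derive_eq (is_deriveB h h')).
  by rewrite opprK addrC.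
rewrite (Rintegral_itv_derive _ _ _ _ _ ler01 _ dF); last first.
  by move=> y; apply: cvgB; exact: continuous_cosprim.
have [b hb] := cosprim2D1 n.
have hx := hb (x - 1); have hx' := hb (x' - 1); rewrite !subrK in hx hx'.
rewrite !subr0 hx hx'; ring.
Qed.

Lemma cosprim_homo n : {homo cosprim n : x y / x <= y}.
Proof.
move=> x y xy; rewrite -subr_ge0.
rewrite -(Rintegral_itv_derive _ _ _ _ _ xy _ (is_derive_cosprim n)).
  by apply: Rintegral_itv_ge0 => z _ _; exact: coskernel_ge0.
move=> u; rewrite /coskernel.
apply: (@continuous_comp _ _ _ (fun u => cos (pi * u)) (fun c => c ^+ n.*2)).
  apply: continuous_comp; last exact: continuous_cos.
  by apply: cvgM; [exact: cvg_cst|exact: cvg_id].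
exact: exprn_continuous.
Qed.

End cosine_kernel.

Arguments coskernel {R} n u.
Arguments cosprim {R} n u.
Arguments cosprim2 {R} n u.

Section approximate_identity.
Variable R : realType.
Implicit Types (u x y : R) (n : nat).

Local Notation "'II' a b f" := (\int[@lebesgue_measure R]_(x in `[a, b]) f x)
  (at level 10, a, b, f at level 9).

Lemma periodic_int (T : Type) (h : R -> T) : (forall u, h (u + 1) = h u) ->
  forall (k : int) u, h (u + k%:~R) = h u.
Proof.
move=> h1; have hn (n : nat) u : h (u + n%:R) = h u.
  by elim: n => [|n IH]; rewrite ?addr0// -natr1 addrA h1.
case=> n u; first exact: hn.
by rewrite NegzE intrN -[in RHS](subrK (n.+1%:~R) u) hn.
Qed.

(** Away from the period lattice [sin ^+ 2] is bounded below, and close to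
    it a continuous periodic function varies little. *)
Lemma periodic_modulus (h : R -> R) x e : continuous h ->
  (forall u, h (u + 1) = h u) -> 0 < e ->
  exists2 K, 0 <= K & forall y, `|h y - h x| <= e + K * sin (pi * (x - y)) ^+ 2.
Proof.
move=> ch h1 e0; have hZ := periodic_int _ h h1.
have /cvgrPdist_lt/(_ _ e0) := ch x.
move=> /nbhs_ballP[dl /= dl0 hdl].
have [M M0 hM] := continuous_bounded_itv _ h (x - 1) (x + 1) ch.
set d := Num.min dl (1 / 4).
have d0 : 0 < d by rewrite lt_min dl0; lra.
have d2 : d <= 1 / 4 by rewrite ge_min lexx orbT.
have p0 := pi_gt0 R.
have pd0 : 0 < sin (pi * d).
  apply: sin_gt0_pihalf; rewrite mulr_gt0//= ltr_pM2l//; lra.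
exists (2 * M / sin (pi * d) ^+ 2) => [|y].
  by rewrite divr_ge0 ?sqr_ge0 ?mulr_ge0.
set k := Num.floor (x - y + 1 / 2).
have hk : k%:~R <= x - y + 1 / 2 < k%:~R + 1.
  by have := floor_itv (x - y + 1 / 2); rewrite intrD.
have -> : sin (pi * (x - y)) ^+ 2 = sin (pi * (x - (y + k%:~R))) ^+ 2.
  have hs u : sin (pi * (u + 1)) ^+ 2 = sin (pi * u) ^+ 2 by rewrite sinpiD1 sqrrN.
  have := @periodic_int _ (fun u => sin (pi * u) ^+ 2) hs k (x - (y + k%:~R)).
  by move=> <-; congr (sin (pi * _) ^+ 2); lra.
rewrite -(hZ k y); set z := y + k%:~R.
have zx : `|x - z| <= 1 / 2.
  by move: hk => /andP[hk1 hk2]; rewrite ler_norml /z; apply/andP; split; lra.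
have [lt|ge] := ltP `|x - z| d.
  have : `|h x - h z| < e.
    apply: hdl; rewrite /ball/=; apply: (lt_le_trans lt).
    by rewrite ge_min lexx.
  rewrite distrC => /ltW/le_trans; apply; rewrite lerDl mulr_ge0 ?sqr_ge0//.
  by rewrite divr_ge0 ?sqr_ge0 ?mulr_ge0.
have s2 : sin (pi * d) ^+ 2 <= sin (pi * (x - z)) ^+ 2.
  have -> : sin (pi * (x - z)) ^+ 2 = sin (pi * `|x - z|) ^+ 2.
    by have [_|_] := ger0P (x - z); rewrite ?mulrN ?sinN ?sqrrN.
  have : sin (pi * d) <= sin (pi * `|x - z|).
    rewrite leNgt ltr_sin ?in_itv/= -?leNgt; first by rewrite ler_pM2l.
      by apply/andP; split; nra.
    by apply/andP; split; nra.
  by move=> hs; rewrite ler_sqr ?nnegrE// ?ltW//; exact: lt_le_trans hs.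
have hzx : `|h z - h x| <= 2 * M.
  have := ler_normB (h z) (h x).
  have := hM z; have := hM x; rewrite ler_norml in zx.
  move=> /(_ _)/(_ _) hx /(_ _)/(_ _) hz.
  have := hx ltac:(lra) ltac:(lra); have := hz ltac:(lra) ltac:(lra); lra.
apply: (le_trans hzx); move: s2 pd0; move: (sin (pi * d)) (sin _) => q r s2 pd0.
rewrite -mulrA ler_wpDl ?(ltW e0)// [leRHS]mulrC ler_peMl ?mulr_ge0//.
by rewrite mulrC ler_pdivlMr ?mul1r// exprn_gt0.
Qed.

Lemma coskernel_approx (h : R -> R) x e : continuous h ->
  (forall u, h (u + 1) = h u) -> 0 < e ->
  exists2 K, 0 <= K & forall n,
    `|II 0 1 (fun y => h y * coskernel n (x - y)) - cosmass R n * h x|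
    <= cosmass R n * (e + K / n.*2.+2%:R).
Proof.
move=> ch h1 e0; have [K K0 hK] := periodic_modulus h x e ch h1 e0.
exists K => // n.
have cE m := continuous_coskernel R m x.
have -> : cosmass R n * h x = II 0 1 (fun y => h x * coskernel n (x - y)).
  by rewrite Rintegral_itvZ// integral_coskernel mulrC.
rewrite -Rintegral_itvN; last 2 first.
- by move=> y; apply: cvgM; [exact: ch|exact: cE].
- by move=> y; apply: cvgM; [exact: cvg_cst|exact: cE].
apply: (le_trans (Rintegral_itv_norm _ _ _ _ _)).
  move=> y; apply: cvgB; apply: cvgM; try exact: cE; [exact: ch|exact: cvg_cst].
have E y : coskernel n (x - y) * sin (pi * (x - y)) ^+ 2 =
    coskernel n (x - y) - coskernel n.+1 (x - y).
  have -> : sin (pi * (x - y)) ^+ 2 = 1 - cos (pi * (x - y)) ^+ 2.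
    by apply/eqP; rewrite eq_sym subr_eq addrC cos2Dsin2.
  by rewrite /coskernel doubleS !exprS; ring.
have -> : cosmass R n * (e + K / n.*2.+2%:R) =
    II 0 1 (fun y => e * coskernel n (x - y)
              + K * (coskernel n (x - y) - coskernel n.+1 (x - y))).
  rewrite Rintegral_itvD ?Rintegral_itvZ ?Rintegral_itvN// ?integral_coskernel.
  - by rewrite cosmassS; ring.
  - by move=> y; apply: cvgB; exact: cE.
  - by move=> y; apply: cvgM; [exact: cvg_cst|exact: cE].
  - by move=> y; apply: cvgM; [exact: cvg_cst|apply: cvgB; exact: cE].
apply: Rintegral_itv_le.
- apply: continuous_normr => y.
  by apply: cvgB; apply: cvgM; try exact: cE; [exact: ch|exact: cvg_cst].
- move=> y; apply: cvgD; apply: cvgM; try exact: cE; try exact: cvg_cst.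
  by apply: cvgB; exact: cE.
move=> y _ _; rewrite -E -mulrBl normrM (ger0_norm (coskernel_ge0 _ _ _)).
rewrite [leRHS](_ : _ = (e + K * sin (pi * (x - y)) ^+ 2) * coskernel n (x - y)).
  by rewrite ler_wpM2r// coskernel_ge0.
by ring.
Qed.

(** Testing a periodic function against differences of translates of the kernel
    [coskernel] is enough to detect its Lipschitz constant. *)
Lemma lipschitz_of_kernel_test (h : R -> R) L : continuous h ->
  (forall u, h (u + 1) = h u) ->
  (forall n x x', x <= x' ->
    `|II 0 1 (fun y => h y * (coskernel n (x - y) - coskernel n (x' - y)))|
    <= L * II 0 1 (fun y => cosprim n (x' - y) - cosprim n (x - y))) ->
  forall x x', `|h x - h x'| <= L * `|x - x'|.
Proof.
move=> ch h1 hL x x'; wlog xx' : x x' / x <= x'.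
  by move=> H; have [/H//|/ltW/H] := leP x x'; rewrite distrC [`|x' - x|]distrC.
apply/ler_addgt0Pr => e e0; have e40 : 0 < e / 4 by rewrite divr_gt0.
have [K K0 hK] := coskernel_approx h x _ ch h1 e40.
have [K' K'0 hK'] := coskernel_approx h x' _ ch h1 e40.
pose n := Num.truncn ((K + K') / (e / 4)).
have nbig : (K + K') / n.*2.+2%:R <= e / 4.
  rewrite ler_pdivrMr// mulrC -ler_pdivrMr//.
  apply: (@le_trans _ _ n.+1%:R); first by rewrite ltW// truncnS_gt.
  by rewrite ler_nat -doubleS -addnn leq_addr.
have := hK n; have := hK' n; have := hL n x x' xx'.
have cE z := @continuous_coskernel R n z.
rewrite integral_cosprim.
under eq_Rintegral do rewrite mulrBr.
rewrite Rintegral_itvN; last 2 first.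
- by move=> y; apply: cvgM; [exact: ch|exact: cE].
- by move=> y; apply: cvgM; [exact: ch|exact: cE].
have -> : `|x - x'| = x' - x by rewrite distrC ger0_norm// subr_ge0.
have m0 := cosmass_gt0 R n.
move: (Rintegral _ _ _) (Rintegral _ _ _) => b a h3 h2 h4.
rewrite -(ler_pM2l m0) -[X in X * `|_ - _|](ger0_norm (ltW m0)) -normrM.
have -> : cosmass R n * (h x - h x') =
  (cosmass R n * h x - a) + (a - b) + (b - cosmass R n * h x') by ring.
apply: (le_trans (ler_normD _ _)); apply: (le_trans (lerD (ler_normD _ _) (lexx _))).
rewrite (distrC _ a).
apply: (le_trans (lerD (lerD h4 h3) h2)).
have := ler_wpM2l (ltW m0) nbig; have := mulr_gt0 m0 e0.
move: (n.*2.+2%:R^-1) (cosmass R n) => q m.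
by rewrite mulrDl !mulrDr; lra.
Qed.

End approximate_identity.

(** Test functions: the algebra generated by the cosines of affine forms. *)
Inductive trigonometric (R : realType) (V : normedModType R) : (V -> R) -> Prop :=
| trig_cst c : trigonometric R V (fun=> c)
| trig_cos (l : {linear V -> R}) b : continuous l ->
    trigonometric R V (fun x => cos (pi * l x + b))
| trig_add f g : trigonometric R V f -> trigonometric R V g ->
    trigonometric R V (fun x => f x + g x)
| trig_mul f g : trigonometric R V f -> trigonometric R V g ->
    trigonometric R V (fun x => f x * g x).
Arguments trigonometric {R V} f.

Section trigonometric_theory.
Variables (R : realType) (V : normedModType R).
Implicit Types (f g : V -> R).

Lemma trig_exp f n : trigonometric f -> trigonometric (fun x => f x ^+ n).
Proof.
move=> tf; elim: n => [|n IH].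
  by under eq_fun do rewrite expr0; exact: trig_cst.
by under eq_fun do rewrite exprS; exact: trig_mul.
Qed.

Lemma differentiable_cos (x : R) : differentiable (cos : R -> R) x.
Proof. by apply/derivable1_diffP; have := is_derive_cos x => -[]. Qed.

Lemma differentiable_trig_cos (l : {linear V -> R}) b x : continuous l ->
  differentiable (fun x => cos (pi * l x + b)) x.
Proof.
move=> cl; apply: (@differentiable_comp _ _ _ _ (fun x => pi * l x + b) cos).
  apply: differentiableD; last exact: differentiable_cst.
  apply: differentiableM; first exact: differentiable_cst.
  exact: linear_differentiable.
exact: differentiable_cos.
Qed.

Lemma trigonometric_differentiable f : trigonometric f -> forall x, differentiable f x.
Proof.
elim=> [c x|l b cl x|f1 g1 _ df _ dg x|f1 g1 _ df _ dg x].
- exact: differentiable_cst.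
- exact: differentiable_trig_cos.
- by apply: differentiableD; [exact: df|exact: dg].
- by apply: differentiableM; [exact: df|exact: dg].
Qed.

Lemma trigonometric_derive f v : trigonometric f ->
  trigonometric ('D_v f : V -> R).
Proof.
elim=> [c|l b cl|f1 g1 tf df tg dg|f1 g1 tf df tg dg].
- rewrite (_ : 'D_v _ = fun=> 0); first exact: trig_cst.
  by apply/funext => x; rewrite derive_cst.
- rewrite (_ : 'D_v _ = fun x => (pi * l v) * cos (pi * l x + (b + pi / 2))).
    by apply: trig_mul; [exact: trig_cst|exact: trig_cos].
  apply/funext => x; rewrite deriveE; last exact: differentiable_trig_cos.
  have dl : differentiable (fun x => pi * l x + b) x.
    apply: differentiableD; last exact: differentiable_cst.
    apply: differentiableM; first exact: differentiable_cst.
    exact: linear_differentiable.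
  have dll : differentiable l x by exact: linear_differentiable.
  rewrite (@diff_comp _ _ _ _ (fun x => pi * l x + b) cos)//; last exact: differentiable_cos.
  rewrite /= addrA cosDpihalf.
  have -> : 'd (fun x => pi * l x + b) x v = pi * l v.
    rewrite -deriveE// deriveD; last 2 first.
    + by apply: diff_derivable; apply: differentiableM.
    + exact: derivable_cst.
    rewrite derive_cst addr0 deriveM//; last exact: diff_derivable.
    rewrite derive_cst/= scaler0 addr0; congr (_ * _).
    by rewrite deriveE// diff_lin.
  rewrite -[pi * l v in LHS]mulr1 -[_ * 1]/((pi * l v) *: (1 : R)) linearZ/=.
  rewrite -deriveE; last exact: differentiable_cos.
  by have := is_derive_cos (pi * l x + b) => -[_ ->].
- rewrite (_ : 'D_v _ = fun x => 'D_v f1 x + 'D_v g1 x); first exact: trig_add.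
  apply/funext => x; rewrite deriveD//; apply: diff_derivable;
    exact: trigonometric_differentiable.
- rewrite (_ : 'D_v _ = fun x => f1 x * 'D_v g1 x + g1 x * 'D_v f1 x).
    by apply: trig_add; exact: trig_mul.
  apply/funext => x; rewrite deriveM//; apply: diff_derivable;
    exact: trigonometric_differentiable.
Qed.

Lemma trigonometric_smooth f : trigonometric f -> smooth f.
Proof.
move=> tf s x; apply: trigonometric_differentiable.
by elim: s => //= v s IH; exact: trigonometric_derive.
Qed.

End trigonometric_theory.

Section weak_derivative_test.
Variable R : realType.

Lemma trig_coskernel (V : normedModType R) (l : {linear V -> R}) n (x : R) :
  continuous l -> trigonometric (fun z => coskernel n (x - l z)).
Proof.
move=> cl; apply: trig_exp.
rewrite (_ : (fun z => _) = fun z => cos (pi * l z + - (pi * x))).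
  exact: trig_cos.
by apply/funext => z; rewrite -cosN; congr cos; ring.
Qed.

Lemma trig_cosprimB (V : normedModType R) (l : {linear V -> R}) n (x x' : R) :
  continuous l -> trigonometric (fun z => cosprim n (x' - l z) - cosprim n (x - l z)).
Proof.
move=> cl; elim: n => [|n IH].
  rewrite (_ : (fun z => _) = fun=> x' - x); first exact: trig_cst.
  by apply/funext => z /=; ring.
pose P y := fun z => cos (pi * (y - l z)) ^+ n.*2.+1 * sin (pi * (y - l z)).
have tP y : trigonometric (P y).
  apply: trig_mul.
    apply: trig_exp.
    rewrite (_ : (fun z => _) = fun z => cos (pi * l z + - (pi * y))).
      exact: trig_cos.
    by apply/funext => z; rewrite -cosN; congr cos; ring.
  rewrite (_ : (fun z => _) = fun z => cos (pi * l z + (- (pi * y) + pi / 2))).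
    exact: trig_cos.
  apply/funext => z; rewrite addrA cosDpihalf -sinN; congr sin; ring.
set a := n.*2.+1%:R / n.*2.+2%:R : R; set b := (pi * n.*2.+2%:R)^-1 : R.
rewrite (_ : (fun z => _) = fun z => a * (cosprim n (x' - l z) - cosprim n (x - l z))
    + (b * P x' z + (- b) * P x z)).
  apply: trig_add; first by apply: trig_mul => //; exact: trig_cst.
  by apply: trig_add; apply: trig_mul => //; exact: trig_cst.
by apply/funext => z /=; rewrite /P -/a -/b; ring.
Qed.

Lemma periodic_torus_lift (h : R -> R) : (forall u, h (u + 1) = h u) ->
  exists phi : torus R -> R, phi \o @torus_pi R = h.
Proof.
move=> h1; exists (h \o repr); apply/funext => u /=.
have /torus_pi_eqP[k ->] : torus_pi (repr (torus_pi u)) = torus_pi u.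
  by rewrite {1}/torus_pi reprK.
exact: periodic_int.
Qed.

Lemma periodic_torus_lift2 (f g : R -> R) : (forall u, f (u + 1) = f u) ->
  (forall u, g (u + 1) = g u) ->
  exists phi : torus R * torus R -> R, phi \o @torus_pi2 R = fun z => f z.1 * g z.2.
Proof.
move=> /periodic_torus_lift[phi hphi] /periodic_torus_lift[psi hpsi].
exists (fun z => phi z.1 * psi z.2); apply/funext => z /=.
by rewrite -hphi -hpsi.
Qed.

Lemma Lnorm_oo_bound d (T : measurableType d) (m : {measure set T -> \bar R})
    (f : T -> R) : (0 < m setT)%E -> ('N[m]_+oo[EFin \o f] < +oo)%E ->
  exists2 M, 0 <= M & {ae m, forall x, `|f x| <= M}.
Proof.
move=> m0; rewrite unlock /= m0 => /ess_supr_bounded[M hM].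
exists `|M|; first exact: normr_ge0.
by apply: filterS hM => x /le_trans; apply; exact: ler_norm.
Qed.

Lemma Rintegral_ae_bound d (T : measurableType d) (m : {measure set T -> \bar R})
    (D : set T) (g k : T -> R) M : measurable D -> 0 <= M ->
  measurable_fun D g -> {ae m, forall x, `|g x| <= M} ->
  m.-integrable D (EFin \o k) -> (forall x, D x -> 0 <= k x) ->
  `|\int[m]_(x in D) (g x * k x)| <= M * \int[m]_(x in D) k x.
Proof.
move=> mD M0 mg gM ik k0.
have mk : measurable_fun D k by apply/measurable_EFinP; case/integrableP: ik.
have mgk : measurable_fun D (fun x => g x * k x) by exact: measurable_funM.
have iMk : m.-integrable D (EFin \o (fun x => M * k x)).
  by have := integrableZl mD M ik.
have le1 : (\int[m]_(x in D) `|(g x * k x)%:E| <= \int[m]_(x in D) (M * k x)%:E)%E.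
  apply: ae_ge0_le_integral => //.
  - by apply: measurableT_comp => //; exact/measurable_EFinP.
  - by move=> x Dx; rewrite lee_fin mulr_ge0// k0.
  - by case/integrableP: iMk.
  - apply: filterS gM => x hx Dx.
    by rewrite lee_fin normrM (ger0_norm (k0 _ Dx)) ler_wpM2r// k0.
have igk : m.-integrable D (EFin \o (fun x => g x * k x)).
  apply/integrableP; split; first exact/measurable_EFinP.
  apply: (le_lt_trans le1).
  have /integrableP[_] := iMk; under eq_integral => x /[!inE] Dx do
    rewrite /= ger0_norm ?mulr_ge0 ?k0//; exact.
apply: (le_trans (le_normr_Rintegral mD igk)).
rewrite -RintegralZl//; apply: fine_le => //.
- by have := integrable_norm igk; exact: integrable_fin_num.
- exact: integrable_fin_num.
Qed.

Lemma lebesgue_measure_itv01 : @lebesgue_measure R `[0, 1]%classic = 1%:E.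
Proof.
apply: (etrans (@lebesgue_measure_itv R `[0, 1])).
by rewrite /= lte_fin ltr01 oppr0 adde0.
Qed.

Lemma lebesgue_measureT_gt0 : (0 < @lebesgue_measure R setT)%E.
Proof.
apply: (@lt_le_trans _ _ 1%:E); first by rewrite lte_fin.
by rewrite -lebesgue_measure_itv01; apply: le_measure; rewrite ?inE.
Qed.

(** The difference of two translates of [cosprim n] is a nonnegative periodic test
    function whose derivative is a difference of translates of [coskernel n], so that
    the bound on the weak derivative is the hypothesis of [lipschitz_of_kernel_test]. *)
Theorem W1oo_lipschitz (mu : torus R -> R) : continuous mu -> in_Wkoo_torus 1 mu ->
  exists2 L, 0 <= L & forall x y, `|mu x - mu y| <= L * torus_dist x y.
Proof.
move=> cmu [_ /(_ [:: 1])[]// g [mg gfin] wd].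
have [M M0 gM] := Lnorm_oo_bound _ _ _ _ lebesgue_measureT_gt0 gfin.
exists M => //; apply: torus_lipschitz.
have cpi : continuous (@torus_pi R).
  by apply/continuousP => U oU; exact: oU.
have ch : continuous (mu \o @torus_pi R).
  by move=> x; apply: continuous_comp; [exact: cpi|exact: cmu].
have h1 u : (mu \o @torus_pi R) (u + 1) = (mu \o @torus_pi R) u.
  by rewrite /=; congr mu; exact: (torus_pi_int _ u 1).
apply: (lipschitz_of_kernel_test _ (mu \o @torus_pi R) M ch h1) => n x x' xx'.
pose Psi y := cosprim n (x' - y) - cosprim n (x - y).
have tPsi : trigonometric Psi.
  by apply: (trig_cosprimB _ idfun n x x') => y; exact: cvg_id.
have Psi1 u : Psi (u + 1) = Psi u.
  have := cosprimD1 R n (x' - (u + 1)); have := cosprimD1 R n (x - (u + 1)).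
  have E z : z - (u + 1) + 1 = z - u by ring.
  by rewrite /Psi !E => -> ->; ring.
have [phi hphi] := periodic_torus_lift _ Psi1.
have := wd phi; rewrite hphi => /(_ (trigonometric_smooth _ _ _ tPsi)).
have phiE y : phi (torus_pi y) = Psi y by rewrite -hphi.
have dPsi y : 'D_1 Psi y = coskernel n (x - y) - coskernel n (x' - y).
  have h := is_derive_reflect _ _ _ x y (is_derive_cosprim _ n (x - y)).
  have h' := is_derive_reflect _ _ _ x' y (is_derive_cosprim _ n (x' - y)).
  by have [_ ->] := is_deriveB h' h; rewrite opprK addrC.
under eq_Rintegral do rewrite /= dPsi.
move=> ->; under eq_Rintegral do rewrite phiE.
rewrite expr1 mulN1r normrN.
have cPsi : continuous Psi.
  by move=> y; apply: cvgB; exact: continuous_cosprim.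
apply: Rintegral_ae_bound => //.
- exact: measurable_funS mg.
- exact: continuous_integrable.
- by move=> y _; rewrite /Psi subr_ge0 cosprim_homo// lerB.
Qed.

End weak_derivative_test.

Section two_variables.
Variable R : realType.
Local Notation "'II' a b f" := (\int[@lebesgue_measure R]_(x in `[a, b]) f x)
  (at level 10, a, b, f at level 9).
Local Notation square := (`[(0 : R), 1] `*` `[(0 : R), 1]).

Lemma continuous_section1 (F : R * R -> R) x : continuous F ->
  continuous (fun y => F (x, y)).
Proof.
move=> cF y; apply: (@continuous_comp _ _ _ (fun y => (x, y)) F); last exact: cF.
by apply: (@cvg_pair _ _ _ (nbhs y) (nbhs x) (nbhs y)); [exact: cvg_cst|exact: cvg_id].
Qed.

Lemma continuous_section2 (F : R * R -> R) y : continuous F ->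
  continuous (fun x => F (x, y)).
Proof.
move=> cF x; apply: (@continuous_comp _ _ _ (fun x => (x, y)) F); last exact: cF.
by apply: (@cvg_pair _ _ _ (nbhs x) (nbhs x) (nbhs y)); [exact: cvg_id|exact: cvg_cst].
Qed.

Lemma continuous_bounded_square (F : R * R -> R) : continuous F ->
  exists2 M, 0 <= M & forall z, square z -> `|F z| <= M.
Proof.
move=> cF.
have cpt : compact square by apply: compact_setX; exact: segment_compact.
have /compact_bounded[M [_ hM]] : compact (F @` square).
  by apply: continuous_compact => //; exact: continuous_subspaceT.
exists (`|M| + 1) => [|z sz]; first by rewrite addr_ge0.
by apply: (hM (`|M| + 1)); [have := ler_norm M; lra|exists z].
Qed.

Lemma lebesgue_measure_square : @lebesgue_measure2 R square = 1%:E.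
Proof.
apply: (etrans (product_measure1E _ _ _ _)) => //.
have E := lebesgue_measure_itv01 R.
by apply: (etrans (congr2 _ E E)); rewrite mul1e.
Qed.

Lemma continuous_integrable_square (F : R * R -> R) : continuous F ->
  measurable_fun setT F ->
  (@lebesgue_measure2 R).-integrable square (EFin \o F).
Proof.
move=> cF mF; have [M M0 hM] := continuous_bounded_square F cF.
have mS : measurable (square : set (R * R)) by apply: measurableX.
apply: measurable_bounded_integrable => //.
- by apply: (@le_lt_trans _ _ 1%:E); [rewrite -lebesgue_measure_square|exact: ltry].
- exact: measurable_funS mF.
- exists M; split; first exact: num_real.
  by move=> K MK z sz; apply: (le_trans (hM z sz)); exact: ltW.
Qed.

(** Each order of integration is needed, because the derivative may fall on
    either variable. *)
Lemma Rintegral_square (F : R * R -> R) : continuous F -> measurable_fun setT F ->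
  \int[@lebesgue_measure2 R]_(z in square) F z = II 0 1 (fun x => II 0 1 (fun y => F (x, y)))
  /\ \int[@lebesgue_measure2 R]_(z in square) F z = II 0 1 (fun y => II 0 1 (fun x => F (x, y))).
Proof.
move=> cF mF.
have iF : (@lebesgue_measure R \x @lebesgue_measure R)%E.-integrable setT
    ((EFin \o F) \_ square).
  apply: (iffLR (integrable_mkcond _ _)); last exact: continuous_integrable_square.
  exact: measurableX.
have inner (G : R -> R) : continuous G ->
    (\int[@lebesgue_measure R]_(x in `[0%R : R, 1%R]) (G x)%:E)%E = (II 0 1 G)%:E.
  move=> cG; rewrite /Rintegral fineK//.
  by apply: integrable_fin_num => //; exact: continuous_integrable.
split; rewrite {1}/Rintegral integral_mkcond /lebesgue_measure2.
- rewrite -integral12_prod_meas1// /fubini_F [RHS]/Rintegral [in RHS]integral_mkcond.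
  congr fine; apply: eq_integral => x _; rewrite /patch/=.
  case: ifPn => [/set_mem /= xI|xI].
    rewrite -inner; last exact: continuous_section1.
    rewrite [in RHS]integral_mkcond; apply: eq_integral => y _; rewrite /patch/=.
    have -> // : ((x, y) \in square) = (y \in `[0, 1]%classic).
    by apply/idP/idP => [/set_mem[_ h]|/set_mem h]; apply/mem_set => //; split.
  rewrite integral0_eq// => y _; case: ifPn => // /set_mem[/= h _].
  by move: xI; rewrite notin_setE.
- rewrite -integral21_prod_meas1// /fubini_G [RHS]/Rintegral [in RHS]integral_mkcond.
  congr fine; apply: eq_integral => y _; rewrite /patch/=.
  case: ifPn => [/set_mem /= yI|yI].
    rewrite -inner; last exact: continuous_section2.
    rewrite [in RHS]integral_mkcond; apply: eq_integral => x _; rewrite /patch/=.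
    have -> // : ((x, y) \in square) = (x \in `[0, 1]%classic).
    by apply/idP/idP => [/set_mem[h _]|/set_mem h]; apply/mem_set => //; split.
  rewrite integral0_eq// => x _; case: ifPn => // /set_mem[_ /= h].
  by move: yI; rewrite notin_setE.
Qed.

Lemma continuous_partial_integral (F : R * R -> R) : continuous F ->
  continuous (fun x => II 0 1 (fun y => F (x, y))).
Proof.
move=> cF x; apply/cvgrPdist_le => e e0.
have /compact_near_coveringP ncov := @segment_compact R 0 1.
have [] := ncov R (nbhs x) (fun x' y => `|F (x, y) - F (x', y)| <= e).
  move=> y _; have e20 : 0 < e / 2 by rewrite divr_gt0.
  have /cvgrPdist_le/(_ _ e20) := cF (x, y).
  move=> [[U V] /= [Ux Vy] UV].
  exists (V, U); first by split.
  move=> [y' x'] /= [Vy' Ux'].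
  have h1 := UV (x', y') (conj Ux' Vy').
  have h2 := UV (x, y') (conj (nbhs_singleton Ux) Vy').
  apply: (le_trans (ler_distD (F (x, y)) _ _)); rewrite (distrC (F (x, y'))).
  by rewrite [e]splitr lerD.
move=> dl /= dl0 hdl; apply/nbhs_ballP; exists dl => // x' /= xx'.
rewrite -Rintegral_itvN; [|exact: continuous_section1..].
rewrite -[e]mulr1 -[X in e * X](subr0 1); apply: Rintegral_itv_bound => //.
  by move=> y; apply: cvgB; exact: continuous_section1.
by move=> y y0 y1; apply: (hdl x') => //=; rewrite in_itv/= y0.
Qed.

(** Smearing the second variable reduces a Lipschitz bound in the first
    variable to the case of functions of one variable. *)
Lemma lipschitz_of_kernel_test2 (F : R * R -> R) M : continuous F ->
  (forall u v, F (u + 1, v) = F (u, v)) -> (forall u v, F (u, v + 1) = F (u, v)) ->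
  0 <= M ->
  (forall n m z x x', x <= x' ->
    `|II 0 1 (fun y1 => II 0 1 (fun y2 => F (y1, y2) * coskernel m (z - y2))
        * (coskernel n (x - y1) - coskernel n (x' - y1)))|
    <= M * cosmass R m * II 0 1 (fun y => cosprim n (x' - y) - cosprim n (x - y))) ->
  forall x x' z, `|F (x, z) - F (x', z)| <= M * `|x - x'|.
Proof.
move=> cF F1 F2 M0 HF x x' z.
pose h m y1 := II 0 1 (fun y2 => F (y1, y2) * coskernel m (z - y2)).
have ch m : continuous (h m).
  apply: (continuous_partial_integral (fun y => F y * coskernel m (z - y.2))) => y.
  apply: cvgM; first exact: cF.
  apply: (@continuous_comp _ _ _ snd (fun y => coskernel m (z - y))).
    exact: cvg_snd.
  exact: continuous_coskernel.
have h1 m u : h m (u + 1) = h m u.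
  by apply: eq_Rintegral => y _; rewrite F1.
have hL m := lipschitz_of_kernel_test _ (h m) (M * cosmass R m) (ch m) (h1 m)
  (fun n x x' => HF n m z x x').
apply/ler_addgt0Pr => e e0; have e40 : 0 < e / 4 by rewrite divr_gt0.
have [K K0 hK] := coskernel_approx _ (fun y => F (x, y)) z _
  (continuous_section1 F x cF) (F2 x) e40.
have [K' K'0 hK'] := coskernel_approx _ (fun y => F (x', y)) z _
  (continuous_section1 F x' cF) (F2 x') e40.
pose n := Num.truncn ((K + K') / (e / 4)).
have nbig : (K + K') / n.*2.+2%:R <= e / 4.
  rewrite ler_pdivrMr// mulrC -ler_pdivrMr//.
  apply: (@le_trans _ _ n.+1%:R); first by rewrite ltW// truncnS_gt.
  by rewrite ler_nat -doubleS -addnn leq_addr.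
have := hK n; have := hK' n; have := hL n x x'; rewrite /h.
have m0 := cosmass_gt0 R n.
move: (Rintegral _ _ _) (Rintegral _ _ _) => b a h3 h2 h4.
rewrite -(ler_pM2l m0) -[X in X * `|_ - _|](ger0_norm (ltW m0)) -normrM.
have -> : cosmass R n * (F (x, z) - F (x', z)) =
  (cosmass R n * F (x, z) - a) + (a - b) + (b - cosmass R n * F (x', z)) by ring.
apply: (le_trans (ler_normD _ _)); apply: (le_trans (lerD (ler_normD _ _) (lexx _))).
rewrite (distrC _ a).
apply: (le_trans (lerD (lerD h4 h3) h2)).
have := ler_wpM2l (ltW m0) nbig; have := mulr_gt0 m0 e0.
move: (n.*2.+2%:R^-1) (cosmass R n) => q m.
by rewrite mulrDl !mulrDr; lra.
Qed.

End two_variables.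

Section W2oo.
Variable R : realType.
Local Notation "'II' a b f" := (\int[@lebesgue_measure R]_(x in `[a, b]) f x)
  (at level 10, a, b, f at level 9).
Local Notation square := (`[(0 : R), 1] `*` `[(0 : R), 1]).

Lemma continuous_torus_pi : continuous (@torus_pi R).
Proof. by apply/continuousP => U oU; exact: oU. Qed.

Lemma continuous_torus_pi2 : continuous (@torus_pi2 R).
Proof.
move=> z; apply: (@cvg_pair _ _ _ (nbhs z) (nbhs (torus_pi z.1)) (nbhs (torus_pi z.2))).
- by apply: continuous_comp; [exact: cvg_fst|exact: continuous_torus_pi].
- by apply: continuous_comp; [exact: cvg_snd|exact: continuous_torus_pi].
Qed.

Lemma lebesgue_measure2T_gt0 : (0 < @lebesgue_measure2 R setT)%E.
Proof.
apply: (@lt_le_trans _ _ 1%:E); first by rewrite lte_fin.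
rewrite -lebesgue_measure_square; apply: le_measure; rewrite ?inE//.
exact: measurableX.
Qed.

(** Testing against products of a difference of translates of the primitive
    kernel in one variable and a kernel in the other one. *)
Lemma weak_derivative_test_square (sigma g : torus R * torus R -> R)
    (v : R * R) M (phi : torus R * torus R -> R) :
  0 <= M -> continuous sigma ->
  measurable_fun setT (sigma \o @torus_pi2 R) ->
  measurable_fun setT (g \o @torus_pi2 R) ->
  {ae @lebesgue_measure2 R, forall z, `|(g \o @torus_pi2 R) z| <= M} ->
  is_weak_derivative (@torus_pi2 R)
    (fun F => \int[@lebesgue_measure2 R]_(z in square) F z) [:: v] sigma g ->
  smooth (phi \o @torus_pi2 R) ->
  measurable_fun setT (phi \o @torus_pi2 R) -> continuous (phi \o @torus_pi2 R) ->
  (forall z, 0 <= (phi \o @torus_pi2 R) z) ->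
  `| \int[@lebesgue_measure2 R]_(z in square)
       (sigma (torus_pi2 z) * 'D_v (phi \o @torus_pi2 R) z) |
  <= M * \int[@lebesgue_measure2 R]_(z in square) phi (torus_pi2 z).
Proof.
move=> M0 cs ms mg gM wd sphi mphi cphi phi0.
have /= -> := wd phi sphi; rewrite expr1 mulN1r normrN.
apply: Rintegral_ae_bound => //.
- exact: measurableX.
- exact: measurable_funS mg.
- exact: continuous_integrable_square.
- by move=> z _; exact: phi0.
Qed.

Lemma continuous_comp_fst (f : R -> R) : continuous f -> continuous (fun z : R * R => f z.1).
Proof. by move=> cf z; apply: continuous_comp; [exact: cvg_fst|exact: cf]. Qed.

Lemma continuous_comp_snd (f : R -> R) : continuous f -> continuous (fun z : R * R => f z.2).
Proof. by move=> cf z; apply: continuous_comp; [exact: cvg_snd|exact: cf]. Qed.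

Lemma measurable_prod_fun (f g : R -> R) : continuous f -> continuous g ->
  measurable_fun setT (fun z : measurableTypeR R * measurableTypeR R => f z.1 * g z.2).
Proof.
move=> cf cg; apply: measurable_funM.
- apply: (@measurableT_comp _ _ _ _ _ _ f _ fst); last exact: measurable_fst.
  exact: continuous_measurable_fun.
- apply: (@measurableT_comp _ _ _ _ _ _ g _ snd); last exact: measurable_snd.
  exact: continuous_measurable_fun.
Qed.

Lemma derive_prod1 (f g : R -> R) (df : R) (z : R * R) : is_derive z.1 1 f df ->
  'D_((1, 0) : R * R) (fun z : R * R => f z.1 * g z.2) z = df * g z.2.
Proof.
move=> dfz; transitivity ('D_1 (fun y => f y * g z.2) z.1).
  rewrite /derive; set u := (X in lim (X @ _)); set v := (X in _ = lim (X @ _)).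
  suff -> : u = v by [].
  by apply/funext => h; rewrite /u /v/= scaler0 add0r.
have := is_deriveM dfz (is_derive_cst (g z.2) z.1 1) => -[_ ->].
by rewrite scaler0 add0r mulrC.
Qed.

Lemma derive_prod2 (f g : R -> R) (dg : R) (z : R * R) : is_derive z.2 1 g dg ->
  'D_((0, 1) : R * R) (fun z : R * R => f z.1 * g z.2) z = dg * f z.1.
Proof.
move=> dgz; transitivity ('D_1 (fun y => f z.1 * g y) z.2).
  rewrite /derive; set u := (X in lim (X @ _)); set v := (X in _ = lim (X @ _)).
  suff -> : u = v by [].
  by apply/funext => h; rewrite /u /v/= scaler0 add0r.
have := is_deriveM (is_derive_cst (f z.1) z.2 1) dgz => -[_ ->].
by rewrite scaler0 addr0 mulrC.
Qed.

Lemma Rintegral_square_prod (f g : R -> R) : continuous f -> continuous g ->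
  \int[@lebesgue_measure2 R]_(z in square) (f z.1 * g z.2) = II 0 1 f * II 0 1 g.
Proof.
move=> cf cg; have [-> _] := Rintegral_square _ (fun z : R * R => f z.1 * g z.2)
  (fun z => continuousM (continuous_comp_fst f cf z) (continuous_comp_snd g cg z))
  (measurable_prod_fun f g cf cg).
under eq_Rintegral do rewrite /= Rintegral_itvZ//.
by rewrite RintegralZr//; exact: continuous_integrable.
Qed.

(** The test function is the product of the one of [W1oo_lipschitz], in the variable of
    the derivative, with a kernel in the other variable. *)
Theorem W2oo_lipschitz (sigma : torus R * torus R -> R) : continuous sigma ->
  in_Wkoo_torus2 2 sigma ->
  exists2 L, 0 <= L & forall x x' y y',
    `|sigma (x, y) - sigma (x', y')| <= L * (torus_dist x x' + torus_dist y y').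
Proof.
move=> cs [[ms _] wd].
have cF : continuous (sigma \o @torus_pi2 R).
  by move=> z; apply: continuous_comp; [exact: continuous_torus_pi2|exact: cs].
set F := sigma \o @torus_pi2 R in ms cF.
have F1 u v : F (u + 1, v) = F (u, v).
  by rewrite /F/= /torus_pi2/=; congr (sigma (_, _)); exact: (torus_pi_int _ u 1).
have F2 u v : F (u, v + 1) = F (u, v).
  by rewrite /F/= /torus_pi2/=; congr (sigma (_, _)); exact: (torus_pi_int _ v 1).
pose eta m z y : R := coskernel m (z - y).
pose Psi n x x' y : R := cosprim n (x' - y) - cosprim n (x - y).
pose dPsi n x x' y : R := coskernel n (x - y) - coskernel n (x' - y).
have ceta m z : continuous (eta m z) by exact: continuous_coskernel.
have cPsi n x x' : continuous (Psi n x x').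
  by move=> y; apply: cvgB; exact: continuous_cosprim.
have cdPsi n x x' : continuous (dPsi n x x').
  by move=> y; apply: cvgB; exact: continuous_coskernel.
have eta1 m z u : eta m z (u + 1) = eta m z u.
  by rewrite /eta -[LHS]coskernelD1; congr (coskernel _ _); ring.
have Psi1 n x x' u : Psi n x x' (u + 1) = Psi n x x' u.
  have := cosprimD1 R n (x' - (u + 1)); have := cosprimD1 R n (x - (u + 1)).
  have E z : z - (u + 1) + 1 = z - u by ring.
  by rewrite /Psi !E => -> ->; ring.
have eta0 m z y : 0 <= eta m z y by exact: coskernel_ge0.
have Psi0 n x x' y : x <= x' -> 0 <= Psi n x x' y.
  by move=> xx'; rewrite /Psi subr_ge0 cosprim_homo// lerB.
have dPsiP n (x x' y : R) : is_derive y 1 (Psi n x x') (dPsi n x x' y).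
  have h := is_derive_reflect _ _ _ x y (is_derive_cosprim _ n (x - y)).
  have h' := is_derive_reflect _ _ _ x' y (is_derive_cosprim _ n (x' - y)).
  by apply: (is_derive_eq (is_deriveB h' h)); rewrite opprK addrC.
have [g1 [mg1 g1fin] wd1] := wd [:: (1, 0)] ltac:(by move=> z; rewrite !inE => ->) isT.
have [M1 M10 gM1] := Lnorm_oo_bound _ _ _ _ _ lebesgue_measure2T_gt0 g1fin.
have [g2 [mg2 g2fin] wd2] := wd [:: (0, 1)] ltac:(by move=> z; rewrite !inE orbC => ->) isT.
have [M2 M20 gM2] := Lnorm_oo_bound _ _ _ _ _ lebesgue_measure2T_gt0 g2fin.
have L1 x x' z : `|F (x, z) - F (x', z)| <= M1 * `|x - x'|.
  apply: (lipschitz_of_kernel_test2 _ F M1) => // {x x' z} n m z x x' xx'.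
  have [phi hphi] := periodic_torus_lift2 _ _ _ (Psi1 n x x') (eta1 m z).
  have sphi : smooth (phi \o @torus_pi2 R).
    rewrite hphi; apply: trigonometric_smooth; apply: trig_mul.
      by apply: (trig_cosprimB _ _ fst n x x') => w; exact: cvg_fst.
    by apply: (trig_coskernel _ _ snd m z) => w; exact: cvg_snd.
  have := weak_derivative_test_square _ _ _ _ phi M10 cs ms mg1 gM1 wd1 sphi.
  have phiE w : phi (torus_pi2 w) = Psi n x x' w.1 * eta m z w.2.
    by have /(congr1 (@^~ w)) := hphi.
  under eq_Rintegral do rewrite hphi (derive_prod1 _ _ _ _ (dPsiP _ _ _ _)).
  under [in leRHS]eq_Rintegral do rewrite phiE.
  rewrite hphi Rintegral_square_prod// integral_coskernel.
  have cG : continuous (fun w : R * R => F w * (dPsi n x x' w.1 * eta m z w.2)).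
    move=> w; apply: cvgM; first exact: cF.
    by apply: cvgM; [exact: continuous_comp_fst|exact: continuous_comp_snd].
  have [-> _] := Rintegral_square _ _ cG
    (measurable_funM ms (measurable_prod_fun _ _ (cdPsi n x x') (ceta m z))).
  have cFe y : continuous (fun y2 => F (y, y2) * eta m z y2).
    by move=> y2; apply: cvgM; [exact: continuous_section1|exact: ceta].
  under eq_Rintegral => y _.
    under eq_Rintegral do rewrite /= mulrCA.
    rewrite Rintegral_itvZ// mulrC; over.
  rewrite (mulrC (II 0 1 _)) mulrA; apply.
  - exact: measurable_prod_fun.
  - by move=> w; apply: cvgM; [exact: continuous_comp_fst|exact: continuous_comp_snd].
  - by move=> w; rewrite mulr_ge0// Psi0.
have L2 x x' z : `|F (z, x) - F (z, x')| <= M2 * `|x - x'|.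
  pose Fs := fun w => F (w.2, w.1).
  have cFs : continuous Fs.
    move=> w; apply: (@continuous_comp _ _ _ (fun w => (w.2, w.1)) F); last exact: cF.
    apply: (@cvg_pair _ _ _ (nbhs w) (nbhs w.2) (nbhs w.1)).
      exact: cvg_snd.
    exact: cvg_fst.
  apply: (lipschitz_of_kernel_test2 _ Fs M2 cFs (fun u v => F2 v u) (fun u v => F1 v u) M20).
  move=> {x x' z} n m z x x' xx'.
  have [phi hphi] := periodic_torus_lift2 _ _ _ (eta1 m z) (Psi1 n x x').
  have sphi : smooth (phi \o @torus_pi2 R).
    rewrite hphi; apply: trigonometric_smooth; apply: trig_mul.
      by apply: (trig_coskernel _ _ fst m z) => w; exact: cvg_fst.
    by apply: (trig_cosprimB _ _ snd n x x') => w; exact: cvg_snd.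
  have := weak_derivative_test_square _ _ _ _ phi M20 cs ms mg2 gM2 wd2 sphi.
  have phiE w : phi (torus_pi2 w) = eta m z w.1 * Psi n x x' w.2.
    by have /(congr1 (@^~ w)) := hphi.
  under eq_Rintegral do rewrite hphi (derive_prod2 _ _ _ _ (dPsiP _ _ _ _)) mulrC.
  under [in leRHS]eq_Rintegral do rewrite phiE.
  rewrite hphi Rintegral_square_prod// integral_coskernel.
  have cG : continuous (fun w : R * R => F w * (eta m z w.1 * dPsi n x x' w.2)).
    move=> w; apply: cvgM; first exact: cF.
    by apply: cvgM; [exact: continuous_comp_fst|exact: continuous_comp_snd].
  have [_] := Rintegral_square _ _ cG
    (measurable_funM ms (measurable_prod_fun _ _ (ceta m z) (cdPsi n x x'))).
  have cFe y : continuous (fun y2 => Fs (y, y2) * eta m z y2).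
    by move=> y2; apply: cvgM; [exact: continuous_section1|exact: ceta].
  have -> : II 0 1 (fun y => II 0 1 (fun w => F (w, y) * (eta m z w * dPsi n x x' y))) =
      II 0 1 (fun y => II 0 1 (fun w => Fs (y, w) * eta m z w) * dPsi n x x' y).
    apply: eq_Rintegral => y _; rewrite mulrC -Rintegral_itvZ//.
    by apply: eq_Rintegral => w _; rewrite /Fs/=; ring.
  move=> <- hyp; rewrite -mulrA.
  have -> : II 0 1 (fun y => cosprim n (x' - y) - cosprim n (x - y)) = II 0 1 (Psi n x x') by [].
  have -> : \int[@lebesgue_measure2 R]_(w in square) (F w * (eta m z w.1 * dPsi n x x' w.2))
    = \int[@lebesgue_measure2 R]_(w in square) (dPsi n x x' w.2 * eta m z w.1 * F w).
    by apply: eq_Rintegral => w _; ring.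
  apply: hyp.
  - exact: measurable_prod_fun.
  - by move=> w; apply: cvgM; [exact: continuous_comp_fst|exact: continuous_comp_snd].
  - by move=> w; rewrite mulr_ge0// Psi0.
exists (M1 + M2) => [|x x' y y']; first by rewrite addr_ge0.
apply: (le_trans (ler_distD (sigma (x', y)) _ _)).
have h1 : `|sigma (x, y) - sigma (x', y)| <= M1 * torus_dist x x'.
  apply: (torus_lipschitz _ _ (fun x => sigma (x, y))) => r s.
  by have [q <-] := torus_pi_surj _ y; exact: L1.
have h2 : `|sigma (x', y) - sigma (x', y')| <= M2 * torus_dist y y'.
  apply: (torus_lipschitz _ _ (fun y => sigma (x', y))) => r s.
  by have [q <-] := torus_pi_surj _ x'; exact: L2.
apply: (le_trans (lerD h1 h2)).
have := torus_dist_ge0 _ x x'; have := torus_dist_ge0 _ y y'.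
have : 0 <= M1 * torus_dist y y' by rewrite mulr_ge0// torus_dist_ge0.
have : 0 <= M2 * torus_dist x x' by rewrite mulr_ge0// torus_dist_ge0.
rewrite mulrDl !mulrDr; lra.
Qed.
End W2oo.

(** * Euclidean operator bounds *)

Section l2_theory.
Variable R : realType.

Definition dotv n (x y : 'cV[R]_n) : R := \sum_i x i 0 * y i 0.

Lemma dotvC n (x y : 'cV[R]_n) : dotv n x y = dotv n y x.
Proof. by apply: eq_bigr => i _; rewrite mulrC. Qed.

Lemma l2norm_ge0 n (x : 'cV[R]_n) : 0 <= l2norm x.
Proof. exact: sqrtr_ge0. Qed.

Lemma dotvv_ge0 n (x : 'cV[R]_n) : 0 <= dotv n x x.
Proof. by apply: sumr_ge0 => i _; rewrite -expr2 sqr_ge0. Qed.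

Lemma sqr_l2norm n (x : 'cV[R]_n) : l2norm x ^+ 2 = dotv n x x.
Proof.
rewrite sqr_sqrtr; first by apply: eq_bigr => i _; rewrite expr2.
by apply: sumr_ge0 => i _; rewrite sqr_ge0.
Qed.

Lemma dotvD n (x y z : 'cV[R]_n) : dotv n (x + y) z = dotv n x z + dotv n y z.
Proof. by rewrite -big_split; apply: eq_bigr => i _; rewrite mxE mulrDl. Qed.

Lemma dotvZ n k (x y : 'cV[R]_n) : dotv n (k *: x) y = k * dotv n x y.
Proof. by rewrite mulr_sumr; apply: eq_bigr => i _; rewrite mxE mulrA. Qed.

Lemma dotv_mulmx m n (A : 'M[R]_(m, n)) x y :
  dotv m (A *m x) y = dotv n x (A^T *m y).
Proof.
rewrite /dotv; under eq_bigr do rewrite mxE mulr_suml.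
rewrite exchange_big; apply: eq_bigr => j _.
by rewrite mxE mulr_sumr; apply: eq_bigr => i _; rewrite !mxE; ring.
Qed.

Lemma l2norm0 n : l2norm (0 : 'cV[R]_n) = 0.
Proof. by rewrite /l2norm big1 ?sqrtr0// => i _; rewrite mxE expr0n. Qed.

Lemma l2norm_eq0 n (x : 'cV[R]_n) : l2norm x = 0 -> x = 0.
Proof.
move=> /eqP; rewrite sqrtr_eq0 => h.
have : \sum_i x i 0 ^+ 2 == 0.
  by rewrite eq_le h sumr_ge0// => i _; rewrite sqr_ge0.
rewrite psumr_eq0; last by move=> i _; rewrite sqr_ge0.
move=> /allP hx; apply/matrixP => i j; rewrite !ord1 mxE.
by have := hx i (mem_index_enum i); rewrite /= sqrf_eq0 => /eqP.
Qed.

Lemma cauchy_schwarz n (x y : 'cV[R]_n) : dotv n x y <= l2norm x * l2norm y.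
Proof.
have [y0|y0] := eqVneq (l2norm y) 0.
  rewrite y0 (l2norm_eq0 _ _ y0) mulr0 /dotv big1// => i _.
  by rewrite mxE mulr0.
have ny0 : 0 < l2norm y by rewrite lt0r y0 l2norm_ge0.
have : 0 <= dotv n (dotv n y y *: x + (- dotv n x y) *: y)
  (dotv n y y *: x + (- dotv n x y) *: y) by exact: dotvv_ge0.
rewrite dotvD !dotvZ ![dotv n _ (_ + _)]dotvC !dotvD !dotvZ (dotvC _ y x).
rewrite -!sqr_l2norm => h.
have h2 : dotv n x y ^+ 2 <= (l2norm x * l2norm y) ^+ 2.
  have y2 : 0 < l2norm y ^+ 2 by rewrite exprn_gt0.
  rewrite exprMn -(ler_pM2l y2); move: h; move: (dotv n x y) (l2norm x) (l2norm y) => a b c.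
  nra.
apply: le_trans (ler_norm _) _.
rewrite -ler_sqr ?nnegrE ?mulr_ge0 ?l2norm_ge0//.
by rewrite real_normK ?num_real.
Qed.

Lemma l2normZ n k (x : 'cV[R]_n) : l2norm (k *: x) = `|k| * l2norm x.
Proof.
rewrite /l2norm; under eq_bigr do rewrite mxE exprMn.
by rewrite -mulr_sumr sqrtrM ?sqr_ge0// sqrtr_sqr.
Qed.

Lemma l2normD n (x y : 'cV[R]_n) : l2norm (x + y) <= l2norm x + l2norm y.
Proof.
rewrite -ler_sqr ?nnegrE ?addr_ge0 ?l2norm_ge0// sqr_l2norm.
rewrite dotvD ![dotv n _ (_ + _)]dotvC !dotvD (dotvC _ y x) -!sqr_l2norm.
have := cauchy_schwarz n x y; nra.
Qed.

(** [opb A c] says that [c] bounds the Euclidean operator norm of [A]; unlike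
    the supremum itself it composes without boundedness side conditions. *)
Definition opb m n (A : 'M[R]_(m, n)) (c : R) :=
  forall x, l2norm (A *m x) <= c * l2norm x.
Arguments opb {m n} A c.

Lemma opb_dot m n (A : 'M[R]_(m, n)) c : 0 <= c ->
  (forall x y, dotv m (A *m x) y <= c * l2norm x * l2norm y) -> opb A c.
Proof.
move=> c0 h x; have := h x (A *m x); rewrite -sqr_l2norm.
have := l2norm_ge0 _ (A *m x); rewrite le_eqVlt => /predU1P[<- _|n0].
  by rewrite mulr_ge0 ?l2norm_ge0.
by rewrite expr2 ler_pM2r.
Qed.

Lemma opb_dotP m n (A : 'M[R]_(m, n)) c x y : opb A c ->
  dotv m (A *m x) y <= c * l2norm x * l2norm y.
Proof.
move=> h; apply: (le_trans (cauchy_schwarz _ _ _)).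
by rewrite ler_wpM2r ?l2norm_ge0.
Qed.

Lemma opb_tr m n (A : 'M[R]_(m, n)) c : 0 <= c -> opb A c -> opb A^T c.
Proof.
move=> c0 h; apply: opb_dot => // x y.
rewrite dotvC -dotv_mulmx mulrAC; exact: opb_dotP.
Qed.

Lemma opbD m n (A B : 'M[R]_(m, n)) a b : opb A a -> opb B b -> opb (A + B) (a + b).
Proof.
move=> hA hB x; rewrite mulmxDl mulrDl.
by apply: (le_trans (l2normD _ _ _)); exact: lerD.
Qed.

Lemma opbZ m n (A : 'M[R]_(m, n)) a k : opb A a -> opb (k *: A) (`|k| * a).
Proof. by move=> hA x; rewrite -scalemxAl l2normZ -mulrA ler_wpM2l. Qed.

Lemma opbN m n (A : 'M[R]_(m, n)) a : opb A a -> opb (- A) a.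
Proof. by move=> /(opbZ _ _ _ _ (-1)); rewrite scaleN1r normrN1 mul1r. Qed.

Lemma opbB m n (A B : 'M[R]_(m, n)) a b : opb A a -> opb B b -> opb (A - B) (a + b).
Proof. by move=> hA hB; apply: opbD => //; exact: opbN. Qed.

Lemma opbM m n p (A : 'M[R]_(m, n)) (B : 'M[R]_(n, p)) a b : 0 <= a ->
  opb A a -> opb B b -> opb (A *m B) (a * b).
Proof.
move=> a0 hA hB x; rewrite -mulmxA; apply: (le_trans (hA _)).
by rewrite -mulrA ler_wpM2l.
Qed.

Lemma opb_le m n (A : 'M[R]_(m, n)) a b : a <= b -> opb A a -> opb A b.
Proof.
by move=> ab hA x; apply: (le_trans (hA x)); rewrite ler_wpM2r ?l2norm_ge0.
Qed.

Lemma sum_sqr_cauchy n (x y : 'I_n -> R) :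
  (\sum_i x i * y i) ^+ 2 <= (\sum_i x i ^+ 2) * (\sum_i y i ^+ 2).
Proof.
pose u : 'cV[R]_n := \col_i x i; pose v : 'cV[R]_n := \col_i y i.
have uv : dotv n u v = \sum_i x i * y i by apply: eq_bigr => i _; rewrite !mxE.
have un : l2norm u ^+ 2 = \sum_i x i ^+ 2.
  by rewrite sqr_l2norm; apply: eq_bigr => i _; rewrite !mxE -expr2.
have vn : l2norm v ^+ 2 = \sum_i y i ^+ 2.
  by rewrite sqr_l2norm; apply: eq_bigr => i _; rewrite !mxE -expr2.
rewrite -uv -un -vn -exprMn -real_normK ?num_real// ler_sqr ?nnegrE ?mulr_ge0 ?l2norm_ge0//.
rewrite ler_norml cauchy_schwarz andbT lerNl.
have := cauchy_schwarz n (- u) v; rewrite -scaleN1r dotvZ l2normZ normrN1 mul1r.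
by rewrite mulN1r.
Qed.

Lemma opb_frobenius m n (A : 'M[R]_(m, n)) c : 0 <= c ->
  \sum_i \sum_j A i j ^+ 2 <= c ^+ 2 -> opb A c.
Proof.
move=> c0 hA x; rewrite -ler_sqr ?nnegrE ?mulr_ge0 ?l2norm_ge0//.
rewrite sqr_l2norm exprMn.
apply: (@le_trans _ _ (\sum_i (\sum_j A i j ^+ 2) * l2norm x ^+ 2)).
  apply: ler_sum => i _; rewrite -expr2 mxE.
  apply: (le_trans (sum_sqr_cauchy _ _ _)); rewrite sqr_l2norm.
  by rewrite (_ : dotv n x x = \sum_j x j 0 ^+ 2)//; apply: eq_bigr => j _; rewrite expr2.
by rewrite -mulr_suml ler_wpM2r// sqr_ge0.
Qed.

Lemma opb_entry m n (A : 'M[R]_(m, n)) c : 0 <= c ->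
  (forall i j, `|A i j| <= c / Num.sqrt (m%:R * n%:R)) -> opb A c.
Proof.
move=> c0 hA; apply: opb_frobenius => //.
case: m A hA => [|m] A hA; first by rewrite big_ord0 sqr_ge0.
case: n A hA => [|n] A hA.
  by rewrite big1 ?sqr_ge0// => i _; rewrite big_ord0.
have mn0 : 0 < m.+1%:R * n.+1%:R :> R by rewrite mulr_gt0// ltr0n.
apply: (@le_trans _ _ (\sum_(i < m.+1) \sum_(j < n.+1) c ^+ 2 / (m.+1%:R * n.+1%:R))).
  apply: ler_sum => i _; apply: ler_sum => j _.
  have h := hA i j; have h2 : `|A i j| ^+ 2 <= (c / Num.sqrt (m.+1%:R * n.+1%:R)) ^+ 2.
    by rewrite ler_sqr ?nnegrE// divr_ge0// sqrtr_ge0.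
  by move: h2; rewrite real_normK ?num_real// exprMn exprVn sqr_sqrtr// ltW.
rewrite !sumr_const !card_ord -mulrnA -[leLHS]mulr_natl natrM.
by rewrite mulrCA mulrA [n.+1%:R * _]mulrC -mulrA divff ?mulr1// gt_eqF.
Qed.

Lemma l2_opnorm_has_ubound m n (A : 'M[R]_(m, n)) :
  has_ubound [set l2norm (A *m x) | x in [set x : 'cV[R]_n | l2norm x <= 1]].
Proof.
pose c := Num.sqrt (\sum_i \sum_j A i j ^+ 2).
have S0 : 0 <= \sum_i \sum_j A i j ^+ 2.
  by apply: sumr_ge0 => i _; apply: sumr_ge0 => j _; rewrite sqr_ge0.
have cA : opb A c.
  by apply: opb_frobenius; [exact: sqrtr_ge0|rewrite sqr_sqrtr].
exists c => _ [x /= x1 <-]; apply: (le_trans (cA x)).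
by rewrite -[leRHS]mulr1 ler_wpM2l// sqrtr_ge0.
Qed.

Lemma l2_opnorm_le m n (A : 'M[R]_(m, n)) c : 0 <= c -> opb A c -> l2_opnorm A <= c.
Proof.
move=> c0 hA; apply: ge_sup.
  by exists (l2norm (A *m 0)), 0 => //=; rewrite l2norm0.
move=> _ [x /= x1 <-]; apply: (le_trans (hA x)).
by rewrite -[leRHS]mulr1 ler_wpM2l.
Qed.

Lemma l2_opnorm_ge0 m n (A : 'M[R]_(m, n)) : 0 <= l2_opnorm A.
Proof.
have -> : 0 = l2norm (A *m 0) by rewrite mulmx0 l2norm0.
apply: ub_le_sup; first exact: l2_opnorm_has_ubound.
by exists 0 => //=; rewrite l2norm0.
Qed.

Lemma opb_l2_opnorm m n (A : 'M[R]_(m, n)) : opb A (l2_opnorm A).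
Proof.
move=> x; have := l2norm_ge0 _ x; rewrite le_eqVlt => /predU1P[x0|x0].
  by rewrite (l2norm_eq0 _ x) // mulmx0 !l2norm0 mulr0.
rewrite -ler_pdivrMr// mulrC.
have -> : (l2norm x)^-1 * l2norm (A *m x) = l2norm (A *m ((l2norm x)^-1 *: x)).
  by rewrite -scalemxAr l2normZ ger0_norm// invr_ge0 ltW.
apply: ub_le_sup; first exact: l2_opnorm_has_ubound.
exists ((l2norm x)^-1 *: x) => //=.
rewrite l2normZ ger0_norm; last by rewrite invr_ge0 ltW.
by rewrite mulVf// lt0r_neq0.
Qed.

End l2_theory.
Arguments opb {R m n} A c.
Arguments dotv {R n} x y.

(** * Weak regularity in operator norm *)

Section weak_regularity.
Variable R : realType.

Lemma l2norm_unit n (x : 'cV[R]_n) : l2norm x != 0 -> l2norm ((l2norm x)^-1 *: x) = 1.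
Proof.
move=> x0; rewrite l2normZ ger0_norm ?invr_ge0 ?l2norm_ge0//.
by rewrite mulVf.
Qed.

Lemma mulmx_entry_bound N (T : 'M[R]_N) b x i : (0 < N)%N -> 0 <= b ->
  (forall i j, `|T i j| <= b / N%:R) ->
  `|(T *m x) i 0| <= b / Num.sqrt N%:R * l2norm x.
Proof.
move=> N0 b0 hT; have n0 : 0 < N%:R :> R by rewrite ltr0n.
rewrite -ler_sqr ?nnegrE ?mulr_ge0 ?divr_ge0 ?sqrtr_ge0 ?l2norm_ge0//.
rewrite real_normK ?num_real// mxE.
apply: (le_trans (sum_sqr_cauchy _ _ _ _)); rewrite 2!exprMn exprVn sqr_sqrtr ?ler0n//.
rewrite sqr_l2norm (_ : dotv x x = \sum_j x j 0 ^+ 2); last first.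
  by apply: eq_bigr => j _; rewrite expr2.
rewrite ler_wpM2r//; first by apply: sumr_ge0 => j _; rewrite sqr_ge0.
apply: (@le_trans _ _ (\sum_(j < N) (b / N%:R) ^+ 2)).
  apply: ler_sum => j _; rewrite -real_normK ?num_real//.
  by rewrite ler_sqr ?nnegrE// divr_ge0// ltW.
rewrite sumr_const card_ord -[leLHS]mulr_natr exprMn.
rewrite [leLHS](_ : _ = b ^+ 2 / N%:R * (N%:R / N%:R)); last by ring.
by rewrite divff ?mulr1// gt_eqF.
Qed.

(** A kernel of large operator norm correlates with the product of two bounded
    functions: a vector [v] almost attaining the norm is replaced by the
    normalized images [p] of [v] under [w] and [q] of [p] under the transpose,
    which inherit the boundedness of the entries. *)
Lemma rank_one_decrement N (w : 'M[R]_N) B eps : (0 < N)%N -> 0 < eps -> 0 <= B ->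
  (forall i j, `|w i j| <= B) -> ~ opb (N%:R^-1 *: w) eps ->
  exists (c : R) (U V : 'I_N -> R),
    [/\ 0 <= c <= B, forall i, `|U i| <= B / eps, forall j, `|V j| <= B / eps
      & \sum_i \sum_j (w i j - c * (U i * V j)) ^+ 2
        <= \sum_i \sum_j w i j ^+ 2 - (N%:R * eps) ^+ 2].
Proof.
move=> N0 e0 B0 wB /existsNP[v /negP]; rewrite -ltNge => ev.
set T := _ *: w in ev; set a := l2norm (T *m v) in ev.
have n0 : 0 < N%:R :> R by rewrite ltr0n.
have sn0 : 0 < Num.sqrt N%:R :> R by rewrite sqrtr_gt0.
have TB i j : `|T i j| <= B / N%:R.
  by rewrite mxE normrM ger0_norm ?invr_ge0 ?ler0n// mulrC ler_pM2r ?invr_gt0.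
have TtB i j : `|T^T i j| <= B / N%:R by rewrite mxE.
have a0 : 0 < a by apply: le_lt_trans ev; rewrite mulr_ge0 ?l2norm_ge0// ltW.
pose p := a^-1 *: (T *m v).
have p1 : l2norm p = 1 by rewrite /p l2norm_unit// gt_eqF.
pose q0 := T^T *m p; set c := l2norm q0.
have q0v : dotv q0 v = a.
  rewrite /q0 dotv_mulmx trmxK /p dotvZ -sqr_l2norm -/a expr2 mulrA mulVf ?gt_eqF//.
  by rewrite mul1r.
have v0 : 0 < l2norm v.
  rewrite lt0r l2norm_ge0 andbT; apply/eqP => /l2norm_eq0 v0.
  by move: a0; rewrite /a v0 mulmx0 l2norm0 ltxx.
have ce : eps < c.
  have := cauchy_schwarz _ _ q0 v; rewrite q0v => h.
  by rewrite -(ltr_pM2r v0); apply: lt_le_trans ev h.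
have c0 : 0 < c by exact: lt_trans ce.
pose q := c^-1 *: q0.
have q1 : l2norm q = 1 by rewrite /q l2norm_unit// gt_eqF.
have q0B j : `|q0 j 0| <= B / Num.sqrt N%:R.
  by have := mulmx_entry_bound _ _ _ p j N0 B0 TtB; rewrite p1 mulr1.
have cB : c <= B.
  rewrite -ler_sqr ?nnegrE ?(ltW c0)// sqr_l2norm.
  apply: (@le_trans _ _ (\sum_(j < N) (B / Num.sqrt N%:R) ^+ 2)).
    apply: ler_sum => j _; rewrite -expr2 -real_normK ?num_real//.
    by rewrite ler_sqr ?nnegrE// divr_ge0// ltW.
  rewrite sumr_const card_ord -[leLHS]mulr_natr exprMn exprVn sqr_sqrtr ?ler0n//.
  by rewrite -mulrA mulVf ?mulr1// gt_eqF.
exists c, (fun i => Num.sqrt N%:R * p i 0), (fun j => Num.sqrt N%:R * q j 0).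
split.
- by rewrite ltW.
- move=> i; rewrite /p mxE !normrM ger0_norm ?sqrtr_ge0// (ger0_norm (_ : 0 <= a^-1)).
    have h := mulmx_entry_bound _ _ _ v i N0 B0 TB.
    apply: (@le_trans _ _ (Num.sqrt N%:R * (a^-1 * (B / Num.sqrt N%:R * l2norm v)))).
      by rewrite ler_wpM2l ?sqrtr_ge0// ler_wpM2l// invr_ge0 ltW.
    rewrite [leLHS](_ : _ = B * (l2norm v / a) * (Num.sqrt N%:R / Num.sqrt N%:R)).
      rewrite divff ?gt_eqF// mulr1 ler_wpM2l// ler_pdivrMr// mulrC ler_pdivlMr//.
      by rewrite mulrC ltW.
    by ring.
  by rewrite invr_ge0 ltW.
- move=> j; rewrite /q mxE !normrM ger0_norm ?sqrtr_ge0// (ger0_norm (_ : 0 <= c^-1)).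
    apply: (@le_trans _ _ (Num.sqrt N%:R * (c^-1 * (B / Num.sqrt N%:R)))).
      by rewrite ler_wpM2l ?sqrtr_ge0// ler_wpM2l// invr_ge0 ltW.
    rewrite [leLHS](_ : _ = B / c * (Num.sqrt N%:R / Num.sqrt N%:R)).
      by rewrite divff ?gt_eqF// mulr1 ler_wpM2l// lef_pV2// ?posrE// ltW.
    by ring.
  by rewrite invr_ge0 ltW.
have wT i j : w i j = N%:R * T i j by rewrite mxE mulrA divff ?mul1r// gt_eqF.
have Tpq : \sum_i \sum_j T i j * (p i 0 * q j 0) = c.
  transitivity (dotv p (T *m q)).
    apply: eq_bigr => i _; rewrite [(T *m q) i 0]mxE mulr_sumr.
    by apply: eq_bigr => j _; ring.
  rewrite -[T]trmxK -dotv_mulmx -/q0 /q dotvC dotvZ -sqr_l2norm -/c expr2 mulrA.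
  by rewrite mulVf ?gt_eqF// mul1r.
have pq1 : \sum_i \sum_j (p i 0 * q j 0) ^+ 2 = 1.
  transitivity (dotv p p * dotv q q); last by rewrite -!sqr_l2norm p1 q1 expr1n mulr1.
  rewrite mulr_suml; apply: eq_bigr => i _; rewrite mulr_sumr.
  by apply: eq_bigr => j _; ring.
have -> : \sum_i \sum_j (w i j - c * (Num.sqrt N%:R * p i 0 * (Num.sqrt N%:R * q j 0))) ^+ 2
    = \sum_i \sum_j (w i j) ^+ 2 - 2 * N%:R ^+ 2 * c * (\sum_i \sum_j T i j * (p i 0 * q j 0))
      + N%:R ^+ 2 * c ^+ 2 * (\sum_i \sum_j (p i 0 * q j 0) ^+ 2).
  rewrite !mulr_sumr -sumrB -big_split; apply: eq_bigr => i _.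
  rewrite !mulr_sumr -sumrB -big_split; apply: eq_bigr => j _ /=.
  rewrite wT; have := sqr_sqrtr (ltW n0); move: (Num.sqrt _) => s <-; ring.
rewrite Tpq pq1.
have : (N%:R * eps) ^+ 2 <= (N%:R * c) ^+ 2.
  by rewrite ler_sqr ?nnegrE ?mulr_ge0 ?ler0n ?(ltW e0) ?(ltW c0)// ler_pM2l// ltW.
rewrite !exprMn; lra.
Qed.

Lemma quantization B dl : 0 < dl -> exists K (idx : R -> 'I_K.+1) (val : 'I_K.+1 -> R),
  (forall x, `|x| <= B -> `|x - val (idx x)| <= dl) /\
  exists M, forall i, `|val i| <= M.
Proof.
move=> d0; pose K := Num.truncn (2 * B / dl).
exists K, (fun x => inord (Num.truncn ((x + B) / dl))), (fun i => i%:R * dl - B).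
split=> [x xB|]; last first.
  exists (K%:R * dl + `|B|) => i; apply: (le_trans (ler_normB _ _)).
  rewrite lerD2r ger0_norm ?mulr_ge0 ?(ltW d0)// ler_wpM2r ?(ltW d0)//.
  by rewrite ler_nat -ltnS.
have /andP[x1 x2] : - B <= x <= B by rewrite -ler_norml.
have y0 : 0 <= (x + B) / dl by rewrite divr_ge0 ?(ltW d0)//; lra.
rewrite inordK; last first.
  rewrite ltnS; apply: le_truncn; rewrite ler_pM2r ?invr_gt0//; lra.
have lo : (Num.truncn ((x + B) / dl))%:R <= (x + B) / dl by rewrite -truncn_ge_nat.
have hi : (x + B) / dl < (Num.truncn ((x + B) / dl)).+1%:R by rewrite -truncn_lt_nat.
move: lo hi; move: (Num.truncn _) => t; rewrite ler_pdivlMr// ltr_pdivrMr// -natr1.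
rewrite mulrDl mul1r => lo hi; rewrite ler_norml; apply/andP; split; lra.
Qed.

(** Subtracting such products decreases the Hilbert-Schmidt norm by a fixed
    amount, so boundedly many of them exhaust the operator norm; the types are
    the quantized values of the functions that occur. *)
Lemma weak_regularity_bounded_energy k : forall B eps th : R,
  0 <= B -> 0 < eps -> 0 < th ->
  exists (S : finType) (M : R), forall N (w : 'M[R]_N), (0 < N)%N ->
    (forall i j, `|w i j| <= B) ->
    \sum_i \sum_j w i j ^+ 2 <= k%:R * (N%:R * eps) ^+ 2 ->
    exists (tau : 'I_N -> S) (a : S -> S -> R), (forall s t, `|a s t| <= M) /\
      opb (N%:R^-1 *: (w - \matrix_(i, j) a (tau i) (tau j))) (eps + th).
Proof.
elim: k => [|k IH] B eps th B0 e0 th0.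
  exists unit, 0 => N w N0 wB; rewrite mul0r => w0.
  exists (fun=> tt), (fun _ _ => 0); split=> [s t|]; first by rewrite normr0.
  apply: opb_frobenius; first by rewrite addr_ge0 ?ltW.
  apply: (@le_trans _ _ 0); last exact: sqr_ge0.
  rewrite (_ : (\sum_i _) = N%:R^-1 ^+ 2 * \sum_i \sum_j w i j ^+ 2).
    by rewrite mulr_ge0_le0 ?sqr_ge0.
  rewrite mulr_sumr; apply: eq_bigr => i _; rewrite mulr_sumr.
  by apply: eq_bigr => j _; rewrite !mxE subr0 exprMn.
have th20 : 0 < th / 2 by rewrite divr_gt0.
pose b := B / eps; have b0 : 0 <= b by rewrite divr_ge0// ltW.
pose B' := B + B * (b * b).
have B'0 : 0 <= B' by rewrite addr_ge0 // mulr_ge0 // mulr_ge0.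
have [S' [M' hS']] := IH B' eps (th / 2) B'0 e0 th20.
pose dl := Num.min 1 (th / 2 / ((B + 1) * (2 * b + 1))).
have D0 : 0 < (B + 1) * (2 * b + 1) by rewrite mulr_gt0//; lra.
have d0 : 0 < dl by rewrite lt_min ltr01 divr_gt0.
have d1 : dl <= 1 by rewrite ge_min lexx.
have d2 : B * (dl * (2 * b + 1)) <= th / 2.
  have : dl <= th / 2 / ((B + 1) * (2 * b + 1)) by rewrite ge_min lexx orbT.
  rewrite ler_pdivlMr//; apply: le_trans.
  rewrite [leRHS](_ : _ = B * (dl * (2 * b + 1)) + dl * (2 * b + 1)); last by ring.
  by rewrite lerDl mulr_ge0//; lra.
have [K [idx [val [hval [Mv hMv]]]]] := quantization b dl d0.
exists (S' * 'I_K.+1 * 'I_K.+1)%type, (M' + B * (Mv * Mv)).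
have Mv0 : 0 <= Mv by apply: le_trans (hMv ord0).
move=> N w N0 wB wE.
have [small|big] := pselect (opb (N%:R^-1 *: w) eps).
  have [||tau [a [ha _]]] := hS' N 0 N0.
  - by move=> i j; rewrite mxE normr0.
  - rewrite [leLHS]big1 => [|i _]; first by apply: mulr_ge0; [exact: ler0n|exact: sqr_ge0].
    by rewrite big1// => j _; rewrite mxE expr0n.
  exists (fun i => (tau i, ord0, ord0)), (fun _ _ => 0); split=> [s t|].
    rewrite normr0 addr_ge0 ?mulr_ge0//.
    exact: le_trans (ha (tau (Ordinal N0)) (tau (Ordinal N0))).
  apply: (@opb_le _ _ _ _ eps); first by rewrite lerDl ltW.
  by rewrite (_ : \matrix_(i, j) _ = 0) ?subr0//; apply/matrixP => i j; rewrite !mxE.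
have [c [U [V [/andP[c0 cB] UB VB dec]]]] := rank_one_decrement _ _ _ _ N0 e0 B0 wB big.
pose w' := \matrix_(i, j) (w i j - c * (U i * V j)).
have [||tau [a [aM ha]]] := hS' N w' N0.
- move=> i j; rewrite mxE; apply: (le_trans (ler_normB _ _)); rewrite lerD//.
  by rewrite normrM ger0_norm// ler_pM// normrM ler_pM.
- have -> : \sum_i \sum_j w' i j ^+ 2 = \sum_i \sum_j (w i j - c * (U i * V j)) ^+ 2.
    by apply: eq_bigr => i _; apply: eq_bigr => j _; rewrite mxE.
  apply: (le_trans dec); rewrite lerBlDr; apply: (le_trans wE).
  by rewrite -natr1 mulrDl mul1r.
exists (fun i => (tau i, idx (U i), idx (V i))).
exists (fun s t => a s.1.1 t.1.1 + c * (val s.1.2 * val t.2)); split=> [s t|].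
  apply: (le_trans (ler_normD _ _)); rewrite lerD// normrM ger0_norm//.
  by rewrite ler_pM// normrM ler_pM.
have -> : eps + th = eps + th / 2 + th / 2 by rewrite -addrA -splitr.
rewrite (_ : _ *: _ = N%:R^-1 *: (w' - \matrix_(i, j) a (tau i) (tau j))
    + N%:R^-1 *: \matrix_(i, j) (c * (U i * V j - val (idx (U i)) * val (idx (V j))))); last first.
  by apply/matrixP => i j; rewrite !mxE/=; ring.
apply: opbD => //; apply: opb_entry => [|i j]; first exact: ltW.
have n0 : 0 < N%:R :> R by rewrite ltr0n.
rewrite !mxE -expr2 sqrtr_sqr [`|N%:R|]ger0_norm ?ler0n// normrM ger0_norm ?invr_ge0 ?ler0n//.
rewrite mulrC ler_pM2r ?invr_gt0// normrM (ger0_norm c0).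
apply: (le_trans _ d2); apply: ler_pM => //.
have hu := hval _ (UB i); have hv := hval _ (VB j).
move: hu hv (UB i) (VB j); set u' := val _; set v' := val _ => hu hv uB vB.
have -> : U i * V j - u' * v' = U i * (V j - v') + (U i - u') * v' by ring.
have v'B : `|v'| <= b + dl.
  have -> : v' = V j - (V j - v') by ring.
  by apply: (le_trans (ler_normB _ _)); rewrite lerD.
apply: (@le_trans _ _ (b * dl + dl * (b + dl))).
  by apply: (le_trans (ler_normD _ _)); rewrite !normrM lerD// ler_pM.
nra.
Qed.

Theorem weak_regularity (B eps : R) : 0 <= B -> 0 < eps ->
  exists (S : finType) (M : R), forall N (w : 'M[R]_N), (0 < N)%N ->
    (forall i j, `|w i j| <= B) ->
    exists (tau : 'I_N -> S) (a : S -> S -> R), (forall s t, `|a s t| <= M) /\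
      opb (N%:R^-1 *: (w - \matrix_(i, j) a (tau i) (tau j))) eps.
Proof.
move=> B0 e0; have e20 : 0 < eps / 2 by rewrite divr_gt0.
pose k := (Num.truncn ((B / (eps / 2)) ^+ 2)).+1.
have [S [M hS]] := weak_regularity_bounded_energy k B _ _ B0 e20 e20.
exists S, M => N w N0 wB; rewrite [eps]splitr; apply: hS => //.
have n0 : 0 < N%:R :> R by rewrite ltr0n.
apply: (@le_trans _ _ (\sum_(i < N) \sum_(j < N) B ^+ 2)).
  apply: ler_sum => i _; apply: ler_sum => j _; rewrite -real_normK ?num_real//.
  by rewrite ler_sqr ?nnegrE.
rewrite !sumr_const !card_ord -mulrnA -[leLHS]mulr_natr natrM exprMn.
have : (B / (eps / 2)) ^+ 2 <= k%:R by rewrite ltW// truncnS_gt.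
rewrite exprMn exprVn ler_pdivrMr ?exprn_gt0// => h.
rewrite [leRHS](_ : _ = k%:R * (eps / 2) ^+ 2 * (N%:R * N%:R)); last by ring.
by rewrite ler_wpM2r// mulr_ge0.
Qed.

End weak_regularity.

(** * Couplings prescribed on finitely many labels *)

Section label_couplings.
Variable R : realType.

Definition label_freq N (L : finType) (lab : 'I_N -> L) (l : L) : R :=
  N%:R^-1 * \sum_i (lab i == l)%:R.

Lemma label_freq_ge0 N (L : finType) (lab : 'I_N -> L) l : 0 <= label_freq _ _ lab l.
Proof. by rewrite mulr_ge0 ?invr_ge0// sumr_ge0. Qed.

Lemma sum_label N (L : finType) (lab : 'I_N -> L) (P : pred L) (f : L -> R) : (0 < N)%N ->
  \sum_(i | P (lab i)) f (lab i) = N%:R * \sum_(l | P l) label_freq _ _ lab l * f l.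
Proof.
move=> N0; have n0 : N%:R != 0 :> R by rewrite pnatr_eq0 -lt0n.
rewrite mulr_sumr (partition_big lab P)//=; apply: eq_bigr => l Pl.
rewrite /label_freq !mulrA divff// mul1r mulr_suml [RHS]big_mkcond/=.
rewrite big_mkcond/=; apply: eq_bigr => i _.
by case: eqP => [->|_]; rewrite ?Pl ?mul1r ?mul0r ?andbF.
Qed.

Lemma sum_label_freq N (L : finType) (lab : 'I_N -> L) : (0 < N)%N ->
  \sum_l label_freq _ _ lab l = 1.
Proof.
move=> N0; have n0 : N%:R != 0 :> R by rewrite pnatr_eq0 -lt0n.
have := sum_label _ _ lab predT (fun=> 1) N0; rewrite sumr_const card_ord => h.
by apply: (mulfI n0); rewrite mulr1 [in RHS]h; congr (_ * _); apply: eq_bigr => l _; rewrite mulr1.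
Qed.

Lemma label_freq_gt0 N (L : finType) (lab : 'I_N -> L) i : 0 < label_freq _ _ lab (lab i).
Proof.
have N0 : (0 < N)%N by case: N i {lab} => [[]|].
rewrite mulr_gt0 ?invr_gt0 ?ltr0n// (bigD1 i)//= eqxx ltr_wpDr//.
by apply: sumr_ge0 => j _; rewrite ler0n.
Qed.

(** The missing mass of a sub-coupling is filled in with a product measure. *)
Lemma complete_subcoupling N1 N2 (g : 'M[R]_(N1, N2)) : (0 < N1)%N -> (0 < N2)%N ->
  (forall i j, 0 <= g i j) ->
  (forall i, \sum_j g i j <= N1%:R^-1) -> (forall j, \sum_i g i j <= N2%:R^-1) ->
  exists2 g' : 'M[R]_(N1, N2), coupling g' & forall i j, g i j <= g' i j.
Proof.
move=> N10 N20 g0 gr gc.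
pose r i := N1%:R^-1 - \sum_j g i j; pose c j := N2%:R^-1 - \sum_i g i j.
have r0 i : 0 <= r i by rewrite subr_ge0.
have c0 j : 0 <= c j by rewrite subr_ge0.
pose m := \sum_i r i.
have cst (n : nat) : (0 < n)%N -> \sum_(i < n) (n%:R^-1 : R) = 1.
  by move=> n0; rewrite sumr_const card_ord -[LHS]mulr_natr mulVf// pnatr_eq0 -lt0n.
have mc : \sum_j c j = m.
  by rewrite /m /r /c !sumrB !cst// exchange_big.
have m0 : 0 <= m by apply: sumr_ge0.
have fill (I : finType) (f : I -> R) : (forall i, 0 <= f i) -> \sum_i f i = m ->
    forall i, f i * (m / m) = f i.
  move=> f0 fm i; have [mz|mz] := eqVneq m 0; last by rewrite divff ?mulr1.
  have /eqP : \sum_i f i = 0 by rewrite fm.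
  rewrite psumr_eq0// => /allP/(_ i (mem_index_enum i))/= /eqP ->.
  by rewrite mul0r.
exists (\matrix_(i, j) (g i j + r i * c j / m)) => [|i j]; last first.
  by rewrite mxE lerDl divr_ge0 ?mulr_ge0.
split=> [i j|j|i].
- by rewrite mxE addr_ge0// divr_ge0 ?mulr_ge0.
- under eq_bigr do rewrite mxE -mulrA; rewrite big_split/= -mulr_suml -/m mulrCA.
  by rewrite (fill _ c) // addrC subrK.
- under eq_bigr do rewrite mxE -mulrA; rewrite big_split/= -mulr_sumr -mulr_suml mc.
  by rewrite (fill _ r) // addrC subrK.
Qed.

Section construction.
Variables (N1 N2 : nat) (N10 : (0 < N1)%N) (N20 : (0 < N2)%N).
Variables (L1 L2 : finType) (l1 : 'I_N1 -> L1) (l2 : 'I_N2 -> L2).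
Variables (H : L1 -> L2 -> R) (h1 : L1 -> R) (h2 : L2 -> R).
Hypothesis H0 : forall a b, 0 <= H a b.
Hypothesis H1 : forall a, \sum_b H a b = h1 a.
Hypothesis H2 : forall b, \sum_a H a b = h2 b.

Local Notation e1 := (label_freq _ _ l1).
Local Notation e2 := (label_freq _ _ l2).
Local Notation m1 := (fun a => Num.max (e1 a) (h1 a)).
Local Notation m2 := (fun b => Num.max (e2 b) (h2 b)).

(** When the empirical label distributions [e1], [e2] coincide with the
    marginals of [H], this is the coupling inducing [H] on labels which is
    uniform on each pair of label classes. *)
Definition label_subcoupling : 'M[R]_(N1, N2) :=
  \matrix_(i, j) (H (l1 i) (l2 j) / (N1%:R * m1 (l1 i) * (N2%:R * m2 (l2 j)))).

Let h10 a : 0 <= h1 a. Proof. by rewrite -H1 sumr_ge0. Qed.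
Let h20 b : 0 <= h2 b. Proof. by rewrite -H2 sumr_ge0. Qed.
Let m10 a : 0 <= m1 a. Proof. by rewrite le_max label_freq_ge0. Qed.
Let m20 a : 0 <= m2 a. Proof. by rewrite le_max label_freq_ge0. Qed.

Lemma ratio_le1 (x m : R) : 0 <= x -> x <= m -> x / m <= 1.
Proof.
move=> x0 xm; have [m0|m0] := eqVneq m 0; first by rewrite m0 invr0 mulr0.
by rewrite ler_pdivrMr ?mul1r// lt0r m0 (le_trans x0).
Qed.

Let e2m2 b : e2 b / m2 b <= 1.
Proof. by apply: ratio_le1; rewrite ?label_freq_ge0// le_max lexx. Qed.
Let e1m1 b : e1 b / m1 b <= 1.
Proof. by apply: ratio_le1; rewrite ?label_freq_ge0// le_max lexx. Qed.
Let h1m1 b : h1 b / m1 b <= 1.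
Proof. by apply: ratio_le1; rewrite ?h10// le_max lexx orbT. Qed.

Lemma label_subcoupling_ge0 i j : 0 <= label_subcoupling i j.
Proof. by rewrite mxE divr_ge0// !mulr_ge0. Qed.

Lemma label_subcoupling_class (A : pred L2) c i : 0 <= c ->
  \sum_(b | A b) H (l1 i) b <= c * h1 (l1 i) ->
  N1%:R * \sum_(j | A (l2 j)) label_subcoupling i j <= c.
Proof.
move=> c0 hc; under eq_bigr do rewrite mxE.
have n1 : N1%:R != 0 :> R by rewrite pnatr_eq0 -lt0n.
have n2 : N2%:R != 0 :> R by rewrite pnatr_eq0 -lt0n.
rewrite (sum_label _ _ l2 A (fun b => H (l1 i) b / (N1%:R * m1 (l1 i) * (N2%:R * m2 b))))//.
rewrite (_ : _ * _ = \sum_(b | A b) H (l1 i) b / m1 (l1 i) * (e2 b / m2 b)); last first.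
  rewrite !mulr_sumr; apply: eq_bigr => b _; rewrite !invfM.
  rewrite [LHS](_ : _ = (N1%:R / N1%:R) * (N2%:R / N2%:R) *
    (H (l1 i) b / m1 (l1 i) * (e2 b / m2 b))); last by ring.
  by rewrite !divff// !mul1r.
apply: (@le_trans _ _ (\sum_(b | A b) H (l1 i) b / m1 (l1 i))).
  by apply: ler_sum => b _; rewrite ler_piMr// divr_ge0.
rewrite -mulr_suml; apply: (@le_trans _ _ (c * h1 (l1 i) / m1 (l1 i))).
  by rewrite ler_wpM2r// invr_ge0.
by rewrite -mulrA ler_piMr.
Qed.

Lemma label_subcoupling_row i : \sum_j label_subcoupling i j <= N1%:R^-1.
Proof.
have n1 : 0 < N1%:R :> R by rewrite ltr0n.
rewrite -(ler_pM2l n1) divff ?gt_eqF//.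
by apply: (label_subcoupling_class predT); rewrite // H1 mul1r.
Qed.

Lemma label_subcoupling_sum (F : L1 -> L2 -> R) :
  \sum_i \sum_j label_subcoupling i j * F (l1 i) (l2 j)
  = \sum_a \sum_b H a b * F a b * (e1 a / m1 a * (e2 b / m2 b)).
Proof.
have n1 : N1%:R != 0 :> R by rewrite pnatr_eq0 -lt0n.
have n2 : N2%:R != 0 :> R by rewrite pnatr_eq0 -lt0n.
under eq_bigr => i _.
  under eq_bigr do rewrite mxE.
  rewrite (sum_label _ _ l2 predT
    (fun b => H (l1 i) b / (N1%:R * m1 (l1 i) * (N2%:R * m2 b)) * F (l1 i) b))//; over.
rewrite (sum_label _ _ l1 predT (fun a => N2%:R * \sum_b e2 b *
    (H a b / (N1%:R * m1 a * (N2%:R * m2 b)) * F a b)))// mulr_sumr.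
apply: eq_bigr => a _; rewrite !mulr_sumr; apply: eq_bigr => b _; rewrite !invfM.
rewrite [LHS](_ : _ = (N1%:R / N1%:R) * (N2%:R / N2%:R) *
    (H a b * F a b * (e1 a / m1 a * (e2 b / m2 b)))); last by ring.
by rewrite !divff// !mul1r.
Qed.

Lemma label_subcoupling_le (F : L1 -> L2 -> R) : (forall a b, 0 <= F a b) ->
  \sum_i \sum_j label_subcoupling i j * F (l1 i) (l2 j) <= \sum_a \sum_b H a b * F a b.
Proof.
move=> F0; rewrite label_subcoupling_sum; apply: ler_sum => a _; apply: ler_sum => b _.
by rewrite ler_piMr ?mulr_ge0// mulr_ile1// divr_ge0// label_freq_ge0.
Qed.

(** Where the empirical frequencies fall short of the marginals of [H], each marginal
    loses at most the total deviation. *)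
Lemma label_subcoupling_mass : \sum_a h1 a = 1 ->
  1 - \sum_i \sum_j label_subcoupling i j
  <= \sum_a `|h1 a - e1 a| + \sum_b `|h2 b - e2 b|.
Proof.
move=> h11; have := label_subcoupling_sum (fun _ _ => 1).
under eq_bigr do under eq_bigr do rewrite mulr1.
move=> ->.
rewrite [X in X - _](_ : 1 = \sum_a \sum_b H a b); last first.
  by rewrite -h11; apply: eq_bigr => a _; rewrite H1.
have defect (h e : R) : 0 <= h -> 0 <= e -> h * (1 - e / Num.max e h) <= `|h - e|.
  move=> h0 e0; have [eh|he] := leP e h; last first.
    by rewrite divff ?gt_eqF ?(le_lt_trans h0)// subrr mulr0.
  have [hz|hz] := eqVneq h 0; first by rewrite hz mul0r.
  by rewrite mulrBr mulr1 mulrCA divff// mulr1 ler_norm.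
rewrite -sumrB.
apply: (@le_trans _ _ (\sum_a h1 a * (1 - e1 a / m1 a) + \sum_b h2 b * (1 - e2 b / m2 b))).
  under [in leRHS]eq_bigr do rewrite -{1}H1 mulr_suml.
  rewrite [X in _ <= _ + X](_ : _ = \sum_a \sum_b H a b * (1 - e2 b / m2 b)); last first.
    rewrite exchange_big; apply: eq_bigr => b _.
    by rewrite -{1}H2 mulr_suml.
  rewrite -big_split/=; apply: ler_sum => a _.
  rewrite -sumrB -big_split/=; apply: ler_sum => b _.
  have := e1m1 a; have := e2m2 b.
  have : 0 <= e1 a / m1 a by rewrite divr_ge0// label_freq_ge0.
  have : 0 <= e2 b / m2 b by rewrite divr_ge0// label_freq_ge0.
  have := H0 a b; move: (H a b) (e1 a / _) (e2 b / _) => x y z x0 z0 y0 z1 y1.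
  rewrite -mulrDr mulr1 -{1}[x]mulr1 -mulrBr ler_wpM2l//; nra.
by apply: lerD; apply: ler_sum => a _; apply: defect; rewrite ?label_freq_ge0.
Qed.

End construction.

Lemma label_subcoupling_tr N1 N2 (L1 L2 : finType) (l1 : 'I_N1 -> L1) (l2 : 'I_N2 -> L2)
    (H : L1 -> L2 -> R) h1 h2 :
  (label_subcoupling N1 N2 L1 L2 l1 l2 H h1 h2)^T
  = label_subcoupling N2 N1 L2 L1 l2 l1 (fun b a => H a b) h2 h1.
Proof. by apply/matrixP => i j; rewrite !mxE; congr (_ / _); rewrite mulrC. Qed.

End label_couplings.
Arguments label_freq {R N L} lab l.

(** * Commutators of couplings with step kernels *)

Section step_kernels.
Variable R : realType.

(** In normalized form the two terms of the distance are the commutators of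
    the operator [couplop g], which is a contraction for the Euclidean norm,
    with the integral operators [kernop w]. *)
Definition couplop N1 N2 (g : 'M[R]_(N1, N2)) : 'M[R]_(N1, N2) :=
  Num.sqrt (N1%:R * N2%:R) *: g.

Definition kernop N (w : 'M[R]_N) : 'M[R]_N := N%:R^-1 *: w.

Definition stepmx N (S : finType) (tau : 'I_N -> S) (a : S -> S -> R) : 'M[R]_N :=
  \matrix_(i, j) a (tau i) (tau j).

Definition commut N1 N2 (w1 : 'M[R]_N1) (w2 : 'M[R]_N2) (g : 'M[R]_(N1, N2)) :=
  kernop N1 w1 *m couplop N1 N2 g - couplop N1 N2 g *m kernop N2 w2.

Lemma couplop_tr N1 N2 (g : 'M[R]_(N1, N2)) : (couplop N1 N2 g)^T = couplop N2 N1 g^T.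
Proof. by apply/matrixP => i j; rewrite !mxE (mulrC N1%:R). Qed.

Lemma kernop_tr N (w : 'M[R]_N) : (kernop N w)^T = kernop N w^T.
Proof. by apply/matrixP => i j; rewrite !mxE. Qed.

Lemma coupling_tr N1 N2 (g : 'M[R]_(N1, N2)) : coupling g -> coupling g^T.
Proof.
move=> [g0 gc gr]; split=> [i j|j|i]; first by rewrite mxE.
- by rewrite -(gr j); apply: eq_bigr => i _; rewrite mxE.
- by rewrite -(gc i); apply: eq_bigr => j _; rewrite mxE.
Qed.

Lemma coupling_mass N1 N2 (g : 'M[R]_(N1, N2)) : (0 < N1)%N -> coupling g ->
  \sum_i \sum_j g i j = 1.
Proof.
move=> N10 [_ _ gr]; under eq_bigr do rewrite gr.
by rewrite sumr_const card_ord -[LHS]mulr_natr mulVf// pnatr_eq0 -lt0n.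
Qed.

(** The Cauchy-Schwarz inequality for the weights [g i j] bounds each row, and the
    column sums of [g] then recover the norm of [x]. *)
Lemma couplop_contraction N1 N2 (g : 'M[R]_(N1, N2)) : (0 < N1)%N -> (0 < N2)%N ->
  coupling g -> opb (couplop N1 N2 g) 1.
Proof.
move=> N10 N20 [g0 gc gr] x; rewrite mul1r.
have n1 : 0 < N1%:R :> R by rewrite ltr0n.
have n2 : 0 < N2%:R :> R by rewrite ltr0n.
rewrite -ler_sqr ?nnegrE ?l2norm_ge0// !sqr_l2norm.
apply: (@le_trans _ _ (\sum_i \sum_j N2%:R * (g i j * x j 0 ^+ 2))).
  apply: ler_sum => i _; rewrite -expr2 -mulr_sumr.
  have -> : (couplop N1 N2 g *m x) i 0 = Num.sqrt (N1%:R * N2%:R) * \sum_j g i j * x j 0.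
    by rewrite mxE mulr_sumr; apply: eq_bigr => j _; rewrite mxE mulrA.
  rewrite exprMn sqr_sqrtr ?mulr_ge0// -mulrA mulrCA ler_wpM2l//.
  have := sum_sqr_cauchy _ _ (fun j => Num.sqrt (g i j)) (fun j => Num.sqrt (g i j) * x j 0).
  have -> : \sum_j Num.sqrt (g i j) * (Num.sqrt (g i j) * x j 0) = \sum_j g i j * x j 0.
    by apply: eq_bigr => j _; rewrite mulrA -expr2 sqr_sqrtr.
  have -> : \sum_j Num.sqrt (g i j) ^+ 2 = N1%:R^-1.
    by rewrite -(gr i); apply: eq_bigr => j _; rewrite sqr_sqrtr.
  have -> : \sum_j (Num.sqrt (g i j) * x j 0) ^+ 2 = \sum_j g i j * x j 0 ^+ 2.
    by apply: eq_bigr => j _; rewrite exprMn sqr_sqrtr.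
  by rewrite ler_pdivlMl.
rewrite exchange_big; apply: ler_sum => j _.
under eq_bigr do rewrite mulrCA.
by rewrite -mulr_suml gc mulrA mulVf ?gt_eqF// mul1r expr2.
Qed.

Lemma kernop_bound N (w : 'M[R]_N) C : (0 < N)%N -> 0 <= C ->
  (forall i j, `|w i j| <= C) -> opb (kernop N w) C.
Proof.
move=> N0 C0 wC; apply: opb_entry => // i j.
rewrite mxE -expr2 sqrtr_sqr !normrM ger0_norm ?invr_ge0 ?ler0n// mulrC.
by rewrite [`|N%:R|]ger0_norm ?ler0n// ler_wpM2r ?invr_ge0.
Qed.

Section transfer.
Variables (N1 N2 : nat) (N10 : (0 < N1)%N) (N20 : (0 < N2)%N).
Variables (S1 S2 : finType) (t1 : 'I_N1 -> S1) (t2 : 'I_N2 -> S2).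
Variables (gam g : 'M[R]_(N1, N2)) (q : S1 -> S2 -> R).
Hypothesis gamC : coupling gam.
Hypothesis g0 : forall i j, 0 <= g i j.
Hypothesis ggam : forall i j, g i j <= gam i j.
Hypothesis q1 : forall t, \sum_s q s t <= 1.
Hypothesis gq : forall s j, N2%:R * \sum_(k | t1 k == s) g k j <= q s (t2 j).

Let n1 : 0 < N1%:R :> R. Proof. by rewrite ltr0n. Qed.
Let n2 : 0 < N2%:R :> R. Proof. by rewrite ltr0n. Qed.
Let d j : R := 1 - N2%:R * \sum_k g k j.

Let d0 j : 0 <= d j.
Proof.
rewrite /d subr_ge0 -ler_pdivlMl// mulr1; have [_ gc _] := gamC; rewrite -(gc j).
by apply: ler_sum => k _.
Qed.

Let d1 j : d j <= 1.
Proof. by rewrite /d gerBl mulr_ge0// sumr_ge0. Qed.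

(** Both the conditional law of the type of the first marginal under [gam] and
    the prescribed kernel [q] dominate the sub-coupling [g]. *)
Lemma conditional_defect (c : S1 -> R) M j : 0 <= M -> (forall s, `|c s| <= M) ->
  `|N2%:R * \sum_k c (t1 k) * gam k j - \sum_s c s * q s (t2 j)| <= 2 * M * d j.
Proof.
move=> M0 cM.
pose cl (h : 'M[R]_(N1, N2)) s := N2%:R * \sum_(k | t1 k == s) h k j.
have clsum h : \sum_s cl h s = N2%:R * \sum_k h k j.
  by rewrite -mulr_sumr; congr (_ * _); rewrite [RHS](partition_big t1 predT).
have -> : N2%:R * \sum_k c (t1 k) * gam k j = \sum_s c s * cl gam s.
  rewrite [X in N2%:R * X](partition_big t1 predT)//= mulr_sumr.
  apply: eq_bigr => s _; rewrite /cl mulrCA; congr (_ * _).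
  by rewrite mulr_sumr; apply: eq_bigr => k /eqP ->.
rewrite -sumrB; apply: (le_trans (ler_norm_sum _ _ _)).
apply: (@le_trans _ _ (\sum_s M * ((cl gam s - cl g s) + (q s (t2 j) - cl g s)))).
  apply: ler_sum => s _; rewrite -mulrBr normrM ler_pM//.
  have h1 : cl g s <= cl gam s.
    by rewrite ler_pM2l// ler_sum.
  have h2 : cl g s <= q s (t2 j) by exact: gq.
  rewrite ler_norml; apply/andP; split; lra.
rewrite -mulr_sumr -mulrA mulrCA ler_wpM2l// big_split/= !sumrB !clsum.
case: gamC => _ -> _; rewrite divff ?gt_eqF// /d.
have := q1 (t2 j); lra.
Qed.

(** The product of a step kernel with a coupling in which, given its second marginal,
    the type of the first one follows exactly the law [q]. *)
Definition idealmx (a : S1 -> S1 -> R) : 'M[R]_(N1, N2) :=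
  \matrix_(i, j) ((Num.sqrt (N1%:R * N2%:R))^-1 * \sum_s a (t1 i) s * q s (t2 j)).

Lemma kernop_couplopE (a : S1 -> S1 -> R) i j :
  (kernop N1 (stepmx N1 S1 t1 a) *m couplop N1 N2 gam) i j
  = (Num.sqrt (N1%:R * N2%:R))^-1 * (N2%:R * \sum_k a (t1 i) (t1 k) * gam k j).
Proof.
have s0 : Num.sqrt (N1%:R * N2%:R) != 0 :> R by rewrite gt_eqF// sqrtr_gt0 mulr_gt0.
have ss : Num.sqrt (N1%:R * N2%:R) ^+ 2 = N1%:R * N2%:R :> R.
  by rewrite sqr_sqrtr// mulr_ge0 ?ltW.
rewrite mxE; transitivity (\sum_k (N1%:R^-1 * Num.sqrt (N1%:R * N2%:R)) *
    (a (t1 i) (t1 k) * gam k j)).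
  by apply: eq_bigr => k _; rewrite !mxE; ring.
rewrite -mulr_sumr mulrA; congr (_ * _).
apply: (mulfI s0); rewrite mulrCA -expr2 ss !mulrA mulVf ?gt_eqF// divff//.
Qed.

(** The defects [d j] have mean the missing mass of [g] and are at most 1, so their
    mean square is at most this mass: hence the square root in the bound. *)
Lemma transfer_left (a : S1 -> S1 -> R) M : 0 <= M -> (forall s s', `|a s s'| <= M) ->
  opb (kernop N1 (stepmx N1 S1 t1 a) *m couplop N1 N2 gam - idealmx a)
    (2 * M * Num.sqrt (1 - \sum_i \sum_j g i j)).
Proof.
move=> M0 aM.
have theta0 : 0 <= 1 - \sum_i \sum_j g i j.
  by rewrite subr_ge0 -(coupling_mass _ _ _ N10 gamC); apply: ler_sum => i _; apply: ler_sum.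
have thetaE : 1 - \sum_i \sum_j g i j = N2%:R^-1 * \sum_j d j.
  rewrite /d sumrB sumr_const card_ord -mulr_sumr mulrBr mulrA mulVf ?gt_eqF// mul1r.
  by rewrite exchange_big.
have nn0 : 0 < N1%:R * N2%:R :> R by rewrite mulr_gt0.
apply: opb_frobenius; first by rewrite !mulr_ge0// sqrtr_ge0.
apply: (@le_trans _ _ (\sum_(i < N1) \sum_j (N1%:R * N2%:R)^-1 * ((2 * M) ^+ 2 * d j))).
  apply: ler_sum => i _; apply: ler_sum => j _.
  rewrite [X in X ^+ 2]mxE kernop_couplopE [(- idealmx a) i j]mxE [idealmx a i j]mxE.
  rewrite -mulrBr exprMn exprVn sqr_sqrtr ?(ltW nn0)// ler_pM2l ?invr_gt0//.
  rewrite -real_normK ?num_real//.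
  apply: (@le_trans _ _ ((2 * M * d j) ^+ 2)).
    rewrite ler_sqr ?nnegrE ?mulr_ge0//; exact: conditional_defect.
  rewrite exprMn ler_wpM2l ?sqr_ge0// expr2 ler_piMr//.
rewrite sumr_const card_ord [leRHS]exprMn sqr_sqrtr// thetaE -[leLHS]mulr_natr -!mulr_sumr invfM.
rewrite [leLHS](_ : _ = (N1%:R / N1%:R) * ((2 * M) ^+ 2 * (N2%:R^-1 * \sum_j d j))); last by ring.
by rewrite divff ?gt_eqF// mul1r.
Qed.

End transfer.

(** The conditional expectation given [t], as a coupling of the system with
    itself. *)
Definition avgmx N (S : finType) (t : 'I_N -> S) : 'M[R]_N :=
  \matrix_(i, j) ((t i == t j)%:R / (N%:R ^+ 2 * label_freq t (t j))).

Lemma avgmx_sym N (S : finType) (t : 'I_N -> S) : (avgmx N S t)^T = avgmx N S t.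
Proof. by apply/matrixP => i j; rewrite !mxE eq_sym; case: eqP => [->|]//; rewrite !mul0r. Qed.

Lemma avgmx_coupling N (S : finType) (t : 'I_N -> S) : (0 < N)%N ->
  coupling (avgmx N S t).
Proof.
move=> N0; have n0 : N%:R != 0 :> R by rewrite pnatr_eq0 -lt0n.
have col j : \sum_i avgmx N S t i j = N%:R^-1.
  under eq_bigr do rewrite mxE.
  have f0 : label_freq t (t j) != 0 :> R by rewrite gt_eqF// label_freq_gt0.
  rewrite -mulr_suml; have -> : \sum_i (t i == t j)%:R = N%:R * label_freq t (t j) :> R.
    by rewrite mulrA divff// mul1r.
  by rewrite invfM expr2 invfM; field; rewrite f0 n0.
split=> [i j||i]; first by rewrite mxE divr_ge0// mulr_ge0 ?sqr_ge0// label_freq_ge0.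
  exact: col.
rewrite -(col i); apply: eq_bigr => j _.
by rewrite -[in LHS]avgmx_sym mxE.
Qed.

Lemma stepmx_avg N (S : finType) (t : 'I_N -> S) (a : S -> S -> R) : (0 < N)%N ->
  stepmx N S t a *m couplop N N (avgmx N S t) = stepmx N S t a.
Proof.
move=> N0; have n0 : N%:R != 0 :> R by rewrite pnatr_eq0 -lt0n.
apply/matrixP => i j; rewrite mxE [RHS]mxE.
have f0 : label_freq t (t j) != 0 :> R by rewrite gt_eqF// label_freq_gt0.
transitivity (\sum_k a (t i) (t j) * (N%:R * avgmx N S t k j)).
  apply: eq_bigr => k _; rewrite mxE [couplop _ _ _ k j]mxE -expr2 sqrtr_sqr.
  rewrite ger0_norm ?ler0n// !mxE.
  by case: eqP => [->//|_]; rewrite !mul0r !mulr0.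
rewrite -!mulr_sumr; have [_ -> _] := avgmx_coupling _ _ t N0.
by rewrite divff// mulr1.
Qed.

Lemma avg_stepmx N (S : finType) (t : 'I_N -> S) (a : S -> S -> R) : (0 < N)%N ->
  couplop N N (avgmx N S t) *m stepmx N S t a = stepmx N S t a.
Proof.
move=> N0; apply: trmx_inj; rewrite trmx_mul couplop_tr avgmx_sym.
have -> : (stepmx N S t a)^T = stepmx N S t (fun s s' => a s' s).
  by apply/matrixP => i j; rewrite !mxE.
exact: stepmx_avg.
Qed.

End step_kernels.

Section distance_bounds.
Variable R : realType.
Local Notation couplop := (couplop R _ _).

Lemma opb_commut_opnorm N1 N2 (w1 : 'M[R]_N1) (w2 : 'M[R]_N2) (g : 'M[R]_(N1, N2)) :
  (0 < N1)%N -> (0 < N2)%N ->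
  (Num.sqrt (N1%:R * N2%:R))^-1 *: (N2%:R *: (w1 *m g) - N1%:R *: (g *m w2))
  = commut R N1 N2 w1 w2 g.
Proof.
move=> N10 N20; have n1 : 0 < N1%:R :> R by rewrite ltr0n.
have n2 : 0 < N2%:R :> R by rewrite ltr0n.
have s0 : 0 < Num.sqrt (N1%:R * N2%:R) :> R by rewrite sqrtr_gt0 mulr_gt0.
have ss : Num.sqrt (N1%:R * N2%:R) ^+ 2 = N1%:R * N2%:R :> R.
  by rewrite sqr_sqrtr// mulr_ge0 ?ltW.
have E2 : (Num.sqrt (N1%:R * N2%:R))^-1 * N2%:R = N1%:R^-1 * Num.sqrt (N1%:R * N2%:R) :> R.
  move: s0 ss; move: (Num.sqrt _) => s s0 ss.
  apply: (mulfI (lt0r_neq0 s0)); rewrite mulrA divff ?gt_eqF// mul1r mulrCA -expr2 ss.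
  by rewrite mulKf// gt_eqF.
have E1 : (Num.sqrt (N1%:R * N2%:R))^-1 * N1%:R = N2%:R^-1 * Num.sqrt (N1%:R * N2%:R) :> R.
  move: s0 ss; move: (Num.sqrt _) => s s0 ss.
  apply: (mulfI (lt0r_neq0 s0)); rewrite mulrA divff ?gt_eqF// mul1r mulrCA -expr2 ss.
  by rewrite [N1%:R * _]mulrC mulKf// gt_eqF.
rewrite scalerBr !scalerA E1 E2 /commut /kernop /couplop.
by rewrite -!scalemxAl -!scalemxAr !scalerA (mulrC (Num.sqrt _)).
Qed.

Lemma l2_opnorm_scale m n (A : 'M[R]_(m, n)) k : 0 < k ->
  opb (k *: A) (k * l2_opnorm A) /\ (forall c, 0 <= c -> opb (k *: A) c -> k * l2_opnorm A <= c).
Proof.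
move=> k0; split=> [|c c0 hc].
  by have := opbZ _ _ _ _ _ k (opb_l2_opnorm _ _ _ A); rewrite ger0_norm// ltW.
rewrite -ler_pdivlMl//; apply: l2_opnorm_le; first by rewrite mulr_ge0 ?invr_ge0 ?(ltW k0).
have := opbZ _ _ _ _ _ k^-1 hc; rewrite scalerA mulVf ?gt_eqF// scale1r.
by rewrite ger0_norm// invr_ge0 ltW.
Qed.

Lemma commutN N1 N2 (w1 : 'M[R]_N1) (w2 : 'M[R]_N2) (g : 'M[R]_(N1, N2)) :
  (0 < N1)%N -> (0 < N2)%N ->
  (Num.sqrt (N1%:R * N2%:R))^-1 *: (N2%:R *: (g^T *m w1) - N1%:R *: (w2 *m g^T))
  = - commut R N2 N1 w2 w1 g^T.
Proof.
move=> N10 N20; rewrite -opb_commut_opnorm// -[RHS]scalerN opprB.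
by rewrite (mulrC N2%:R).
Qed.

Lemma bicoupling_cost_ge0 N1 N2 (w1 : 'M[R]_N1) (X1 : 'I_N1 -> torus R)
    (w2 : 'M[R]_N2) (X2 : 'I_N2 -> torus R) (g : 'M[R]_(N1, N2)) :
  coupling g -> 0 <= bicoupling_cost w1 X1 w2 X2 g.
Proof.
move=> [g0 _ _]; apply: addr_ge0.
  by apply: sumr_ge0 => i _; apply: sumr_ge0 => j _; rewrite mulr_ge0// torus_dist_ge0.
by rewrite mulr_ge0 ?invr_ge0 ?sqrtr_ge0// addr_ge0// l2_opnorm_ge0.
Qed.

Lemma bicoupling_dist_has_inf N1 N2 (w1 : 'M[R]_N1) (X1 : 'I_N1 -> torus R)
    (w2 : 'M[R]_N2) (X2 : 'I_N2 -> torus R) : (0 < N1)%N -> (0 < N2)%N ->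
  has_inf [set bicoupling_cost w1 X1 w2 X2 g | g in @coupling R N1 N2].
Proof.
move=> N10 N20; split; last by exists 0 => _ [g gC <-]; exact: bicoupling_cost_ge0.
have n1 : 0 < N1%:R :> R by rewrite ltr0n.
have n2 : 0 < N2%:R :> R by rewrite ltr0n.
have [|||g gC _] := complete_subcoupling R N1 N2 0 N10 N20.
- by move=> i j; rewrite mxE.
- by move=> i; rewrite big1 ?invr_ge0 ?ler0n// => j _; rewrite mxE.
- by move=> i; rewrite big1 ?invr_ge0 ?ler0n// => j _; rewrite mxE.
by exists (bicoupling_cost w1 X1 w2 X2 g), g.
Qed.

Lemma bicoupling_dist_ge0 N1 N2 (w1 : 'M[R]_N1) (X1 : 'I_N1 -> torus R)
    (w2 : 'M[R]_N2) (X2 : 'I_N2 -> torus R) : (0 < N1)%N -> (0 < N2)%N ->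
  0 <= bicoupling_dist w1 X1 w2 X2.
Proof.
move=> N10 N20; apply: lb_le_inf; first by case: (bicoupling_dist_has_inf _ _ w1 X1 w2 X2 N10 N20).
by move=> _ [g gC <-]; exact: bicoupling_cost_ge0.
Qed.

Lemma bicoupling_dist_le N1 N2 (w1 : 'M[R]_N1) (X1 : 'I_N1 -> torus R)
    (w2 : 'M[R]_N2) (X2 : 'I_N2 -> torus R) (g : 'M[R]_(N1, N2)) k1 k2 :
  (0 < N1)%N -> (0 < N2)%N -> coupling g -> 0 <= k1 -> 0 <= k2 ->
  opb (commut R N1 N2 w1 w2 g) k1 -> opb (commut R N2 N1 w2 w1 g^T) k2 ->
  bicoupling_dist w1 X1 w2 X2
  <= \sum_i1 \sum_i2 torus_dist (X1 i1) (X2 i2) * g i1 i2 + (k1 + k2).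
Proof.
move=> N10 N20 gC k10 k20 h1 h2.
apply: (@le_trans _ _ (bicoupling_cost w1 X1 w2 X2 g)).
  apply: ge_inf; last by exists g.
  by case: (bicoupling_dist_has_inf _ _ w1 X1 w2 X2 N10 N20).
have s0 : 0 < (Num.sqrt (N1%:R * N2%:R))^-1 :> R.
  by rewrite invr_gt0 sqrtr_gt0 mulr_gt0// ltr0n.
rewrite lerD2l mulrDr; apply: lerD.
  by apply: (l2_opnorm_scale _ _ _ _ s0).2 => //; rewrite opb_commut_opnorm.
by apply: (l2_opnorm_scale _ _ _ _ s0).2 => //; rewrite commutN//; exact: opbN.
Qed.

Lemma bicoupling_dist_adherent N1 N2 (w1 : 'M[R]_N1) (X1 : 'I_N1 -> torus R)
    (w2 : 'M[R]_N2) (X2 : 'I_N2 -> torus R) e :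
  (0 < N1)%N -> (0 < N2)%N -> bicoupling_dist w1 X1 w2 X2 < e ->
  exists g : 'M[R]_(N1, N2), [/\ coupling g,
    \sum_i1 \sum_i2 torus_dist (X1 i1) (X2 i2) * g i1 i2 <= e,
    opb (commut R N1 N2 w1 w2 g) e & opb (commut R N2 N1 w2 w1 g^T) e].
Proof.
move=> N10 N20 de; have := bicoupling_dist_has_inf _ _ w1 X1 w2 X2 N10 N20.
have d0 : 0 < e - bicoupling_dist w1 X1 w2 X2 by rewrite subr_gt0.
move=> /(inf_adherent d0)[_ [g gC <-]]; rewrite -/(bicoupling_dist _ _ _ _) addrC subrK.
move=> /ltW ce; exists g; move: ce; rewrite /bicoupling_cost mulrDr.
have s0 : 0 < (Num.sqrt (N1%:R * N2%:R))^-1 :> R.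
  by rewrite invr_gt0 sqrtr_gt0 mulr_gt0// ltr0n.
have [b1 _] := l2_opnorm_scale _ _ (N2%:R *: (w1 *m g) - N1%:R *: (g *m w2)) _ s0.
have [b2 _] := l2_opnorm_scale _ _ (N2%:R *: (g^T *m w1) - N1%:R *: (w2 *m g^T)) _ s0.
have p0 : 0 <= \sum_i1 \sum_i2 torus_dist (X1 i1) (X2 i2) * g i1 i2.
  have [g0 _ _] := gC.
  by apply: sumr_ge0 => i _; apply: sumr_ge0 => j _; rewrite mulr_ge0// torus_dist_ge0.
have p1 := mulr_ge0 (ltW s0) (l2_opnorm_ge0 _ _ _ (N2%:R *: (w1 *m g) - N1%:R *: (g *m w2))).
have p2 := mulr_ge0 (ltW s0) (l2_opnorm_ge0 _ _ _ (N2%:R *: (g^T *m w1) - N1%:R *: (w2 *m g^T))).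
rewrite opb_commut_opnorm// in b1; rewrite commutN// in b2.
move=> h; split => //; first lra.
- by apply: opb_le b1; lra.
- rewrite -[commut _ _ _ _ _ _]opprK; apply: opbN.
  by apply: opb_le b2; lra.
Qed.

(** The commutator of any coupling dominating [g] with kernels close to step
    kernels is governed by the prescribed conditional laws of the types. *)
Lemma commut_transfer N1 N2 (S1 S2 : finType) (t1 : 'I_N1 -> S1) (t2 : 'I_N2 -> S2)
    (w1 : 'M[R]_N1) (w2 : 'M[R]_N2) (gam g : 'M[R]_(N1, N2))
    (q : S1 -> S2 -> R) (r : S2 -> S1 -> R)
    (a1 : S1 -> S1 -> R) (a2 : S2 -> S2 -> R) M e c :
  (0 < N1)%N -> (0 < N2)%N -> coupling gam ->
  (forall i j, 0 <= g i j) -> (forall i j, g i j <= gam i j) ->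
  (forall t, \sum_s q s t <= 1) -> (forall s, \sum_t r t s <= 1) ->
  (forall s j, N2%:R * \sum_(k | t1 k == s) g k j <= q s (t2 j)) ->
  (forall t i, N1%:R * \sum_(k | t2 k == t) g i k <= r t (t1 i)) ->
  0 <= M -> (forall s s', `|a1 s s'| <= M) -> (forall s s', `|a2 s s'| <= M) ->
  0 <= e -> opb (kernop R N1 (w1 - stepmx R N1 S1 t1 a1)) e ->
  opb (kernop R N2 (w2 - stepmx R N2 S2 t2 a2)) e ->
  opb (idealmx R N1 N2 S1 S2 t1 t2 q a1
    - (idealmx R N2 N1 S2 S1 t2 t1 r (fun s s' => a2 s' s))^T) c ->
  opb (commut R N1 N2 w1 w2 gam)
    (2 * e + 4 * M * Num.sqrt (1 - \sum_i \sum_j g i j) + c).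
Proof.
move=> N10 N20 gamC g0 ggam q1 r1 gq gr M0 a1M a2M e0 h1 h2 hc.
set th := Num.sqrt _.
have L := transfer_left R N1 N2 N10 N20 S1 S2 t1 t2 gam g q gamC g0 ggam q1 gq a1 M M0 a1M.
have gT0 i j : 0 <= g^T i j by rewrite mxE.
have gTgam i j : g^T i j <= gam^T i j by rewrite !mxE.
have gTr t i : N1%:R * \sum_(k | t2 k == t) g^T k i <= r t (t1 i).
  by under eq_bigr do rewrite mxE; exact: gr.
have := transfer_left R N2 N1 N20 N10 S2 S1 t2 t1 gam^T g^T r (coupling_tr _ _ _ _ gamC)
  gT0 gTgam r1 gTr (fun s s' => a2 s' s) M M0 (fun s s' => a2M s' s).
have -> : \sum_i \sum_j g^T i j = \sum_i \sum_j g i j.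
  by rewrite exchange_big; apply: eq_bigr => i _; apply: eq_bigr => j _; rewrite mxE.
rewrite -/th in L *; have th0 : 0 <= th by exact: sqrtr_ge0.
have b0 : 0 <= 2 * M * th by rewrite !mulr_ge0.
move=> /(opb_tr _ _ _ _ _ b0); rewrite linearB/= trmx_mul couplop_tr trmxK kernop_tr.
have -> : (stepmx R N2 S2 t2 (fun s s' => a2 s' s))^T = stepmx R N2 S2 t2 a2.
  by apply/matrixP => i j; rewrite !mxE.
move=> Rt; have cc := couplop_contraction R N1 N2 gam N10 N20 gamC.
have e1 := opbM _ _ _ _ _ _ _ _ e0 h1 cc; have e2 := opbM _ _ _ _ _ _ _ _ ler01 cc h2.
rewrite mulr1 in e1; rewrite mul1r in e2.
have kernopB N (x y : 'M[R]_N) : kernop R N (x - y) = kernop R N x - kernop R N y.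
  by rewrite /kernop scalerBr.
rewrite !kernopB mulmxBl in e1; rewrite kernopB mulmxBr in e2.
have := opbD _ _ _ _ _ _ _ (opbB _ _ _ _ _ _ _ e1 e2)
  (opbD _ _ _ _ _ _ _ (opbB _ _ _ _ _ _ _ L Rt) hc).
have telescope (a b a' b' p s : 'M[R]_(N1, N2)) :
    a - a' - (b - b') + (a' - p - (b' - s) + (p - s)) = a - b.
  by apply/matrixP => i j; rewrite !mxE; ring.
rewrite telescope -/(commut R N1 N2 w1 w2 gam).
apply: opb_le; lra.
Qed.

Lemma idealmx_diag N1 N2 (S : finType) (t1 : 'I_N1 -> S) (t2 : 'I_N2 -> S) (a : S -> S -> R) :
  idealmx R N1 N2 S S t1 t2 (fun s t => (s == t)%:R) a
  - (idealmx R N2 N1 S S t2 t1 (fun s t => (s == t)%:R) (fun s s' => a s' s))^T = 0.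
Proof.
have del (f : S -> R) u : \sum_s f s * (s == u)%:R = f u.
  rewrite (bigD1 u)//= eqxx mulr1 big1 ?addr0// => s /negbTE ->.
  by rewrite mulr0.
by apply/matrixP => i j; rewrite !mxE !del (mulrC N1%:R) subrr.
Qed.

Definition type_law N1 N2 (S1 S2 : finType) (t1 : 'I_N1 -> S1) (t2 : 'I_N2 -> S2)
    (g : 'M[R]_(N1, N2)) s t :=
  \sum_i \sum_j (t1 i == s)%:R * (t2 j == t)%:R * g i j.

Lemma sum_type_law N1 N2 (S1 S2 : finType) (t1 : 'I_N1 -> S1) (t2 : 'I_N2 -> S2)
    (g : 'M[R]_(N1, N2)) (F : S1 -> S2 -> R) :
  \sum_s \sum_t type_law N1 N2 S1 S2 t1 t2 g s t * F s t
  = \sum_i \sum_j g i j * F (t1 i) (t2 j).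
Proof.
under eq_bigr => s _ do under eq_bigr => t _ do rewrite mulr_suml.
under eq_bigr => s _ do rewrite exchange_big/=.
rewrite exchange_big/=; apply: eq_bigr => i _.
under eq_bigr => s _ do under eq_bigr => t _ do rewrite mulr_suml.
under eq_bigr => s _ do rewrite exchange_big/=.
rewrite exchange_big/=; apply: eq_bigr => j _.
rewrite (bigD1 (t1 i))//= (bigD1 (t2 j))//= !eqxx !mul1r.
rewrite [X in _ + X + _]big1 ?addr0; last first.
  by move=> t /negbTE; rewrite eq_sym => ->; rewrite mulr0 !mul0r.
rewrite [X in _ + X]big1 ?addr0// => s /negbTE; rewrite eq_sym => ->.
by rewrite big1// => t _; rewrite !mul0r.
Qed.

Lemma type_law_marginal2 N1 N2 (S1 S2 : finType) (t1 : 'I_N1 -> S1) (t2 : 'I_N2 -> S2)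
    (g : 'M[R]_(N1, N2)) t : coupling g ->
  \sum_s type_law N1 N2 S1 S2 t1 t2 g s t = label_freq t2 t.
Proof.
move=> [_ gc _]; have := sum_type_law N1 N2 S1 S2 t1 t2 g (fun _ t' => (t' == t)%:R).
have -> : \sum_s \sum_t' type_law N1 N2 S1 S2 t1 t2 g s t' * (t' == t)%:R =
    \sum_s type_law N1 N2 S1 S2 t1 t2 g s t.
  apply: eq_bigr => s _; rewrite (bigD1 t)//= eqxx mulr1 big1 ?addr0// => t' /negbTE ->.
  by rewrite mulr0.
move=> ->; rewrite exchange_big/= /label_freq mulr_sumr; apply: eq_bigr => j _.
by rewrite -mulr_suml gc.
Qed.

Lemma type_law_tr N1 N2 (S1 S2 : finType) (t1 : 'I_N1 -> S1) (t2 : 'I_N2 -> S2)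
    (g : 'M[R]_(N1, N2)) s t :
  type_law N2 N1 S2 S1 t2 t1 g^T t s = type_law N1 N2 S1 S2 t1 t2 g s t.
Proof.
rewrite /type_law exchange_big; apply: eq_bigr => i _; apply: eq_bigr => j _.
by rewrite mxE (mulrC (t2 j == t)%:R).
Qed.

Definition cond_law N1 N2 (S1 S2 : finType) (t1 : 'I_N1 -> S1) (t2 : 'I_N2 -> S2)
    (g : 'M[R]_(N1, N2)) s t :=
  type_law N1 N2 S1 S2 t1 t2 g s t / label_freq t2 t.

(** Conditioning on the type of the second marginal is a composition with
    [avgmx]. *)
Lemma idealmx_avg N1 N2 (S1 S2 : finType) (t1 : 'I_N1 -> S1) (t2 : 'I_N2 -> S2)
    (g : 'M[R]_(N1, N2)) (a : S1 -> S1 -> R) : (0 < N1)%N -> (0 < N2)%N ->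
  idealmx R N1 N2 S1 S2 t1 t2 (cond_law N1 N2 S1 S2 t1 t2 g) a
  = kernop R N1 (stepmx R N1 S1 t1 a) *m couplop g *m couplop (avgmx R N2 S2 t2).
Proof.
move=> N10 N20; apply/matrixP => i j; rewrite [RHS]mxE [LHS]mxE.
have n2 : N2%:R != 0 :> R by rewrite pnatr_eq0 -lt0n.
have f0 : label_freq t2 (t2 j) != 0 :> R by rewrite gt_eqF// label_freq_gt0.
transitivity (\sum_l (Num.sqrt (N1%:R * N2%:R))^-1 *
   \sum_k g k l * (a (t1 i) (t1 k) * (t2 l == t2 j)%:R / label_freq t2 (t2 j))).
  rewrite -mulr_sumr; congr (_ * _).
  rewrite exchange_big/= -(sum_type_law _ _ _ _ t1 t2 g
    (fun s t => a (t1 i) s * (t == t2 j)%:R / label_freq t2 (t2 j))).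
  apply: eq_bigr => s _; rewrite (bigD1 (t2 j))//= big1 => [|t /negbTE ->]; last first.
    by rewrite mulr0 mul0r mulr0.
  by rewrite addr0 eqxx mulr1 /cond_law; ring.
apply: eq_bigr => l _; rewrite kernop_couplopE// -mulrA; congr (_ * _).
rewrite !mxE -expr2 sqrtr_sqr ger0_norm ?ler0n// mulr_sumr mulr_suml.
apply: eq_bigr => k _; rewrite expr2; field; by rewrite n2 f0.
Qed.

(** Step kernels are unchanged by averaging over types, so the two ideal products
    differ by the commutator of the step kernels compressed between two averaging
    operators, which are contractions. *)
Lemma ideal_commut N1 N2 (S1 S2 : finType) (t1 : 'I_N1 -> S1) (t2 : 'I_N2 -> S2)
    (w1 : 'M[R]_N1) (w2 : 'M[R]_N2) (g : 'M[R]_(N1, N2))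
    (a1 : S1 -> S1 -> R) (a2 : S2 -> S2 -> R) e c :
  (0 < N1)%N -> (0 < N2)%N -> coupling g -> 0 <= e -> 0 <= c ->
  opb (kernop R N1 (w1 - stepmx R N1 S1 t1 a1)) e ->
  opb (kernop R N2 (w2 - stepmx R N2 S2 t2 a2)) e ->
  opb (commut R N1 N2 w1 w2 g) c ->
  opb (idealmx R N1 N2 S1 S2 t1 t2 (cond_law N1 N2 S1 S2 t1 t2 g) a1
    - (idealmx R N2 N1 S2 S1 t2 t1 (cond_law N2 N1 S2 S1 t2 t1 g^T) (fun s s' => a2 s' s))^T)
    (c + 2 * e).
Proof.
move=> N10 N20 gC e0 c0 h1 h2 hc; rewrite !idealmx_avg// !trmx_mul !couplop_tr trmxK.
rewrite avgmx_sym kernop_tr.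
have -> : (stepmx R N2 S2 t2 (fun s s' => a2 s' s))^T = stepmx R N2 S2 t2 a2.
  by apply/matrixP => i j; rewrite !mxE.
have A1 := couplop_contraction R _ _ _ N10 N10 (avgmx_coupling R N1 S1 t1 N10).
have A2 := couplop_contraction R _ _ _ N20 N20 (avgmx_coupling R N2 S2 t2 N20).
have E1 : couplop (avgmx R N1 S1 t1) *m kernop R N1 (stepmx R N1 S1 t1 a1)
    = kernop R N1 (stepmx R N1 S1 t1 a1).
  by rewrite /kernop -scalemxAr avg_stepmx.
have E2 : kernop R N2 (stepmx R N2 S2 t2 a2) *m couplop (avgmx R N2 S2 t2)
    = kernop R N2 (stepmx R N2 S2 t2 a2).
  by rewrite /kernop -scalemxAl stepmx_avg.
have -> : kernop R N1 (stepmx R N1 S1 t1 a1) *m couplop g *m couplop (avgmx R N2 S2 t2)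
    - couplop (avgmx R N1 S1 t1) *m (couplop g *m kernop R N2 (stepmx R N2 S2 t2 a2))
  = couplop (avgmx R N1 S1 t1) *m commut R N1 N2 (stepmx R N1 S1 t1 a1) (stepmx R N2 S2 t2 a2) g
    *m couplop (avgmx R N2 S2 t2).
  by rewrite /commut mulmxBr mulmxBl !mulmxA E1 
    -(mulmxA (couplop (avgmx R N1 S1 t1) *m couplop g)) E2.
rewrite -[c + _]mulr1 -[c + _]mul1r.
have n0 : 0 <= 1 * (c + 2 * e) by rewrite mul1r addr_ge0// mulr_ge0.
apply: opbM => //; apply: opbM => //.
have -> : commut R N1 N2 (stepmx R N1 S1 t1 a1) (stepmx R N2 S2 t2 a2) g
  = commut R N1 N2 w1 w2 g - (kernop R N1 (w1 - stepmx R N1 S1 t1 a1) *m couplop g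
     - couplop g *m kernop R N2 (w2 - stepmx R N2 S2 t2 a2)).
  have telescope (a b a' b' : 'M[R]_(N1, N2)) : a' - b' = a - b - ((a - a') - (b - b')).
    by apply/matrixP => i j; rewrite !mxE; ring.
  by rewrite /commut /kernop !scalerBr mulmxBl mulmxBr; exact: telescope.
have cc := couplop_contraction R N1 N2 g N10 N20 gC.
have e1 := opbM _ _ _ _ _ _ _ _ e0 h1 cc; have e2 := opbM _ _ _ _ _ _ _ _ ler01 cc h2.
rewrite mulr1 in e1; rewrite mul1r in e2.
apply: opb_le (opbB _ _ _ _ _ _ _ hc (opbB _ _ _ _ _ _ _ e1 e2)); lra.
Qed.

End distance_bounds.

Section label_transfer.
Variable R : realType.

(** Completing a sub-coupling [g] to [gam] changes averages of functions
    bounded by 1 by at most the missing mass. *)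
Lemma coupling_average_le N1 N2 (g gam : 'M[R]_(N1, N2)) (f h : 'I_N1 -> 'I_N2 -> R) :
  (0 < N1)%N -> coupling gam -> (forall i j, 0 <= g i j) ->
  (forall i j, g i j <= gam i j) ->
  (forall i j, f i j <= 1) -> (forall i j, f i j <= h i j) ->
  \sum_i \sum_j f i j * gam i j
  <= (1 - \sum_i \sum_j g i j) + \sum_i \sum_j g i j * h i j.
Proof.
move=> N10 gamC g0 ggam f1 fh.
rewrite -(coupling_mass _ _ _ _ N10 gamC) -sumrB -big_split/=; apply: ler_sum => i _.
rewrite -sumrB -big_split/=; apply: ler_sum => j _.
have -> : f i j * gam i j = f i j * (gam i j - g i j) + g i j * f i j by ring.
apply: lerD; last by rewrite ler_wpM2l.
by rewrite ler_piMl// subr_ge0.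
Qed.

(** Given a coupling [gam0] of two systems with types [t1], [t2], and extra
    labels [r1], [r2] nearly independent of the types and of the same law [p],
    a new coupling matches the extra labels while inducing nearly the same law on
    pairs of types. The commutation relations see a coupling only through this law,
    up to the errors of the step kernels, and thus survive; [Th] is the mass that
    has to be coupled without regard to the labels. *)
Lemma relabelled_coupling N1 N2 (S1 S2 T : finType) (t1 : 'I_N1 -> S1) (t2 : 'I_N2 -> S2)
    (r1 : 'I_N1 -> T) (r2 : 'I_N2 -> T) (p : T -> R)
    (w1 : 'M[R]_N1) (w2 : 'M[R]_N2) (gam0 : 'M[R]_(N1, N2))
    (a1 : S1 -> S1 -> R) (a2 : S2 -> S2 -> R) M e c :
  let Th := \sum_l `|label_freq t1 l.1 * p l.2 - label_freq (fun i => (t1 i, r1 i)) l|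
    + \sum_l `|label_freq t2 l.1 * p l.2 - label_freq (fun i => (t2 i, r2 i)) l| in
  (0 < N1)%N -> (0 < N2)%N -> coupling gam0 ->
  (forall x, 0 <= p x) -> \sum_x p x = 1 ->
  0 <= M -> (forall s s', `|a1 s s'| <= M) -> (forall s s', `|a2 s s'| <= M) ->
  0 <= e -> 0 <= c -> opb (kernop R N1 (w1 - stepmx R N1 S1 t1 a1)) e ->
  opb (kernop R N2 (w2 - stepmx R N2 S2 t2 a2)) e ->
  opb (commut R N1 N2 w1 w2 gam0) c -> opb (commut R N2 N1 w2 w1 gam0^T) c ->
  exists gam : 'M[R]_(N1, N2), [/\ coupling gam,
    opb (commut R N1 N2 w1 w2 gam) (4 * e + 4 * M * Num.sqrt Th + c),
    opb (commut R N2 N1 w2 w1 gam^T) (4 * e + 4 * M * Num.sqrt Th + c) &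
    forall (f : 'I_N1 -> 'I_N2 -> R) (F : S1 -> S2 -> R) (J1 : 'I_N1 -> R) (J2 : 'I_N2 -> R),
      (forall i j, f i j <= 1) -> (forall s t, 0 <= F s t) ->
      (forall i, 0 <= J1 i) -> (forall j, 0 <= J2 j) ->
      (forall i j, r1 i = r2 j -> f i j <= F (t1 i) (t2 j) + J1 i + J2 j) ->
      \sum_i \sum_j f i j * gam i j <=
        Th + \sum_i \sum_j gam0 i j * F (t1 i) (t2 j)
        + N1%:R^-1 * \sum_i J1 i + N2%:R^-1 * \sum_j J2 j].
Proof.
move=> Th N10 N20 gC p0 p1 M0 a1M a2M e0 c0 hw1 hw2 hc hc'.
pose G := type_law R N1 N2 S1 S2 t1 t2 gam0.
have [g00 g0c g0r] := gC.
have G0 s t : 0 <= G s t.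
  by apply: sumr_ge0 => i _; apply: sumr_ge0 => j _; rewrite !mulr_ge0.
have G2 t : \sum_s G s t = label_freq t2 t by exact: type_law_marginal2.
have G1 s : \sum_t G s t = label_freq t1 s.
  rewrite -(type_law_marginal2 R N2 N1 S2 S1 t2 t1 gam0^T s (coupling_tr _ _ _ _ gC)).
  by apply: eq_bigr => t _; rewrite type_law_tr.
pose l1 i := (t1 i, r1 i); pose l2 j := (t2 j, r2 j).
pose H (a : S1 * T) (b : S2 * T) := G a.1 b.1 * p a.2 * (a.2 == b.2)%:R.
pose h1 (a : S1 * T) := label_freq t1 a.1 * p a.2.
pose h2 (a : S2 * T) := label_freq t2 a.1 * p a.2.
have H0 a b : 0 <= H a b by rewrite !mulr_ge0.
have delta x : \sum_y p x * (x == y)%:R = p x :> R.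
  rewrite (bigD1 x)//= eqxx mulr1 big1 ?addr0// => z.
  by rewrite eq_sym => /negbTE ->; rewrite mulr0.
have delta' y : \sum_x p x * (x == y)%:R = p y :> R.
  rewrite (bigD1 y)//= eqxx mulr1 big1 ?addr0// => z.
  by move=> /negbTE ->; rewrite mulr0.
have H1 a : \sum_b H a b = h1 a.
  rewrite -(pair_bigA _ (fun b1 b2 => G a.1 b1 * p a.2 * (a.2 == b2)%:R))/=.
  rewrite /h1 -G1 mulr_suml; apply: eq_bigr => b1 _.
  under eq_bigr do rewrite -mulrA.
  by rewrite -mulr_sumr delta.
have H2 b : \sum_a H a b = h2 b.
  rewrite -(pair_bigA _ (fun a1 a2 => G a1 b.1 * p a2 * (a2 == b.2)%:R))/=.
  rewrite /h2 -G2 mulr_suml; apply: eq_bigr => x _.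
  under eq_bigr do rewrite -mulrA.
  by rewrite -mulr_sumr delta'.
pose g := label_subcoupling R N1 N2 _ _ l1 l2 H h1 h2.
have gT : g^T = label_subcoupling R N2 N1 _ _ l2 l1 (fun b a => H a b) h2 h1.
  exact: label_subcoupling_tr.
have g0 i j : 0 <= g i j by apply: label_subcoupling_ge0.
have grow i : \sum_j g i j <= N1%:R^-1 by exact: label_subcoupling_row.
have gcol j : \sum_i g i j <= N2%:R^-1.
  have := label_subcoupling_row R N2 N1 N20 N10 _ _ l2 l1 (fun b a => H a b) h2 h1
    (fun b a => H0 a b) H2 j.
  by rewrite -gT; under eq_bigr do rewrite mxE.
have [gam gamC ggam] := complete_subcoupling _ _ _ g N10 N20 g0 grow gcol.
have h11 : \sum_a h1 a = 1.
  rewrite -(pair_bigA _ (fun s x => label_freq t1 s * p x))/=.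
  under eq_bigr do rewrite -mulr_sumr p1 mulr1.
  exact: sum_label_freq.
have mass := label_subcoupling_mass R N1 N2 N10 N20 _ _ l1 l2 H h1 h2 H0 H1 H2 h11.
rewrite -/g -/Th in mass.
have th0 : 0 <= 1 - \sum_i \sum_j g i j.
  by rewrite subr_ge0 -(coupling_mass _ _ _ _ N10 gamC); apply: ler_sum => i _; apply: ler_sum.
have Th0 : 0 <= Th by apply: le_trans mass.
have sq : Num.sqrt (1 - \sum_i \sum_j g i j) <= Num.sqrt Th by rewrite ler_sqrt.
pose q := cond_law R N1 N2 S1 S2 t1 t2 gam0.
pose r := cond_law R N2 N1 S2 S1 t2 t1 gam0^T.
have q0 s t : 0 <= q s t by rewrite divr_ge0// label_freq_ge0.
have r0 s t : 0 <= r t s by rewrite /r /cond_law type_law_tr divr_ge0// label_freq_ge0.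
have q1 t : \sum_s q s t <= 1.
  by rewrite -mulr_suml G2; apply: ratio_le1; rewrite ?label_freq_ge0.
have r1' s : \sum_t r t s <= 1.
  rewrite -mulr_suml; under eq_bigr do rewrite type_law_tr.
  by rewrite G1; apply: ratio_le1; rewrite ?label_freq_ge0.
have gr t i : N1%:R * \sum_(k | t2 k == t) g i k <= r t (t1 i).
  apply: (label_subcoupling_class R N1 N2 N10 N20 _ _ l1 l2 H h1 h2 H0 H1
    (fun b => b.1 == t)) => //.
  rewrite (eq_bigl (fun b => (b.1 == t) && true)); last by move=> b; rewrite andbT.
  rewrite -(pair_big (fun s => s == t) xpredT (fun b1 b2 => G (t1 i) b1 * p (r1 i) * (r1 i == b2)%:R))/=.
  rewrite big_pred1_eq; under eq_bigr do rewrite -mulrA.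
  rewrite -mulr_sumr delta// /r /cond_law type_law_tr /h1/= -/G mulrCA mulrA.
  rewrite mulrCA divff ?gt_eqF ?label_freq_gt0// mulr1 mulrC lexx//.
have gq s j : N2%:R * \sum_(k | t1 k == s) g k j <= q s (t2 j).
  have := label_subcoupling_class R N2 N1 N20 N10 _ _ l2 l1 (fun b a => H a b) h2 h1
    (fun b a => H0 a b) H2 (fun a => a.1 == s) (q s (t2 j)) j (q0 _ _).
  rewrite -gT => hh; apply: le_trans (hh _).
    by under [in leRHS]eq_bigr do rewrite mxE.
  rewrite (eq_bigl (fun b => (b.1 == s) && true)); last by move=> b; rewrite andbT.
  rewrite -(pair_big (fun s' => s' == s) xpredT (fun a1 a2 => G a1 (t2 j) * p a2 * (a2 == r2 j)%:R))/=.
  rewrite big_pred1_eq; under eq_bigr do rewrite -mulrA.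
  rewrite -mulr_sumr delta'// /q /cond_law /h2/= -/G mulrA divfK//.
  by rewrite gt_eqF// label_freq_gt0.
have e4 : 4 * e + 4 * M * Num.sqrt Th + c = 2 * e + 4 * M * Num.sqrt Th + (c + 2 * e) by ring.
have mono (x : R) : 2 * e + 4 * M * Num.sqrt (1 - \sum_i \sum_j g i j) + x <=
    2 * e + 4 * M * Num.sqrt Th + x by rewrite lerD2r lerD2l ler_wpM2l// mulr_ge0.
exists gam; split => //.
- rewrite e4; apply: (opb_le _ _ _ _ _ _ (mono _)).
  apply: (commut_transfer R N1 N2 S1 S2 t1 t2 w1 w2 gam g q r a1 a2) => //.
  exact: ideal_commut.
- rewrite e4; apply: (opb_le _ _ _ _ _ _ (mono _)).
  have -> : \sum_i \sum_j g i j = \sum_i \sum_j g^T i j.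
    by rewrite exchange_big; apply: eq_bigr => i _; apply: eq_bigr => j _; rewrite [RHS]mxE.
  apply: (commut_transfer R N2 N1 S2 S1 t2 t1 w2 w1 gam^T g^T r q a2 a1) => //.
  + exact: coupling_tr.
  + by move=> i j; rewrite [g^T i j]mxE.
  + by move=> i j; rewrite [g^T i j]mxE [gam^T i j]mxE.
  + by move=> s j; under eq_bigr do rewrite mxE; exact: gr.
  + by move=> s j; under eq_bigr do rewrite mxE; exact: gq.
  + have := ideal_commut R N2 N1 S2 S1 t2 t1 w2 w1 gam0^T a2 a1 e c N20 N10
      (coupling_tr _ _ _ _ gC) e0 c0 hw2 hw1 hc'.
    by rewrite trmxK.
move=> f F J1 J2 f1 F0 J10 J20 fF.
pose FF (a : S1 * T) (b : S2 * T) : R := F a.1 b.1 + (a.2 != b.2)%:R.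
have := coupling_average_le _ _ g gam f (fun i j => FF (l1 i) (l2 j) + J1 i + J2 j)
  N10 gamC g0 ggam f1.
move=> /(_ _)/le_trans; apply=> [i j|].
  rewrite /FF/=; case: eqP => [/fF|_] /=; first by rewrite addr0.
  have := f1 i j; have := F0 (t1 i) (t2 j); have := J10 i; have := J20 j; lra.
have split3 : \sum_i \sum_j g i j * (FF (l1 i) (l2 j) + J1 i + J2 j) =
  \sum_i \sum_j g i j * FF (l1 i) (l2 j) + \sum_i \sum_j g i j * J1 i + \sum_i \sum_j g i j * J2 j.
  rewrite -!big_split/=; apply: eq_bigr => i _; rewrite -!big_split/=.
  by apply: eq_bigr => j _; rewrite !mulrDr.
rewrite split3 !addrA; apply: lerD; [apply: lerD; [apply: lerD => //|]|].
- apply: (le_trans (label_subcoupling_le R N1 N2 N10 N20 _ _ l1 l2 H h1 h2 H0 FF _)).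
    by move=> a b; rewrite addr_ge0.
  rewrite -(sum_type_law R N1 N2 S1 S2 t1 t2 gam0 F).
  rewrite -(pair_bigA _ (fun a1 a2 => \sum_b H (a1, a2) b * FF (a1, a2) b))/=.
  apply: ler_sum => s _; rewrite exchange_big/=.
  rewrite -(pair_bigA _ (fun b1 b2 => \sum_x H (s, x) (b1, b2) * FF (s, x) (b1, b2)))/=.
  apply: ler_sum => t _.
  apply: (@le_trans _ _ (\sum_y p y * (G s t * F s t))).
    apply: ler_sum => y _.
    rewrite (bigD1 y)//= big1 => [|x /negbTE xy]; last by rewrite /H/= xy mulr0 mul0r.
    rewrite addr0 /H /FF/= eqxx/= mulr1 addr0 -[leLHS]mulrA mulrCA lexx//.
  by rewrite -mulr_suml p1 mul1r.
- rewrite mulr_sumr; apply: ler_sum => i _; rewrite -mulr_suml ler_wpM2r//.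
- rewrite exchange_big mulr_sumr; apply: ler_sum => j _; rewrite -mulr_suml ler_wpM2r//.
Qed.

(** Coupling equal types, up to the discrepancy of their frequencies, makes the
    common step kernel commute with the coupling. *)
Lemma same_kernel_dist N1 N2 (S : finType) (t1 : 'I_N1 -> S) (t2 : 'I_N2 -> S)
    (w1 : 'M[R]_N1) (w2 : 'M[R]_N2) (X1 : 'I_N1 -> torus R) (X2 : 'I_N2 -> torus R)
    (a : S -> S -> R) M e c :
  let Th := \sum_s `|label_freq t1 s - label_freq t2 s| in
  (0 < N1)%N -> (0 < N2)%N -> 0 <= M -> (forall s s', `|a s s'| <= M) ->
  0 <= e -> 0 <= c -> opb (kernop R N1 (w1 - stepmx R N1 S t1 a)) e ->
  opb (kernop R N2 (w2 - stepmx R N2 S t2 a)) e ->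
  (forall i j, t1 i = t2 j -> torus_dist (X1 i) (X2 j) <= c) ->
  bicoupling_dist w1 X1 w2 X2 <= Th + c + (4 * e + 8 * M * Num.sqrt Th).
Proof.
move=> Th N10 N20 M0 aM e0 c0 hw1 hw2 hX.
pose h1 s := label_freq t1 s : R.
pose H s t := h1 s * (s == t)%:R.
have h10 s : 0 <= h1 s by exact: label_freq_ge0.
have H0 s t : 0 <= H s t by rewrite mulr_ge0.
have H1 s : \sum_t H s t = h1 s.
  rewrite /H (bigD1 s)//= eqxx mulr1 big1 ?addr0// => z.
  by rewrite eq_sym => /negbTE ->; rewrite mulr0.
have H2 t : \sum_s H s t = h1 t.
  rewrite /H (bigD1 t)//= eqxx mulr1 big1 ?addr0// => z.
  by move=> /negbTE ->; rewrite mulr0.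
pose g := label_subcoupling R N1 N2 _ _ t1 t2 H h1 h1.
have gT : g^T = label_subcoupling R N2 N1 _ _ t2 t1 (fun b a => H a b) h1 h1.
  exact: label_subcoupling_tr.
have g0 i j : 0 <= g i j by apply: label_subcoupling_ge0.
have grow i : \sum_j g i j <= N1%:R^-1 by exact: label_subcoupling_row.
have gcol j : \sum_i g i j <= N2%:R^-1.
  have := label_subcoupling_row R N2 N1 N20 N10 _ _ t2 t1 (fun b a => H a b) h1 h1
    (fun b a => H0 a b) H2 j.
  by rewrite -gT; under eq_bigr do rewrite mxE.
have [gam gamC ggam] := complete_subcoupling _ _ _ g N10 N20 g0 grow gcol.
have h11 : \sum_a h1 a = 1 by exact: sum_label_freq.
have mass := label_subcoupling_mass R N1 N2 N10 N20 _ _ t1 t2 H h1 h1 H0 H1 H2 h11.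
have hz : \sum_s `|h1 s - label_freq t1 s| = 0.
  by rewrite big1// => s _; rewrite subrr normr0.
rewrite -/g hz add0r -/Th in mass.
have th0 : 0 <= 1 - \sum_i \sum_j g i j.
  by rewrite subr_ge0 -(coupling_mass _ _ _ _ N10 gamC); apply: ler_sum => i _; apply: ler_sum.
have Th0 : 0 <= Th by apply: le_trans mass.
have sq : Num.sqrt (1 - \sum_i \sum_j g i j) <= Num.sqrt Th by rewrite ler_sqrt.
pose q (s t : S) : R := (s == t)%:R.
have q1 t : \sum_s q s t <= 1.
  rewrite (bigD1 t)//= /q eqxx big1 ?addr0// => z.
  by move=> /negbTE ->.
have gr t i : N1%:R * \sum_(k | t2 k == t) g i k <= q t (t1 i).
  apply: (label_subcoupling_class R N1 N2 N10 N20 _ _ t1 t2 H h1 h1 H0 H1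
    (fun b => b == t)) => //.
  by rewrite big_pred1_eq /H /q eq_sym mulrC.
have gq s j : N2%:R * \sum_(k | t1 k == s) g k j <= q s (t2 j).
  have := label_subcoupling_class R N2 N1 N20 N10 _ _ t2 t1 (fun b a => H a b) h1 h1
    (fun b a => H0 a b) H2 (fun a => a == s) (q s (t2 j)) j (ler0n _ _).
  rewrite -gT => hh; apply: le_trans (hh _).
    by under [in leRHS]eq_bigr do rewrite mxE.
  rewrite big_pred1_eq /H /q; case: eqP => [->|_]; by rewrite ?mulr1 ?mul1r ?mulr0 ?mul0r.
have ms : 4 * M * Num.sqrt (1 - \sum_i \sum_j g i j) <= 4 * M * Num.sqrt Th.
  by rewrite ler_wpM2l// mulr_ge0.
have k0 : 0 <= 2 * e + 4 * M * Num.sqrt Th by rewrite addr_ge0// !mulr_ge0// sqrtr_ge0.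
have b1 : opb (commut R N1 N2 w1 w2 gam) (2 * e + 4 * M * Num.sqrt Th).
  apply: (@opb_le _ _ _ _ (2 * e + 4 * M * Num.sqrt (1 - \sum_i \sum_j g i j) + 0)).
    by rewrite addr0 lerD2l.
  apply: (commut_transfer R N1 N2 S S t1 t2 w1 w2 gam g q q a a) => //.
  rewrite idealmx_diag => x; rewrite mul0mx mul0r l2norm0 lexx//.
have b2 : opb (commut R N2 N1 w2 w1 gam^T) (2 * e + 4 * M * Num.sqrt Th).
  apply: (@opb_le _ _ _ _ (2 * e + 4 * M * Num.sqrt (1 - \sum_i \sum_j g i j) + 0)).
    by rewrite addr0 lerD2l.
  have -> : \sum_i \sum_j g i j = \sum_i \sum_j g^T i j.
    by rewrite exchange_big; apply: eq_bigr => i _; apply: eq_bigr => j _; rewrite [RHS]mxE.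
  apply: (commut_transfer R N2 N1 S S t2 t1 w2 w1 gam^T g^T q q a a) => //.
  + exact: coupling_tr.
  + by move=> i j; rewrite [g^T i j]mxE.
  + by move=> i j; rewrite [g^T i j]mxE [gam^T i j]mxE.
  + by move=> s j; under eq_bigr do rewrite mxE; exact: gr.
  + by move=> s j; under eq_bigr do rewrite mxE; exact: gq.
  + rewrite idealmx_diag => x; rewrite mul0mx mul0r l2norm0 lexx//.
apply: (le_trans (bicoupling_dist_le _ _ _ _ _ _ _ _ _ _ N10 N20 gamC k0 k0 b1 b2)).
apply: (@le_trans _ _ (Th + c + (2 * e + 4 * M * Num.sqrt Th + (2 * e + 4 * M * Num.sqrt Th)))).
  rewrite lerD2r.
  pose FF (s t : S) : R := c + (s != t)%:R.
  have := coupling_average_le _ _ g gam (fun i j => torus_dist (X1 i) (X2 j))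
    (fun i j => FF (t1 i) (t2 j)) N10 gamC g0 ggam (fun i j => torus_dist_le1 _ _ _).
  move=> /(_ _)/le_trans; apply=> [i j|].
    rewrite /FF/=; case: eqP => [/hX|_] /=; first by rewrite addr0.
    by apply: (le_trans (torus_dist_le1 _ _ _)); rewrite lerDr.
  apply: lerD => //.
  apply: (le_trans (label_subcoupling_le R N1 N2 N10 N20 _ _ t1 t2 H h1 h1 H0 FF _)).
    by move=> s t; rewrite addr_ge0.
  rewrite -[leRHS]mul1r -h11 mulr_suml; apply: ler_sum => s _.
  rewrite (bigD1 s)//= big1 => [|x /negbTE xy]; last by rewrite /H eq_sym xy mulr0 mul0r.
  by rewrite /H /FF eqxx/= mulr1 !addr0.
lra.
Qed.

End label_transfer.

(** * Compactness *)

Section compactness.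
Variable R : realType.

Lemma tail_sup_cvg0 (f : nat * nat -> \bar R) : (forall p, (0 <= f p)%E) ->
  (forall e : R, 0 < e -> exists n0, forall p, (n0 <= p.1)%N -> (n0 <= p.2)%N -> (f p <= e%:E)%E) ->
  (fun n => ereal_sup [set f p | p in [set p : nat * nat | (n <= p.1)%N /\ (n <= p.2)%N]])
    @ \oo --> 0%E.
Proof.
move=> f0 H; pose s n := ereal_sup [set f p | p in [set p : nat * nat | (n <= p.1)%N /\ (n <= p.2)%N]].
have s0 n : (0 <= s n)%E.
  by apply: (le_trans (f0 (n, n))); apply: ereal_sup_ubound; exists (n, n).
have se (e : R) : 0 < e -> exists n0, forall n, (n0 <= n)%N -> (s n <= e%:E)%E.
  move=> /H[n0 hn0]; exists n0 => n nn0; apply: ge_ereal_sup => _ [p [p1 p2] <-].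
  by apply: hn0; [exact: leq_trans p1|exact: leq_trans p2].
have [n1 hn1] := se 1 ltr01.
have fin n : (n1 <= n)%N -> s n \is a fin_num.
  by move=> nn; rewrite ge0_fin_numE// (le_lt_trans (hn1 n nn))// ltry.
apply/fine_cvgP; split; first by exists n1 => // n /= nn; exact: fin.
apply/cvgrPdist_le => e e0; have [n2 hn2] := se e e0.
exists (maxn n1 n2) => // n /=; rewrite geq_max => /andP[nn1 nn2] /=.
rewrite sub0r normrN ger0_norm ?fine_ge0//; last exact: s0.
by rewrite -lee_fin fineK ?fin//; exact: hn2.
Qed.

Lemma tail_sup_cvg0P (f : nat * nat -> R) : (forall p, 0 <= f p) ->
  (fun n => ereal_sup [set (f p)%:E | p in [set p : nat * nat | (n <= p.1)%N /\ (n <= p.2)%N]])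
    @ \oo --> 0%E ->
  forall e : R, 0 < e -> exists n0, forall p, (n0 <= p.1)%N -> (n0 <= p.2)%N -> f p < e.
Proof.
move=> f0 /fine_cvgP[[n1 _ hn1]] /cvgrPdist_lt h e e0.
have [n2 _ hn2] := h e e0; exists (maxn n1 n2) => p p1 p2.
pose n := maxn n1 n2.
have nn1 : (n1 <= n)%N by rewrite leq_maxl.
have nn2 : (n2 <= n)%N by rewrite leq_maxr.
have := hn2 n nn2; have := hn1 n nn1 => /= fn; rewrite /= sub0r normrN => hh.
rewrite -lte_fin; apply: (@le_lt_trans _ _ (fine (ereal_sup
   [set (f p)%:E | p in [set p : nat * nat | (n <= p.1)%N /\ (n <= p.2)%N]]))%:E).
  by rewrite fineK//; apply: ereal_sup_ubound; exists p.
by rewrite lte_fin; apply: le_lt_trans hh; exact: ler_norm.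
Qed.

(** Each colouring is constant on some infinite subset of the set selected by the
    previous ones, and a diagonal sequence is eventually in all these subsets. *)
Lemma diagonal_colours (Col : nat -> finType) (c : forall k, nat -> Col k) :
  exists2 phi : nat -> nat, {homo phi : m n / (m < n)%N} &
    forall k m n, (k < m)%N -> (k < n)%N -> c k (phi m) = c k (phi n).
Proof.
pose infinite_set (A : set nat) := forall n, exists m, (n <= m)%N /\ A m.
have refine k (A : set nat) : infinite_set A ->
    exists x : Col k, infinite_set (A `&` [set n | c k n = x]).
  move=> iA; apply: contrapT => /forallNP hx.
  have {}hx x : exists n, forall m, (n <= m)%N -> A m -> c k m <> x.
    have /existsNP[n hn] := hx x; exists n => m nm Am cm; apply: hn; exists m.
    by split.
  have [b hb] := choice hx.
  have [m [mb Am]] := iA (\max_(x : Col k) b x)%N.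
  by apply: (hb (c k m) m _ Am erefl); apply: leq_trans mb; exact: leq_bigmax.
pose I := {A : set nat | infinite_set A}.
have step (kA : nat * I) : exists B : I, (sval B `<=` sval kA.2) /\
    exists x, forall n, sval B n -> c kA.1 n = x.
  case: kA => k [A iA] /=; have [x ix] := refine k A iA.
  by exists (exist _ _ ix); split=> [n []|]//; exists x => n [].
have [F hF] := choice step.
have iT : infinite_set setT by move=> n; exists n.
pose fix As k : I := if k is k'.+1 then F (k', As k') else exist _ setT iT.
have dec k m : (k <= m)%N -> sval (As m) `<=` sval (As k).
  elim: m => [|m IH]; first by rewrite leqn0 => /eqP ->.
  rewrite leq_eqVlt => /predU1P[->//|]; rewrite ltnS => /IH h n hn.
  by apply: h; have [h1 _] := hF (m, As m); exact: h1.
have pick (kn : nat * nat) : exists m, (kn.2 < m)%N /\ sval (As kn.1) m.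
  by have [m [h1 h2]] := svalP (As kn.1) kn.2.+1; exists m.
have [p hp] := choice pick.
pose fix phi k : nat := if k is k'.+1 then p (k, phi k') else p (0%N, 0%N).
have phiA k : sval (As k) (phi k).
  by case: k => [|k]; [have [] := hp (0%N, 0%N)|have [] := hp (k.+1, phi k)].
exists phi; first by apply: homo_ltn => [x y z|k]; [exact: ltn_trans|have [] := hp (k.+1, phi k)].
move=> k m n km kn; have [_ [x hx]] := hF (k, As k).
by rewrite !hx//; [exact: dec kn _ (phiA n)|exact: dec km _ (phiA m)].
Qed.

(** For each accuracy the systems are sorted into finitely many classes of
    diameter at most [eta], according to their quantized step kernel and type
    frequencies. *)
Lemma finite_colouring (N : nat -> nat) (w : forall n, 'M[R]_(N n))
    (X : forall n, 'I_(N n) -> torus R) C eta :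
  (forall n, (0 < N n)%N) -> 0 <= C -> (forall n i j, `|w n i j| <= C) -> 0 < eta ->
  exists (Col : finType) (c : nat -> Col), forall n m, c n = c m ->
    bicoupling_dist (w n) (X n) (w m) (X m) <= eta.
Proof.
move=> N0 C0 wC eta0; pose e := eta / 16; have e0 : 0 < e by rewrite divr_gt0.
have [S [M0 hS]] := weak_regularity R C e C0 e0.
pose M := `|M0|.
pose K := Num.truncn (eta / 8)^-1.
have KE : K.+1%:R^-1 <= eta / 8.
  rewrite -[leRHS]invrK lef_pV2 ?posrE ?invr_gt0 ?divr_gt0//.
  by rewrite ltW// truncnS_gt.
pose S' : finType := (S * 'I_K.+1)%type.
have reg n : exists ta : ('I_(N n) -> S) * (S -> S -> R), (forall s t, `|ta.2 s t| <= M) /\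
    opb (kernop R (N n) (w n - stepmx R (N n) S ta.1 ta.2)) e.
  have [tau [a [aM ha]]] := hS (N n) (w n) (N0 n) (wC n).
  by exists (tau, a); split=> // s t; apply: (le_trans (aM s t)); exact: ler_norm.
pose ta n := sval (cid (reg n)); have hta n := svalP (cid (reg n)).
rewrite -/(ta _) in hta.
pose t n i : S' := ((ta n).1 i, torus_cell R K (X n i)).
pose a n (s s' : S') := (ta n).2 s.1 s'.1.
have [Ka [ia [va [hva _]]]] := quantization R M (e / 2) ltac:(by rewrite divr_gt0).
have D0 : 0 < 8 * M + 4 by rewrite ltr_wpDl// mulr_ge0 // normr_ge0.
pose th := Num.min (eta / 4) ((e / (8 * M + 4)) ^+ 2).
have th0 : 0 < th by rewrite lt_min exprn_gt0 ?divr_gt0.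
pose dp := th / (2 * (#|S'|%:R + 1)).
have dp0 : 0 < dp by rewrite divr_gt0// mulr_gt0// ltr_wpDl.
have [Kp [ip [vp [hvp _]]]] := quantization R 1 dp dp0.
pose c n : {ffun S * S -> 'I_Ka.+1} * {ffun S' -> 'I_Kp.+1} :=
  ([ffun ss => ia ((ta n).2 ss.1 ss.2)], [ffun s => ip (label_freq (t n) s)]).
exists ({ffun S * S -> 'I_Ka.+1} * {ffun S' -> 'I_Kp.+1})%type, c => n m [/ffunP ca /ffunP cp].
have haa s s' : `|a n s s' - a m s s'| <= e.
  have := ca (s.1, s'.1); rewrite !ffunE /= => E.
  have h1 := hva _ ((hta n).1 s.1 s'.1); have h2 := hva _ ((hta m).1 s.1 s'.1).
  rewrite E in h1; rewrite [e]splitr.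
  apply: (le_trans (ler_distD (va (ia ((ta m).2 s.1 s'.1))) _ _)).
  by rewrite lerD// distrC.
have freq1 k s : `|label_freq (t k) s| <= 1 :> R.
  rewrite ger0_norm ?label_freq_ge0// -(sum_label_freq R _ _ (t k) (N0 k)).
  rewrite (bigD1 s)//= lerDl sumr_ge0// => s' _; exact: label_freq_ge0.
have hpp s : `|label_freq (t n) s - label_freq (t m) s| <= 2 * dp.
  have := cp s; rewrite !ffunE => E.
  have h1 := hvp _ (freq1 n s); have h2 := hvp _ (freq1 m s).
  rewrite E in h1; apply: (le_trans (ler_distD (vp (ip (label_freq (t m) s))) _ _)).
  by rewrite (distrC (vp _)); lra.
have an M' s s' : `|a M' s s'| <= M by exact: (hta M').1.
have hn : opb (kernop R (N n) (w n - stepmx R (N n) S' (t n) (a n))) (e + e).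
  apply: (@opb_le _ _ _ _ e); first by rewrite lerDl ltW.
  rewrite (_ : stepmx _ _ _ _ _ = stepmx R (N n) S (ta n).1 (ta n).2); first exact: (hta n).2.
  by apply/matrixP => i j; rewrite !mxE.
have hm : opb (kernop R (N m) (w m - stepmx R (N m) S' (t m) (a n))) (e + e).
  rewrite (_ : kernop _ _ _ = kernop R (N m) (w m - stepmx R (N m) S (ta m).1 (ta m).2)
    + kernop R (N m) (stepmx R (N m) S' (t m) (a m) - stepmx R (N m) S' (t m) (a n))); last first.
    by apply/matrixP => i j; rewrite !mxE/= /a; ring.
  apply: opbD; first exact: (hta m).2.
  apply: kernop_bound; rewrite ?ltW// => i j; rewrite !mxE distrC; exact: haa.
pose Th : R := \sum_s `|label_freq (t n) s - label_freq (t m) s|.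
have ThE : Th <= th.
  apply: (@le_trans _ _ (\sum_(s : S') 2 * dp)); first by apply: ler_sum.
  rewrite sumr_const -[leLHS]mulr_natr /dp.
  have k0 : 0 <= #|S'|%:R :> R by rewrite ler0n.
  move: (#|S'|%:R) k0 => k k0.
  rewrite [leLHS](_ : _ = th * (k / (k + 1))); last by field; lra.
  by rewrite ler_piMr ?(ltW th0)// ler_pdivrMr; lra.
have Th0 : 0 <= Th by exact: sumr_ge0.
have e20 : 0 <= e + e by rewrite addr_ge0// ltW.
apply: (le_trans (same_kernel_dist R (N n) (N m) S' (t n) (t m) (w n) (w m) (X n) (X m)
  (a n) M (e + e) (eta / 8) (N0 n) (N0 m) (normr_ge0 _) (an n) e20 _ hn hm _)).
- by rewrite divr_ge0// ltW.
- by move=> i j [_ /torus_cell_dist/le_trans]; apply.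
have hs : 8 * M * Num.sqrt Th <= e.
  have : Num.sqrt Th <= e / (8 * M + 4).
    have q0 : 0 <= e / (8 * M + 4) by rewrite ltW// divr_gt0.
    rewrite -[leRHS](ger0_norm q0) -[leRHS]sqrtr_sqr ler_sqrt ?sqr_ge0//; apply: (le_trans ThE).
    by rewrite ge_min lexx orbT.
  have M00 : 0 <= M by exact: normr_ge0.
  have := sqrtr_ge0 Th; move: (Num.sqrt Th) => s s0; rewrite ler_pdivlMr//; nra.
have : Th <= eta / 4 by apply: (le_trans ThE); rewrite ge_min lexx.
rewrite -/Th; have : e = eta / 16 by []; lra.
Qed.

Theorem cauchy_subsequence (N : nat -> nat) (w : forall n, 'M[R]_(N n))
    (X : forall n, 'I_(N n) -> torus R) C :
  (forall n, (0 < N n)%N) -> 0 <= C -> (forall n i j, `|w n i j| <= C) ->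
  exists2 phi : nat -> nat, {homo phi : m n / (m < n)%N} &
    bicoupling_cauchy (fun n => w (phi n)) (fun n => X (phi n)).
Proof.
move=> N0 C0 wC.
have /choice[Col] : forall k : nat, exists Col : finType, exists c : nat -> Col,
    forall n m, c n = c m -> bicoupling_dist (w n) (X n) (w m) (X m) <= k.+1%:R^-1.
  by move=> k; apply: (finite_colouring N w X C) => //; rewrite invr_gt0.
move=> hc; pose c k := sval (cid (hc k)).
have cP k n m : c k n = c k m -> bicoupling_dist (w n) (X n) (w m) (X m) <= k.+1%:R^-1.
  by rewrite /c; case: cid => f /= hf; exact: hf.
have [phi phi_homo hphi] := diagonal_colours Col c.
exists phi => //; apply: (tail_sup_cvg0 (fun p => (bicoupling_dist (w (phi p.1)) (X (phi p.1))
  (w (phi p.2)) (X (phi p.2)))%:E)).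
  by move=> p; rewrite lee_fin bicoupling_dist_ge0.
move=> e e0; pose k := Num.truncn e^-1.
exists k.+1 => p p1 p2; rewrite lee_fin; apply: (le_trans (cP k _ _ (hphi k _ _ p1 p2))).
rewrite -[leRHS]invrK lef_pV2 ?posrE ?invr_gt0//.
by rewrite ltW// truncnS_gt.
Qed.

End compactness.

(** * Picard iteration for a fixed noise path *)

Section picard.
Variable R : realType.
Variables (mu : torus R -> R) (sigma : torus R * torus R -> R) (nu : R).
Variables (Lm Ls C : R) (N : nat) (w : 'M[R]_N).
Hypothesis mu_cont : continuous mu.
Hypothesis sigma_cont : continuous sigma.
Hypothesis Lm0 : 0 <= Lm.
Hypothesis Ls0 : 0 <= Ls.
Hypothesis C0 : 0 <= C.
Hypothesis N0 : (0 < N)%N.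
Hypothesis muL : forall x y, `|mu x - mu y| <= Lm * torus_dist x y.
Hypothesis sigmaL : forall x x' y y',
  `|sigma (x, y) - sigma (x', y')| <= Ls * (torus_dist x x' + torus_dist y y').
Hypothesis wC : forall i j, `|w i j| <= C.
Local Notation "'II' a b f" := (\int[@lebesgue_measure R]_(x in `[a, b]) f x)
  (at level 10, a, b, f at level 9).
Local Notation dr := (@drift R mu sigma N w).

Lemma weighted_mean_le (f : 'I_N -> R) i e : (forall j, `|f j| <= e) ->
  `|N%:R^-1 * \sum_j w i j * f j| <= C * e.
Proof.
move=> fe; have n0 : 0 < N%:R :> R by rewrite ltr0n.
rewrite normrM ger0_norm ?invr_ge0 ?ler0n// ler_pdivrMl//.
apply: (le_trans (ler_norm_sum _ _ _)).
apply: (@le_trans _ _ (\sum_(j < N) C * e)).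
  by apply: ler_sum => j _; rewrite normrM ler_pM.
by rewrite sumr_const card_ord -[leLHS]mulr_natl.
Qed.

Definition drift_lip := Lm + 2 * C * Ls + 1.
Definition drift_bound := `|mu 0| + Lm + C * (`|sigma (0, 0)| + 2 * Ls).

Lemma drift_lip_gt0 : 0 < drift_lip.
Proof. by rewrite ltr_wpDl// addr_ge0// !mulr_ge0. Qed.

Lemma drift_bound_ge0 : 0 <= drift_bound.
Proof. by rewrite !addr_ge0// mulr_ge0// addr_ge0// mulr_ge0. Qed.

Lemma mu_bound x : `|mu x| <= `|mu 0| + Lm.
Proof.
have -> : mu x = mu 0 + (mu x - mu 0) by ring.
apply: (le_trans (ler_normD _ _)); rewrite lerD2l.
by apply: (le_trans (muL _ _)); rewrite ler_piMr// torus_dist_le1.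
Qed.

Lemma sigma_bound z : `|sigma z| <= `|sigma (0, 0)| + 2 * Ls.
Proof.
case: z => x y; have -> : sigma (x, y) = sigma (0, 0) + (sigma (x, y) - sigma (0, 0)) by ring.
apply: (le_trans (ler_normD _ _)); rewrite lerD2l.
apply: (le_trans (sigmaL _ _ _ _)); rewrite mulrC ler_wpM2r//.
by have := torus_dist_le1 _ x 0; have := torus_dist_le1 _ y 0; lra.
Qed.

Lemma drift_le x i : `|dr x i| <= drift_bound.
Proof.
apply: (le_trans (ler_normD _ _)); apply: lerD; first exact: mu_bound.
by apply: weighted_mean_le => j; exact: sigma_bound.
Qed.

Lemma drift_diff x y i e : (forall j, torus_dist (x j) (y j) <= e) ->
  `|dr x i - dr y i| <= drift_lip * e.
Proof.
move=> xy; have e0 : 0 <= e by apply: le_trans (torus_dist_ge0 _ _ _) (xy i).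
have -> : dr x i - dr y i = (mu (x i) - mu (y i))
    + N%:R^-1 * \sum_j w i j * (sigma (x i, x j) - sigma (y i, y j)).
  rewrite /drift; under [in RHS]eq_bigr do rewrite mulrBr.
  by rewrite sumrB mulrBr; ring.
apply: (le_trans (ler_normD _ _)).
apply: (@le_trans _ _ (Lm * e + C * (Ls * (e + e)))); last by rewrite /drift_lip; nra.
apply: lerD; first by apply: (le_trans (muL _ _)); rewrite ler_wpM2l.
apply: weighted_mean_le => j; apply: (le_trans (sigmaL _ _ _ _)).
by rewrite ler_wpM2l// lerD.
Qed.

Lemma continuous_drift (Y : 'I_N -> R -> torus R) i : (forall j, continuous (Y j)) ->
  continuous (fun s => dr (fun j => Y j s) i).
Proof.
move=> cY s; apply: cvgD.
  by apply: continuous_comp; [exact: cY|exact: mu_cont].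
apply: cvgM; first exact: cvg_cst.
apply: (continuous_sum R R _ _ _ (fun j s => w i j * sigma (Y i s, Y j s))) => j {}s.
apply: cvgM; first exact: cvg_cst.
apply: (@continuous_comp _ _ _ (fun s => (Y i s, Y j s)) sigma); last exact: sigma_cont.
by apply: (@cvg_pair _ _ _ (nbhs s) (nbhs (Y i s)) (nbhs (Y j s))); exact: cY.
Qed.

Section path.
Variables (x0 : 'I_N -> R) (b : 'I_N -> R -> R).
Hypothesis cb : forall i, continuous (b i).

Definition picard_map (Y : 'I_N -> R -> torus R) i t : R :=
  x0 i + (II 0 t (fun s => dr (fun j => Y j s) i) + nu * b i t).

Definition torus_path (x : 'I_N -> R -> R) i t : torus R := torus_pi (x i t).

Fixpoint picard_iter k : 'I_N -> R -> R :=
  if k is k'.+1 then picard_map (torus_path (picard_iter k'))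
  else fun i t => x0 i + nu * b i t.

Definition picard_err k t : R := drift_bound * (2^-1) ^+ k * expR (2 * drift_lip * t).

Lemma picard_err_ge0 k t : 0 <= picard_err k t.
Proof.
by rewrite mulr_ge0 ?expR_ge0// mulr_ge0 ?drift_bound_ge0// exprn_ge0.
Qed.

Lemma continuous_torus_path x : (forall i, continuous (x i)) ->
  forall i, continuous (torus_path x i).
Proof.
by move=> cx i t; apply: continuous_comp; [exact: cx|exact: continuous_torus_pi].
Qed.

Lemma continuous_picard_map Y : (forall i, continuous (Y i)) ->
  forall i, continuous (picard_map Y i).
Proof.
move=> cY i t; apply: cvgD; first exact: cvg_cst.
apply: cvgD; first by apply: continuous_Rintegral_itv; exact: continuous_drift.
by apply: cvgM; [exact: cvg_cst|exact: cb].
Qed.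

Lemma continuous_picard_iter k i : continuous (picard_iter k i).
Proof.
elim: k i => [|k IH] i /=.
  by move=> t; apply: cvgD; [exact: cvg_cst|apply: cvgM; [exact: cvg_cst|exact: cb]].
exact/continuous_picard_map/continuous_torus_path.
Qed.

Lemma picard_base Y i t : (forall i, continuous (Y i)) -> 0 <= t ->
  `|picard_map Y i t - picard_iter 0 i t| <= picard_err 0 t.
Proof.
move=> cY t0; rewrite /picard_map /=.
have -> : x0 i + (II 0 t (fun s => dr (fun j => Y j s) i) + nu * b i t) - (x0 i + nu * b i t)
  = II 0 t (fun s => dr (fun j => Y j s) i) by ring.
apply: (le_trans (Rintegral_itv_bound _ _ _ _ drift_bound _ t0 _)).
- exact: continuous_drift.
- by move=> s _ _; exact: drift_le.
rewrite subr0 /picard_err expr0 mulr1 ler_wpM2l ?drift_bound_ge0//.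
apply: le_trans (expR_ge1Dx _).
have : 1 <= drift_lip by rewrite /drift_lip lerDr addr_ge0// !mulr_ge0.
nra.
Qed.

Lemma Rintegral_expR k t : 0 < k -> 0 <= t ->
  II 0 t (fun s => expR (k * s)) <= k^-1 * expR (k * t).
Proof.
move=> k0 t0.
have dF (s : R) : is_derive s 1 (fun s => k^-1 * expR (k * s)) (expR (k * s)).
  have h : is_derive s 1 (fun s : R => k * s) k.
    by apply: (is_derive_eq (is_deriveZ k (is_derive_id s 1))); rewrite /GRing.scale/= mulr1.
  have h2 := is_derive1_comp (is_derive_expR (k * s)) h.
  apply: (is_derive_eq (is_deriveZ k^-1 h2)).
  by rewrite /GRing.scale/= mulrC mulfK// gt_eqF.
rewrite (Rintegral_itv_derive _ _ _ _ _ t0 _ dF).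
  by rewrite mulr0 expR0 mulr1 gerBl invr_ge0 ltW.
move=> s; apply: continuous_comp; last exact: continuous_expR.
by apply: cvgM; [exact: cvg_cst|exact: cvg_id].
Qed.

(** The weight absorbs half of the Lipschitz factor, so that one step of the
    iteration is a contraction uniformly in time. *)
Lemma picard_step (Y Z : 'I_N -> R -> torus R) k (t : R) : (forall i, continuous (Y i)) -> (forall i, continuous (Z i)) ->
  0 <= t ->
  (forall i s, 0 <= s -> s <= t -> torus_dist (Y i s) (Z i s) <= picard_err k s) ->
  forall i, `|picard_map Y i t - picard_map Z i t| <= picard_err k.+1 t.
Proof.
move=> cY cZ t0 YZ i; rewrite /picard_map.
have cdY := continuous_drift Y i cY; have cdZ := continuous_drift Z i cZ.
have -> : forall p q r s : R, p + (q + r) - (p + (s + r)) = q - s by move=> *; ring.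
rewrite -Rintegral_itvN//.
have cD : continuous (fun s => dr (fun j => Y j s) i - dr (fun j => Z j s) i).
  by move=> s; apply: cvgB; [exact: cdY|exact: cdZ].
apply: (le_trans (Rintegral_itv_norm _ _ _ _ cD)).
have k0 : 0 < 2 * drift_lip by rewrite mulr_gt0// drift_lip_gt0.
pose c := drift_lip * (drift_bound * (2^-1) ^+ k).
have cE : continuous (fun s : R => expR (2 * drift_lip * s)).
  move=> s; apply: continuous_comp; last exact: continuous_expR.
  by apply: cvgM; [exact: cvg_cst|exact: cvg_id].
apply: (@le_trans _ _ (II 0 t (fun s => c * expR (2 * drift_lip * s)))).
  apply: Rintegral_itv_le.
  - exact: continuous_normr.
  - by move=> s; apply: cvgM; [exact: cvg_cst|exact: cE].
  move=> s s0 st; rewrite /c -mulrA; apply: drift_diff => j.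
  exact: YZ.
rewrite Rintegral_itvZ//.
have c0 : 0 <= c.
  by rewrite mulr_ge0 ?(ltW drift_lip_gt0)// mulr_ge0 ?drift_bound_ge0// exprn_ge0.
apply: (le_trans (ler_wpM2l c0 (Rintegral_expR _ _ k0 t0))).
rewrite /picard_err /c exprS; have := gt_eqF drift_lip_gt0; move: drift_lip => K K0.
rewrite le_eqVlt; apply/orP; left; apply/eqP; field.
by rewrite K0.
Qed.

(** Every path solving the equation stays at distance [picard_err k] of the [k]-th
    iterate; this gives uniqueness as well as a finite-step approximation
    independent of the size of the system. *)
Lemma solution_picard (Y : 'I_N -> R -> torus R) k : (forall i, continuous (Y i)) ->
  (forall i t, 0 <= t -> Y i t = torus_pi (picard_map Y i t)) ->
  forall i t, 0 <= t -> `|picard_map Y i t - picard_iter k i t| <= picard_err k t.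
Proof.
move=> cY hY; elim: k => [|k IH] i t t0; first exact: picard_base.
apply: picard_step => //; first exact/continuous_torus_path/continuous_picard_iter.
move=> j s s0 _; rewrite hY//; apply: (le_trans (torus_dist_pi _ _ _)); exact: IH.
Qed.

Lemma picard_cauchy k m i t : (k <= m)%N -> 0 <= t ->
  `|picard_iter m i t - picard_iter k i t| <= picard_err k t.
Proof.
elim: k m i t => [|k IH] [|m] i t // km t0.
- by rewrite subrr normr0 picard_err_ge0.
- by apply: picard_base => //; exact/continuous_torus_path/continuous_picard_iter.
- apply: picard_step => //; try exact/continuous_torus_path/continuous_picard_iter.
  by move=> j s s0 _; apply: (le_trans (torus_dist_pi _ _ _)); exact: IH.
Qed.

Lemma picard_err_cvg t e : 0 < e -> exists k, forall m, (k <= m)%N -> picard_err m t <= e.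
Proof.
move=> e0; have : (fun m => picard_err m t) @ \oo --> 0.
  rewrite (_ : 0 = drift_bound * 0 * expR (2 * drift_lip * t)); last by rewrite mulr0 mul0r.
  apply: cvgM; last exact: cvg_cst.
  apply: cvgM; first exact: cvg_cst.
  by apply: cvg_expr; rewrite ger0_norm ?invr_ge0// invf_lt1// ltr1n.
move=> /cvgrPdist_le/(_ e e0)[k _ hk]; exists k => m km.
by have := hk m km; rewrite /= sub0r normrN ger0_norm ?picard_err_ge0.
Qed.

(** Negative times are sent to 0, where the estimate of the iterates holds, so that the
    limit exists and is continuous on the line. *)
Definition picard_lim i t : R := lim (picard_iter k i (Num.max t 0) @[k --> \oo]).

Lemma picard_cvg i t : 0 <= t -> picard_iter k i t @[k --> \oo] --> picard_lim i t.
Proof.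
move=> t0; rewrite /picard_lim max_l//.
apply: cauchy_cvg; apply: cauchy_exP => e e0.
have e20 : 0 < e / 2 by rewrite divr_gt0.
have [k hk] := picard_err_cvg t _ e20.
exists (picard_iter k i t); exists k => // m /= km.
rewrite /ball/= distrC; apply: (le_lt_trans (picard_cauchy _ _ _ _ km t0)).
by apply: (le_lt_trans (hk k (leqnn k))); lra.
Qed.

Lemma picard_lim_err k i t : 0 <= t ->
  `|picard_lim i t - picard_iter k i t| <= picard_err k t.
Proof.
move=> t0; have /cvgrPdist_le h := picard_cvg i t t0.
apply/ler_addgt0Pr => e e0; have [m _ hm] := h e e0.
apply: (le_trans (ler_distD (picard_iter (maxn m k) i t) _ _)).
rewrite addrC lerD//; first by apply: picard_cauchy => //; rewrite leq_maxr.
by apply: hm; rewrite /= leq_maxl.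
Qed.

Lemma picard_lim_max i t : picard_lim i (Num.max t 0) = picard_lim i t.
Proof. by rewrite /picard_lim (@max_l _ _ (Num.max t 0)) // le_max lexx orbT. Qed.

Lemma continuous_picard_lim i : continuous (picard_lim i).
Proof.
move=> t; apply/cvgrPdist_le => e e0; have e30 : 0 < e / 3 by rewrite divr_gt0.
have [k hk] := picard_err_cvg (`|t| + 1) _ e30.
have cm : continuous (fun s : R => picard_iter k i (Num.max s 0)).
  move=> s; apply: (@continuous_comp _ _ _ (fun s : R => Num.max s 0) (picard_iter k i)).
    by apply: continuous_max; [exact: cvg_id|exact: cvg_cst].
  exact: continuous_picard_iter.
have /cvgrPdist_le/(_ _ e30) hc := cm t.
have err s : s <= `|t| + 1 -> `|picard_lim i s - picard_iter k i (Num.max s 0)| <= e / 3.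
  move=> st; rewrite -picard_lim_max.
  have s0 : 0 <= Num.max s 0 by rewrite le_max lexx orbT.
  apply: (le_trans (picard_lim_err k i _ s0)); apply: le_trans (hk k (leqnn k)).
  rewrite /picard_err ler_wpM2l//; first by rewrite mulr_ge0 ?drift_bound_ge0// exprn_ge0.
  rewrite ler_expR ler_wpM2l ?mulr_ge0 ?(ltW drift_lip_gt0)//.
  by rewrite ge_max st addr_ge0.
near=> s.
have s1 : s <= `|t| + 1.
  have : `|t - s| < 1.
    by near: s; apply/nbhs_ballP; exists 1 => //= s.
  move=> h; have := ler_norm (s - t); rewrite distrC => h'; have := ler_norm t; lra.
have t1 : t <= `|t| + 1 by have := ler_norm t; lra.
have h3 : `|picard_iter k i (Num.max t 0) - picard_iter k i (Num.max s 0)| <= e / 3.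
  by near: s; exact: hc.
have h1 := err t t1; have h2 := err s s1.
apply: (le_trans (ler_distD (picard_iter k i (Num.max t 0)) _ _)).
apply: (le_trans (lerD h1 (ler_distD (picard_iter k i (Num.max s 0)) _ _))).
rewrite (distrC _ (picard_lim i s)); lra.
Unshelve. all: by end_near. Qed.

Lemma picard_lim_fix i t : 0 <= t ->
  picard_lim i t = picard_map (torus_path picard_lim) i t.
Proof.
move=> t0; apply/eqP; rewrite -subr_eq0 -normr_le0; apply/ler_addgt0Pr => e e0.
have e20 : 0 < e / 2 by rewrite divr_gt0.
have [k hk] := picard_err_cvg t _ e20.
apply: (le_trans (ler_distD (picard_iter k.+1 i t) _ _)).
have h1 : `|picard_lim i t - picard_iter k.+1 i t| <= e / 2.
  by apply: (le_trans (picard_lim_err _ _ _ t0)); apply: hk.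
have h2 : `|picard_iter k.+1 i t - picard_map (torus_path picard_lim) i t| <= e / 2.
  rewrite distrC; apply: (@le_trans _ _ (picard_err k.+1 t)); last exact: hk.
  apply: picard_step => //.
  - exact/continuous_torus_path/continuous_picard_lim.
  - exact/continuous_torus_path/continuous_picard_iter.
  move=> j s s0 _; apply: (le_trans (torus_dist_pi _ _ _)); exact: picard_lim_err.
lra.
Qed.

Lemma solution_unique (Y : 'I_N -> R -> torus R) : (forall i, continuous (Y i)) ->
  (forall i t, 0 <= t -> Y i t = torus_pi (picard_map Y i t)) ->
  forall i t, 0 <= t -> Y i t = torus_pi (picard_lim i t).
Proof.
move=> cY hY i t t0; rewrite hY//; congr torus_pi.
apply/eqP; rewrite -subr_eq0 -normr_le0; apply/ler_addgt0Pr => e e0.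
have e20 : 0 < e / 2 by rewrite divr_gt0.
have [k hk] := picard_err_cvg t _ e20; have {}hk := hk k (leqnn k).
apply: (le_trans (ler_distD (picard_iter k i t) _ _)).
have h1 := solution_picard _ k cY hY i t t0.
have h2 := picard_lim_err k i t t0; rewrite distrC in h2.
apply: (le_trans (lerD h1 h2)); lra.
Qed.

End path.
End picard.

(** * Strong solutions *)

(** The measurable space is arbitrary, in order to cover both the full sigma-algebra and
    the filtration at a given time. *)
Section measurability.
Variable R : realType.
Variables (mu : torus R -> R) (sigma : torus R * torus R -> R) (nu : R).
Variables (N : nat) (w : 'M[R]_N).
Hypothesis mu_cont : continuous mu.
Hypothesis sigma_cont : continuous sigma.
Hypothesis sigma_Loo : in_Loo_torus2 sigma.
Context (d : measure_display) (T : measurableType d).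
Variables (x0 : 'I_N -> R) (b : 'I_N -> R -> T -> R).
Hypothesis cb : forall i om, continuous (fun s => b i s om).
Local Notation iter om k := (picard_iter R mu sigma nu N w x0 (fun i s => b i s om) k).

Lemma measurable_drift (x : 'I_N -> T -> R) i :
  (forall j, measurable_fun setT (x j)) ->
  measurable_fun setT (fun om => @drift R mu sigma N w (fun j => torus_pi (x j om)) i).
Proof.
move=> mx; apply: measurable_funD.
  apply: (@measurableT_comp _ _ _ _ _ _ (mu \o @torus_pi R)) => //.
  apply: continuous_measurable_fun => s.
  by apply: continuous_comp; [exact: continuous_torus_pi|exact: mu_cont].
apply: measurable_funM; first exact: measurable_cst.
apply: measurable_sum => j; apply: measurable_funM; first exact: measurable_cst.
have [ms _] := sigma_Loo.
apply: (measurableT_comp ms (g := fun om => (x i om, x j om))).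
by apply: measurable_fun_pair; exact: mx.
Qed.

Lemma measurable_Rintegral_itv (F : R -> T -> R) (a c : R) : a <= c ->
  (forall om, continuous (fun s => F s om)) ->
  (forall s, a <= s <= c -> measurable_fun setT (F s)) ->
  measurable_fun setT (fun om => \int[@lebesgue_measure R]_(s in `[a, c]) F s om).
Proof.
move=> ac cF mF.
apply: (@measurable_fun_cvg _ _ _ _ (fun n om => riemann_sum R (fun s => F s om) a c n)); last first.
  by move=> om _; apply: cvg_riemann_sum.
move=> n; rewrite /riemann_sum; apply: measurable_funM; first exact: measurable_cst.
apply: measurable_sum => j; apply: mF.
have n0 : 0 < n.+1%:R :> R by rewrite ltr0n.
have h0 : 0 <= (c - a) / n.+1%:R by rewrite divr_ge0 ?subr_ge0.
have e : (c - a) / n.+1%:R * n.+1%:R = c - a by rewrite divfK// gt_eqF.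
rewrite lerDl mulr_ge0//=.
have : j%:R * ((c - a) / n.+1%:R) <= n.+1%:R * ((c - a) / n.+1%:R).
  by rewrite ler_wpM2r// ler_nat; apply: ltnW.
rewrite (mulrC n.+1%:R) e => h; rewrite -lerBrDl.
exact: h.
Qed.

Lemma measurable_picard_iter k i t : 0 <= t ->
  (forall j s, 0 <= s <= t -> measurable_fun setT (b j s)) ->
  measurable_fun setT (fun om => iter om k i t).
Proof.
elim: k i t => [|k IH] i t t0 mb /=.
  apply: measurable_funD; first exact: measurable_cst.
  by apply: measurable_funM; [exact: measurable_cst|apply: mb; rewrite t0 lexx].
rewrite /picard_map; apply: measurable_funD; first exact: measurable_cst.
apply: measurable_funD; last first.
  by apply: measurable_funM; [exact: measurable_cst|apply: mb; rewrite t0 lexx].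
apply: (measurable_Rintegral_itv (fun s om =>
  @drift R mu sigma N w (fun j => torus_pi (iter om k j s)) i)) => //.
  move=> om; apply: (continuous_drift R mu sigma N w mu_cont sigma_cont
    (fun j s => torus_pi (iter om k j s))) => j s.
  apply: continuous_comp; last exact: continuous_torus_pi.
  exact: (continuous_picard_iter R mu sigma nu N w mu_cont sigma_cont).
move=> s /andP[s0 st]; apply: measurable_drift => j; apply: IH => // j' s' /andP[s'0 s's].
by apply: mb; rewrite s'0 (le_trans s's).
Qed.

End measurability.

Lemma torus_borel_preimage (R : realType) d (T : measurableType d) (f : T -> R) :
  measurable_fun setT f ->
  forall A, @torus_borel R A -> measurable ((fun om => torus_pi (f om)) @^-1` A).
Proof.
move=> mf A bA.
suff : @measurable _ (measurableTypeR R) (@torus_pi R @^-1` A).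
  by move=> /(mf measurableT); rewrite setTI.
have := bA (fun A => @measurable _ (measurableTypeR R) (@torus_pi R @^-1` A)); apply; split.
  split=> //.
  - by rewrite preimage_set0.
  - by move=> U mU; rewrite setTD -preimage_setC; exact: measurableC.
  - by move=> F mF; rewrite preimage_bigcup; exact: bigcup_measurable.
by move=> U oU; apply: open_measurable.
Qed.

Lemma continuous_stopped (R : realType) (T : topologicalType) (f : R -> T) :
  {within `[0, +oo[, continuous f} -> continuous (fun s : R => f (Num.max s 0)).
Proof.
move=> /subspace_continuousP cf s.
have s0 : [set` `[0, +oo[ ] (Num.max s 0).
  by rewrite /= in_itv/= andbT le_max lexx orbT.
have cm : Num.max u 0 @[u --> s] --> Num.max s 0.
  by apply: continuous_max; [exact: cvg_id|exact: cvg_cst].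
move=> U /(cf _ s0) hU.
have h : nbhs s (fun u : R => [set` `[0, +oo[ ] (Num.max u 0) -> U (f (Num.max u 0))).
  exact: cm _ hU.
apply: (@filterS _ (nbhs s) _ _ _ _ h) => u; apply.
by rewrite /= in_itv/= andbT le_max lexx orbT.
Qed.

Section noise.
Context (R : realType) (d : measure_display) (Omega : measurableType d).
Variable P : probability Omega R.
Variables (N : nat) (B : 'I_N -> R -> Omega -> R).
Hypothesis bmB : forall i, brownian_motion P (B i).

Lemma noise_exceptional : exists Z : set Omega, [/\ measurable Z, P Z = 0%E &
  forall om, ~ Z om -> forall i, B i 0 om = 0 /\
    {within `[0, +oo[, continuous (fun t => B i t om)}].
Proof.
have h : {ae P, forall om, forall i : 'I_N, B i 0 om = 0 /\
    {within `[0, +oo[, continuous (fun t => B i t om)}}.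
  apply: filter_forall => i.
  have h1 := bm_start (bmB i); have h2 := bm_continuous (bmB i).
  by apply: filterS2 h1 h2 => om.
have [Z [mZ PZ hZ]] := h; exists Z; split=> // om nZ; apply: contrapT => hn.
by apply: nZ; apply: hZ.
Qed.

(** The noise made continuous everywhere by erasing it on an exceptional null
    set; measurability of the iterates then needs no exceptional set. *)
Definition regular_noise (Z : set Omega) i s om : R :=
  if `[< Z om >] then 0 else B i (Num.max s 0) om.

Variable Z : set Omega.
Hypothesis mZ : measurable Z.
Hypothesis PZ : P Z = 0%E.
Hypothesis hZ : forall om, ~ Z om -> forall i, B i 0 om = 0 /\
    {within `[0, +oo[, continuous (fun t => B i t om)}.

Lemma continuous_regular_noise i om : continuous (fun s => regular_noise Z i s om).
Proof.
rewrite /regular_noise; case: asboolP => hz; first by move=> s; exact: cvg_cst.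
by apply: (continuous_stopped R _ (fun s => B i s om)); case: (hZ om hz i).
Qed.

Lemma regular_noise0 i om : regular_noise Z i 0 om = 0.
Proof.
by rewrite /regular_noise maxxx; case: asboolP => // hz; case: (hZ om hz i).
Qed.

Lemma regular_noiseE i s om : 0 <= s -> ~ Z om -> regular_noise Z i s om = B i s om.
Proof. by move=> s0 hz; rewrite /regular_noise max_l//; case: asboolP. Qed.

Lemma ae_regular : {ae P, forall om, ~ Z om}.
Proof. by exists Z; split=> // om /= /contrapT. Qed.

Lemma measurable_erase d' (T : measurableType d') (Z' : set T) (f : T -> R) :
  measurable Z' -> measurable_fun setT f ->
  measurable_fun setT (fun om => if `[< Z' om >] then 0 else f om).
Proof.
move=> mZ' mf; rewrite (_ : (fun om => _) = (fun om => f om * \1_(~` Z') om)).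
  by apply: measurable_funM => //; apply: measurable_indic; exact: measurableC.
apply/funext => om; rewrite indicE in_setC; case: asboolP => h.
  by rewrite mem_set// mulr0.
by rewrite memNset// mulr1.
Qed.

Lemma measurable_regular_noise i s : 0 <= s -> measurable_fun setT (regular_noise Z i s).
Proof.
move=> s0; apply: measurable_erase => //; rewrite max_l//.
exact: (bm_measurable (bmB i)).
Qed.

Let gen t := [set A | (exists i, exists2 s, 0 <= s <= t & rv_events (B i s) A)
               \/ (measurable A /\ P A = 0%E)].

Lemma regular_noise_adapted i s t : 0 <= s <= t ->
  measurable_fun setT (regular_noise Z i s : g_sigma_algebraType (gen t) -> R).
Proof.
move=> /andP[s0 st].
apply: (@measurable_erase _ (g_sigma_algebraType (gen t)) Z).
  by apply: sub_gen_smallest; right.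
rewrite max_l// => _ U mU; apply: sub_gen_smallest; left.
by exists i; exists s; [rewrite s0 st|exists U].
Qed.

Lemma bm_filtrationE t : bm_filtration P B t = @measurable _ (g_sigma_algebraType (gen t)).
Proof. by []. Qed.
End noise.

Section wellposed.
Context (R : realType) (d : measure_display) (Omega : measurableType d).
Variable P : probability Omega R.
Variables (mu : torus R -> R) (sigma : torus R * torus R -> R) (nu : R).
Variables (Lm Ls C : R) (N : nat) (w : 'M[R]_N).
Hypothesis mu_cont : continuous mu.
Hypothesis sigma_cont : continuous sigma.
Hypothesis sigma_Loo : in_Loo_torus2 sigma.
Hypothesis Lm0 : 0 <= Lm.
Hypothesis Ls0 : 0 <= Ls.
Hypothesis C0 : 0 <= C.
Hypothesis N0 : (0 < N)%N.
Hypothesis muL : forall x y, `|mu x - mu y| <= Lm * torus_dist x y.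
Hypothesis sigmaL : forall x x' y y',
  `|sigma (x, y) - sigma (x', y')| <= Ls * (torus_dist x x' + torus_dist y y').
Hypothesis wC : forall i j, `|w i j| <= C.
Variables (B : 'I_N -> R -> Omega -> R) (X0 : 'I_N -> torus R) (x0 : 'I_N -> R).
Hypothesis bmB : forall i, brownian_motion P (B i).
Hypothesis x0X : forall i, torus_pi (x0 i) = X0 i.
Variable Z : set Omega.
Hypothesis mZ : measurable Z.
Hypothesis PZ : P Z = 0%E.
Hypothesis hZ : forall om, ~ Z om -> forall i, B i 0 om = 0 /\
    {within `[0, +oo[, continuous (fun t => B i t om)}.
Local Notation b om := (fun i s => regular_noise R d Omega N B Z i s om).
Let cb om i : continuous (b om i).
Proof. exact: (continuous_regular_noise _ _ _ N B Z hZ). Qed.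

Definition strong_lift i t om : R := picard_lim R mu sigma nu N w x0 (b om) i t.
Definition strong_solution i t om : torus R := torus_pi (strong_lift i t om).

Lemma measurable_strong_lift d' (T : measurableType d') (b' : 'I_N -> R -> T -> R) t i :
  0 <= t -> (forall i om, continuous (fun s => b' i s om)) ->
  (forall i s, 0 <= s <= t -> measurable_fun setT (b' i s)) ->
  measurable_fun setT (fun om : T =>
    picard_lim R mu sigma nu N w x0 (fun i s => b' i s om) i t).
Proof.
move=> t0 cb' mb'.
apply: (@measurable_fun_cvg _ _ _ _
  (fun k om => picard_iter R mu sigma nu N w x0 (fun i s => b' i s om) k i t)).
  move=> k; apply: (measurable_picard_iter R mu sigma nu N w mu_cont sigma_cont sigma_Loo).
  - exact: cb'.
  - exact: t0.
  - exact: mb'.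
move=> om _; apply: (picard_cvg R mu sigma nu Lm Ls C) => //.
Qed.

Lemma strong_solution_start i om : strong_solution i 0 om = X0 i.
Proof.
rewrite /strong_solution /strong_lift.
rewrite (picard_lim_fix R mu sigma nu Lm Ls C)// /picard_map.
rewrite (regular_noise0 _ _ _ N B Z hZ) Rintegral_itv1 mulr0 !addr0; exact: x0X.
Qed.

Lemma continuous_strong_solution i om : continuous (fun t => strong_solution i t om).
Proof.
apply: (continuous_torus_path R N (fun i t => strong_lift i t om)) => j.
by apply: (continuous_picard_lim R mu sigma nu Lm Ls C).
Qed.

Lemma strong_solutionP : is_solution P mu sigma nu w B X0 strong_solution.
Proof.
split.
- move=> i t t0; apply: torus_borel_preimage.
  apply: measurable_strong_lift => // j s /andP[s0 _].
  exact: measurable_regular_noise.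
- by apply: aeW => om i; apply: continuous_subspaceT; exact: continuous_strong_solution.
- by apply: aeW => om i; exact: strong_solution_start.
- apply: filterS (ae_regular _ _ _ _ Z mZ PZ) => om nZ i t t0.
  rewrite /strong_solution /strong_lift (picard_lim_fix R mu sigma nu Lm Ls C)// /picard_map.
  by rewrite torus_piD x0X regular_noiseE.
Qed.

Lemma strong_solution_adapted : adapted P B strong_solution.
Proof.
move=> i t t0 A bA; rewrite bm_filtrationE.
apply: torus_borel_preimage => //.
apply: (measurable_strong_lift _ _
  (fun i s => regular_noise R d Omega N B Z i s : g_sigma_algebraType _ -> R)) => //.
by move=> j s hs; apply: regular_noise_adapted.
Qed.

(** Freezing the time at 0 turns continuity on the half-line into the continuity on
    the line required by the lemmas on single paths. *)
Lemma solution_path Y : is_solution P mu sigma nu w B X0 Y ->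
  {ae P, forall om, ~ Z om /\ exists y : 'I_N -> R -> torus R,
    [/\ (forall i, continuous (y i)),
        (forall i t, 0 <= t -> y i t = Y i t om) &
        (forall i t, 0 <= t ->
           y i t = torus_pi (picard_map R mu sigma nu N w x0 (b om) y i t))]}.
Proof.
move=> [_ hc _ he]; have hz := ae_regular _ _ _ P Z mZ PZ.
apply: filterS3 hc he hz => om c e nZ; split=> //.
exists (fun i s => Y i (Num.max s 0) om); split.
- move=> i; exact: (continuous_stopped R _ (fun t => Y i t om)).
- by move=> i t t0; rewrite max_l.
move=> i t t0; rewrite max_l// e// /picard_map torus_piD x0X regular_noiseE//.
congr (_ + torus_pi (_ + _)); apply: eq_Rintegral => s; rewrite inE/= in_itv/= => /andP[s0 _].
by rewrite max_l.
Qed.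

Lemma strong_solution_unique Y : is_solution P mu sigma nu w B X0 Y ->
  indistinguishable P strong_solution Y.
Proof.
move=> /solution_path hY; apply: filterS hY => om [_ [y [cy yY hy]]] i t t0.
rewrite -yY// /strong_solution; apply/esym.
by apply: (solution_unique R mu sigma nu Lm Ls C).
Qed.

Lemma solution_picard_dist Y : is_solution P mu sigma nu w B X0 Y ->
  {ae P, forall om i t k, 0 <= t ->
    torus_dist (Y i t om) (torus_pi (picard_iter R mu sigma nu N w x0 (b om) k i t))
    <= picard_err R mu sigma Lm Ls C k t}.
Proof.
move=> /solution_path hY; apply: filterS hY => om [_ [y [cy yY hy]]] i t k t0.
rewrite -yY// hy//; apply: (le_trans (torus_dist_pi _ _ _)).
by apply: (solution_picard R mu sigma nu Lm Ls C).
Qed.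
End wellposed.

(** * Stability of the drift and of the Picard iterates *)

Section kernel_average.
Variable R : realType.

Definition kernel_average N (w : 'M[R]_N) (g : 'I_N -> R) i := N%:R^-1 * \sum_k w i k * g k.

Lemma kernel_average_bound N (w : 'M[R]_N) g C M i : (0 < N)%N -> 0 <= C ->
  (forall i j, `|w i j| <= C) -> (forall k, `|g k| <= M) ->
  `|kernel_average N w g i| <= C * M.
Proof. by move=> N0 C0 wC gM; exact: weighted_mean_le. Qed.

Lemma l2norm_bound n (x : 'cV[R]_n) M : 0 <= M -> (forall i, `|x i 0| <= M) ->
  l2norm x <= Num.sqrt n%:R * M.
Proof.
move=> M0 xM; rewrite -[M]ger0_norm// -sqrtr_sqr -sqrtrM ?ler0n// ler_wsqrtr//.
apply: (@le_trans _ _ (\sum_(i < n) M ^+ 2)).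
  by apply: ler_sum => i _; rewrite -[x i 0 ^+ 2]real_normK ?num_real// lerXn2r// nnegrE.
by rewrite sumr_const card_ord -[leLHS]mulr_natl.
Qed.

Section pair.
Variables (N1 N2 : nat) (w1 : 'M[R]_N1) (w2 : 'M[R]_N2) (gam : 'M[R]_(N1, N2)) (C M kap : R).
Variables (g1 : 'I_N1 -> R) (g2 : 'I_N2 -> R).
Hypothesis N10 : (0 < N1)%N.
Hypothesis N20 : (0 < N2)%N.
Hypothesis C0 : 0 <= C.
Hypothesis M0 : 0 <= M.
Hypothesis kap0 : 0 <= kap.
Hypothesis w1C : forall i j, `|w1 i j| <= C.
Hypothesis cgam : coupling gam.
Hypothesis hkap : opb (commut R N1 N2 w1 w2 gam) kap.
Hypothesis g1M : forall i, `|g1 i| <= M.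
Hypothesis g2M : forall i, `|g2 i| <= M.
Local Notation F := (kernel_average N1 w1 g1).
Local Notation H := (kernel_average N2 w2 g2).

Let comm i l := \sum_k N1%:R^-1 * w1 i k * gam k l - \sum_k gam i k * (N2%:R^-1 * w2 k l).

Lemma commutE i l : commut R N1 N2 w1 w2 gam i l = Num.sqrt (N1%:R * N2%:R) * comm i l.
Proof.
rewrite /commut !mxE mulrBr !mulr_sumr; congr (_ - _); apply: eq_bigr => k _.
  by rewrite /kernop /couplop !mxE; ring.
by rewrite /kernop /couplop !mxE; ring.
Qed.

(** The left-hand side is the pairing of [F] with the commutator applied to [g2], up to
    the normalization of the Euclidean norms by the sizes. *)
Lemma commut_pairing : \sum_i F i * \sum_l comm i l * g2 l <= C * M * (kap * M).
Proof.
have n1 : 0 < N1%:R :> R by rewrite ltr0n.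
have n2 : 0 < N2%:R :> R by rewrite ltr0n.
pose u : 'cV[R]_N1 := \col_i F i; pose v : 'cV[R]_N2 := \col_l g2 l.
have := opb_dotP _ _ _ _ _ v u hkap.
have s0 : 0 < Num.sqrt (N1%:R * N2%:R) :> R by rewrite sqrtr_gt0 mulr_gt0.
have -> : dotv (commut R N1 N2 w1 w2 gam *m v) u
    = Num.sqrt (N1%:R * N2%:R) * \sum_i F i * \sum_l comm i l * g2 l.
  rewrite /dotv mulr_sumr; apply: eq_bigr => i _.
  rewrite ![(_ *m v) _ _]mxE [u _ _]mxE [RHS]mulrCA [LHS]mulrC; congr (_ * _); rewrite mulr_sumr.
  by apply: eq_bigr => l _; rewrite commutE [v _ _]mxE mulrA.
have hu : l2norm u <= Num.sqrt N1%:R * (C * M).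
  apply: l2norm_bound; first by rewrite mulr_ge0.
  by move=> i; rewrite mxE kernel_average_bound.
have hv : l2norm v <= Num.sqrt N2%:R * M by apply: l2norm_bound => // i; rewrite mxE.
move=> h; rewrite -(ler_pM2l s0); apply: (le_trans h).
apply: (@le_trans _ _ (kap * (Num.sqrt N2%:R * M) * (Num.sqrt N1%:R * (C * M)))).
  by rewrite ler_pM ?mulr_ge0 ?l2norm_ge0// ler_wpM2l.
by rewrite sqrtrM ?ler0n// le_eqVlt; apply/orP; left; apply/eqP; ring.
Qed.

(** With [L] the operator of the coupling, [F - L H] is the sum of the kernel average of
    [g1 - L g2], which is controlled in mean because [w1] is bounded, and of the
    commutator applied to [g2]. *)
Lemma kernel_average_half :
  \sum_i \sum_j F i * (F i - H j) * gam i j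
  <= C * M * (kap * M + C * \sum_i \sum_j `|g1 i - g2 j| * gam i j).
Proof.
have n1 : 0 < N1%:R :> R by rewrite ltr0n.
have [gam0 gamc gamr] := cgam.
have e : \sum_i \sum_j F i * (F i - H j) * gam i j
  = \sum_i F i * (N1%:R^-1 * \sum_k w1 i k * \sum_l (g1 k - g2 l) * gam k l)
    + \sum_i F i * \sum_l comm i l * g2 l.
  rewrite -big_split/=; apply: eq_bigr => i _; rewrite -mulrDr.
  under eq_bigr do rewrite -mulrA; rewrite -mulr_sumr; congr (_ * _).
  have -> : \sum_j (F i - H j) * gam i j = F i / N1%:R - \sum_j H j * gam i j.
    by rewrite -(gamr i) mulr_sumr -sumrB; apply: eq_bigr => j _; rewrite mulrBl.
  have -> : F i / N1%:R = N1%:R^-1 * \sum_k w1 i k * \sum_l g1 k * gam k l.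
    rewrite mulrC /kernel_average; congr (_ * _).
    rewrite mulr_sumr; apply: eq_bigr => k _.
    by rewrite -mulr_sumr gamr; ring.
  have -> : \sum_l comm i l * g2 l = N1%:R^-1 * (\sum_k w1 i k * \sum_l g2 l * gam k l)
      - \sum_k H k * gam i k.
    rewrite /comm; under eq_bigr do rewrite mulrBl; rewrite sumrB; congr (_ - _).
      under eq_bigr do rewrite mulr_suml; rewrite exchange_big mulr_sumr/=.
      by apply: eq_bigr => k _; rewrite !mulr_sumr; apply: eq_bigr => l _; ring.
    under eq_bigr do rewrite mulr_suml; rewrite exchange_big/=.
    apply: eq_bigr => k _; rewrite /kernel_average -mulrA mulr_suml mulr_sumr.
    by apply: eq_bigr => l _; ring.
  rewrite addrA -mulrDr -big_split/=; congr (N1%:R^-1 * _ - _).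
  apply: eq_bigr => k _; rewrite -mulrDr -big_split/=; congr (_ * _).
  by apply: eq_bigr => l _; ring.
rewrite e mulrDr addrC lerD ?commut_pairing//.
set D := \sum_i \sum_j _.
have D0 : 0 <= D by apply: sumr_ge0 => i _; apply: sumr_ge0 => j _; rewrite mulr_ge0.
apply: (@le_trans _ _ (\sum_(i < N1) C * M * (N1%:R^-1 * (C * D)))); last first.
  rewrite sumr_const card_ord -[leLHS]mulr_natl.
  by rewrite le_eqVlt; apply/orP; left; apply/eqP; field; rewrite gt_eqF.
apply: ler_sum => i _; apply: (le_trans (ler_norm _)); rewrite normrM.
apply: ler_pM => //; first exact: kernel_average_bound.
rewrite normrM ger0_norm ?invr_ge0 ?ler0n// ler_wpM2l ?invr_ge0 ?ler0n//.
apply: (le_trans (ler_norm_sum _ _ _)); rewrite mulr_sumr; apply: ler_sum => k _.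
rewrite normrM ler_pM//; apply: (le_trans (ler_norm_sum _ _ _)); apply: ler_sum => l _.
by rewrite normrM (ger0_norm (gam0 _ _)).
Qed.
End pair.

(** The square splits into the pairing of [F] with [F - H] and that of [H] with [H - F],
    each of them an instance of [kernel_average_half]; the two commutators of the
    distance serve one each. *)
Lemma kernel_average_sqr N1 N2 (w1 : 'M[R]_N1) (w2 : 'M[R]_N2) (gam : 'M[R]_(N1, N2))
    (C M kap : R) (g1 : 'I_N1 -> R) (g2 : 'I_N2 -> R) :
  (0 < N1)%N -> (0 < N2)%N -> 0 <= C -> 0 <= M -> 0 <= kap ->
  (forall i j, `|w1 i j| <= C) -> (forall i j, `|w2 i j| <= C) -> coupling gam ->
  opb (commut R N1 N2 w1 w2 gam) kap ->
  opb (commut R N2 N1 w2 w1 gam^T) kap ->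
  (forall i, `|g1 i| <= M) -> (forall i, `|g2 i| <= M) ->
  \sum_i \sum_j (kernel_average N1 w1 g1 i - kernel_average N2 w2 g2 j) ^+ 2 * gam i j
  <= 2 * (C * M * (kap * M + C * \sum_i \sum_j `|g1 i - g2 j| * gam i j)).
Proof.
move=> N10 N20 C0 M0 kap0 w1C w2C cg k1 k2 g1M g2M.
have h1 := kernel_average_half N1 N2 w1 w2 gam C M kap g1 g2 N10 N20 C0 M0 kap0 w1C cg k1 g1M g2M.
have h2 := kernel_average_half N2 N1 w2 w1 gam^T C M kap g2 g1 N20 N10 C0 M0 kap0 w2C
  (coupling_tr _ _ _ _ cg) k2 g2M g1M.
set D := \sum_i \sum_j `|g1 i - g2 j| * gam i j in h1 *.
have eD : \sum_i \sum_j `|g2 i - g1 j| * gam^T i j = D.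
  rewrite exchange_big/=; apply: eq_bigr => i _; apply: eq_bigr => j _.
  by rewrite [gam^T _ _]mxE distrC.
rewrite eD exchange_big/= in h2.
rewrite [2]mulr2n mulrDl !mul1r; apply: le_trans (lerD h1 h2).
rewrite -big_split/= ler_sum// => i _; rewrite -big_split/= ler_sum// => j _.
rewrite [gam^T _ _]mxE.
by rewrite le_eqVlt; apply/orP; left; apply/eqP; ring.
Qed.
End kernel_average.

Section coupled_drift.
Variable R : realType.
Variables (mu : torus R -> R) (sigma : torus R * torus R -> R).
Variables (Lm Ls C : R).
Hypothesis Lm0 : 0 <= Lm.
Hypothesis Ls0 : 0 <= Ls.
Hypothesis C0 : 0 <= C.
Hypothesis muL : forall x y, `|mu x - mu y| <= Lm * torus_dist x y.
Hypothesis sigmaL : forall x x' y y',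
  `|sigma (x, y) - sigma (x', y')| <= Ls * (torus_dist x x' + torus_dist y y').

Definition cell_point K (a : 'I_K.+1) : torus R :=
  if pselect (exists x, torus_cell R K x = a) is left h then sval (cid h) else 0.

Lemma cell_point_dist K x : torus_dist x (cell_point K (torus_cell R K x)) <= K.+1%:R^-1.
Proof.
apply: torus_cell_dist; rewrite /cell_point; case: pselect => [h|[]]; last by exists x.
by rewrite (svalP (cid h)).
Qed.

Definition coupled_average N1 N2 (gam : 'M[R]_(N1, N2)) (f : 'I_N1 -> 'I_N2 -> R) : R :=
  \sum_i \sum_j f i j * gam i j.

Section linear.
Variables (N1 N2 : nat) (gam : 'M[R]_(N1, N2)).
Hypothesis N10 : (0 < N1)%N.
Hypothesis cgam : coupling gam.
Local Notation av := (coupled_average N1 N2 gam).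

Lemma coupled_averageD f h : av (fun i j => f i j + h i j) = av f + av h.
Proof.
rewrite -big_split; apply: eq_bigr => i _; rewrite -big_split.
by apply: eq_bigr => j _; rewrite mulrDl.
Qed.

Lemma coupled_averageZ k f : av (fun i j => k * f i j) = k * av f.
Proof.
rewrite mulr_sumr; apply: eq_bigr => i _; rewrite mulr_sumr.
by apply: eq_bigr => j _; rewrite mulrA.
Qed.

Lemma coupled_average_sum (I : finType) (f : I -> 'I_N1 -> 'I_N2 -> R) :
  av (fun i j => \sum_a f a i j) = \sum_a av (f a).
Proof.
rewrite [RHS]exchange_big/=; apply: eq_bigr => i _; rewrite exchange_big/=.
by apply: eq_bigr => j _; rewrite mulr_suml.
Qed.

Lemma coupled_average_cst k : av (fun _ _ => k) = k.
Proof.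
rewrite /coupled_average; under eq_bigr do rewrite -mulr_sumr.
by rewrite -mulr_sumr coupling_mass// mulr1.
Qed.

Lemma coupled_average_le f h : (forall i j, f i j <= h i j) -> av f <= av h.
Proof.
move=> fh; have [g0 _ _] := cgam; apply: ler_sum => i _; apply: ler_sum => j _.
by rewrite ler_wpM2r.
Qed.

Lemma coupled_average_ge0 f : (forall i j, 0 <= f i j) -> 0 <= av f.
Proof. by move=> f0; rewrite -(coupled_average_cst 0); exact: coupled_average_le. Qed.
End linear.

Lemma kernel_average_split N (w : 'M[R]_N) (x y : torus R) (X : 'I_N -> torus R) i :
  (0 < N)%N -> (forall i j, `|w i j| <= C) ->
  `|kernel_average R N w (fun k => sigma (x, X k)) i
    - kernel_average R N w (fun k => sigma (y, X k)) i| <= C * (Ls * torus_dist x y).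
Proof.
move=> N0 wC; rewrite /kernel_average -mulrBr -sumrB.
under eq_bigr do rewrite -mulrBr.
apply: weighted_mean_le => // k; apply: (le_trans (sigmaL _ _ _ _)).
by rewrite torus_distxx addr0.
Qed.

(** The operator norm of the commutator only sees averages of the interaction
    against a fixed function of the second variable, hence the discretization
    of the first one; the constant depends neither on the sizes nor on the
    kernels. *)
Lemma drift_stability eta : 0 < eta -> exists2 K, 0 <= K &
  forall N1 N2 (w1 : 'M[R]_N1) (w2 : 'M[R]_N2) (gam : 'M[R]_(N1, N2)) kap
    (x : 'I_N1 -> torus R) (y : 'I_N2 -> torus R),
  (0 < N1)%N -> (0 < N2)%N -> 0 <= kap ->
  (forall i j, `|w1 i j| <= C) -> (forall i j, `|w2 i j| <= C) -> coupling gam ->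
  opb (commut R N1 N2 w1 w2 gam) kap -> opb (commut R N2 N1 w2 w1 gam^T) kap ->
  coupled_average N1 N2 gam
    (fun i j => `|@drift R mu sigma N1 w1 x i - @drift R mu sigma N2 w2 y j|)
  <= eta + K * (kap + coupled_average N1 N2 gam (fun i j => torus_dist (x i) (y j))).
Proof.
move=> eta0.
pose M := `|sigma (0, 0)| + 2 * Ls.
have M0 : 0 <= M by rewrite addr_ge0// mulr_ge0.
have [K hK] : exists K, 2 * C * Ls * K.+1%:R^-1 <= eta / 2.
  have [K hK] : exists K : nat, 4 * C * Ls / eta < K.+1%:R.
    exists (Num.truncn (4 * C * Ls / eta)).
    by apply: truncnS_gt.
  exists K; rewrite ler_pdivrMr ?ltr0n//.
  by move: hK; rewrite ltr_pdivrMr// => hK; lra.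
pose q : R := K.+1%:R; have q0 : 0 < q by rewrite ltr0n.
pose e := eta / (2 * q); have e0 : 0 < e by rewrite divr_gt0// mulr_gt0.
pose c := 2 * (C * M) / e; have c0 : 0 <= c by rewrite divr_ge0 ?(ltW e0)// mulr_ge0// mulr_ge0.
exists (Lm + C * Ls + q * c * (M + C * Ls)).
  apply: addr_ge0; first by rewrite addr_ge0// mulr_ge0.
  by apply: mulr_ge0; [rewrite mulr_ge0//; exact: ltW|rewrite addr_ge0// mulr_ge0].
move=> N1 N2 w1 w2 gam kap x y N10 N20 kap0 w1C w2C cg k1 k2.
set D := coupled_average _ _ _ (fun i j => torus_dist _ _).
have D0 : 0 <= D by apply: coupled_average_ge0 => // i j; exact: torus_dist_ge0.
pose z a := cell_point K a.
pose F a i := kernel_average R N1 w1 (fun k => sigma (z a, x k)) i.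
pose G a j := kernel_average R N2 w2 (fun k => sigma (z a, y k)) j.
have hsig u v : `|sigma (u, v)| <= M by exact: sigma_bound.
have hFG a : coupled_average N1 N2 gam (fun i j => `|F a i - G a j|)
    <= e + c * (kap * M + C * (Ls * D)).
  apply: (@le_trans _ _ (coupled_average N1 N2 gam
      (fun i j => e + e^-1 * (F a i - G a j) ^+ 2))).
    apply: coupled_average_le => // i j; set r := F a i - G a j.
    have -> : r ^+ 2 = `|r| ^+ 2 by rewrite real_normK ?num_real.
    have := normr_ge0 r; move: `|r| => s s0.
    have [se|es] := leP s e; first by rewrite ler_wpDr// mulr_ge0 ?sqr_ge0 ?invr_ge0 ?(ltW e0).
    have : e * s <= s ^+ 2 by rewrite expr2 ler_wpM2r// ltW.
    by rewrite -ler_pdivlMl// => /le_trans; apply; rewrite lerDr ltW.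
  rewrite coupled_averageD coupled_average_cst// lerD2l coupled_averageZ.
  have := kernel_average_sqr R N1 N2 w1 w2 gam C M kap (fun k => sigma (z a, x k))
    (fun k => sigma (z a, y k)) N10 N20 C0 M0 kap0 w1C w2C cg k1 k2 (fun k => hsig _ _)
    (fun k => hsig _ _).
  move=> h; apply: (@le_trans _ _ (e^-1 * (2 * (C * M * (kap * M + C * (Ls * D)))))); last first.
    by rewrite /c le_eqVlt; apply/orP; left; apply/eqP; ring.
  rewrite ler_wpM2l ?invr_ge0 ?(ltW e0)//; apply: (le_trans h).
  rewrite ler_wpM2l// ler_wpM2l ?mulr_ge0// lerD2l ler_wpM2l//.
  rewrite -coupled_averageZ; apply: coupled_average_le => // i j.
  by apply: (le_trans (sigmaL _ _ _ _)); rewrite torus_distxx add0r.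
have main i j : `|@drift R mu sigma N1 w1 x i - @drift R mu sigma N2 w2 y j|
    <= (Lm + C * Ls) * torus_dist (x i) (y j) + (2 * C * Ls * q^-1 + \sum_a `|F a i - G a j|).
  pose a := torus_cell R K (x i).
  have -> : @drift R mu sigma N1 w1 x i - @drift R mu sigma N2 w2 y j
    = (mu (x i) - mu (y j)) + ((kernel_average R N1 w1 (fun k => sigma (x i, x k)) i - F a i)
      + ((F a i - G a j) + (G a j - kernel_average R N2 w2 (fun k => sigma (y j, y k)) j))).
    by rewrite /drift /kernel_average; ring.
  apply: (le_trans (ler_normD _ _)); have h1 := muL (x i) (y j).
  have h2 := ler_normD (kernel_average R N1 w1 (fun k => sigma (x i, x k)) i - F a i)
     ((F a i - G a j) + (G a j - kernel_average R N2 w2 (fun k => sigma (y j, y k)) j)).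
  have h3 := ler_normD (F a i - G a j)
     (G a j - kernel_average R N2 w2 (fun k => sigma (y j, y k)) j).
  have h4 := kernel_average_split N1 w1 (x i) (z a) x i N10 w1C.
  have h5 := kernel_average_split N2 w2 (z a) (y j) y j N20 w2C.
  have h6 : `|F a i - G a j| <= \sum_a `|F a i - G a j|.
    by rewrite (bigD1 a)//= lerDl sumr_ge0.
  have h7 : torus_dist (x i) (z a) <= q^-1 by exact: cell_point_dist.
  have h8 : torus_dist (z a) (y j) <= q^-1 + torus_dist (x i) (y j).
    apply: (le_trans (torus_dist_triangle _ (x i) _ _)).
    by rewrite torus_distC lerD2r.
  have CL : 0 <= C * Ls by rewrite mulr_ge0.
  have h9 := ler_wpM2l CL h7; have h10 := ler_wpM2l CL h8.
  rewrite -/(F a i) -/(G a j) in h4 h5.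
  move: h1 h2 h3 h4 h5 h6 h9 h10; rewrite !mulrA !mulrDr !mulrDl.
  by move: (q^-1) => q'; lra.
apply: (le_trans (coupled_average_le N1 N2 gam cg _ _ main)).
rewrite coupled_averageD coupled_averageZ coupled_averageD coupled_average_cst//.
rewrite coupled_average_sum -/D.
have h : \sum_a coupled_average N1 N2 gam (fun i j => `|F a i - G a j|)
    <= q * (e + c * (kap * M + C * (Ls * D))).
  apply: (@le_trans _ _ (\sum_(a < K.+1) (e + c * (kap * M + C * (Ls * D))))).
    by apply: ler_sum => a _; exact: hFG.
  by rewrite sumr_const card_ord -[leLHS]mulr_natl.
have qe : q * e = eta / 2 by rewrite /e; field; rewrite gt_eqF.
rewrite mulrDr qe in h.
have hx : 0 <= (Lm + C * Ls) * kap by rewrite mulr_ge0// addr_ge0// mulr_ge0.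
have qc0 : 0 <= q * c by apply: mulr_ge0; first exact: ltW.
have hy : 0 <= q * c * (M * D) by apply: mulr_ge0 => //; apply: mulr_ge0.
have hz : 0 <= q * c * (C * Ls * kap).
  by apply: mulr_ge0 => //; apply: mulr_ge0 => //; apply: mulr_ge0.
apply: (le_trans (lerD (lexx _) (lerD hK h))).
have hx' : 0 <= Lm * kap by rewrite mulr_ge0.
have -> : (Lm + C * Ls) * D + (eta / 2 + (eta / 2 + q * (c * (kap * M + C * (Ls * D)))))
  = eta + ((Lm + C * Ls) * D + q * c * (kap * M) + q * c * (C * Ls * D)) by field.
rewrite lerD2l.
have -> : (Lm + C * Ls + q * c * (M + C * Ls)) * (kap + D)
  = ((Lm + C * Ls) * D + q * c * (kap * M) + q * c * (C * Ls * D))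
    + ((Lm + C * Ls) * kap + q * c * (M * D) + q * c * (C * Ls * kap)) by ring.
by rewrite lerDl !addr_ge0.
Qed.
End coupled_drift.

Lemma torus_dist_lip (R : realType) (x x' y y' : torus R) :
  `|torus_dist x y - torus_dist x' y'| <= torus_dist x x' + torus_dist y y'.
Proof.
have h u u' v v' : torus_dist u v - torus_dist u' v' <= torus_dist u u' + torus_dist v v' :> R.
  have h1 := torus_dist_triangle R u' u v; have h2 := torus_dist_triangle R v' u' v.
  by rewrite (torus_distC R v v'); lra.
rewrite ler_norml h andbT; have := h x' x y' y.
by rewrite (torus_distC R x' x) (torus_distC R y' y); lra.
Qed.

Lemma continuous_torus_dist (R : realType) (f g : R -> R) :
  continuous f -> continuous g ->
  continuous (fun s => torus_dist (torus_pi (f s)) (torus_pi (g s))).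
Proof.
move=> cf cg s; apply/cvgrPdist_le => e e0; have e2 : 0 < e / 2 by rewrite divr_gt0.
have /cvgrPdist_le/(_ _ e2) hf := cf s; have /cvgrPdist_le/(_ _ e2) hg := cg s.
near=> u; apply: (le_trans (torus_dist_lip _ _ _ _ _)).
have h1 := torus_dist_pi R (f s) (f u); have h2 := torus_dist_pi R (g s) (g u).
have h3 : `|f s - f u| <= e / 2 by near: u.
have h4 : `|g s - g u| <= e / 2 by near: u.
by lra.
Unshelve. all: by end_near. Qed.

Section coupled_picard.
Variable R : realType.
Variables (mu : torus R -> R) (sigma : torus R * torus R -> R) (nu : R).
Variables (Lm Ls C : R).
Hypothesis mu_cont : continuous mu.
Hypothesis sigma_cont : continuous sigma.
Hypothesis Lm0 : 0 <= Lm.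
Hypothesis Ls0 : 0 <= Ls.
Hypothesis C0 : 0 <= C.
Hypothesis muL : forall x y, `|mu x - mu y| <= Lm * torus_dist x y.
Hypothesis sigmaL : forall x x' y y',
  `|sigma (x, y) - sigma (x', y')| <= Ls * (torus_dist x x' + torus_dist y y').
Local Notation "'II' a b f" := (\int[@lebesgue_measure R]_(x in `[a, b]) f x)
  (at level 10, a, b, f at level 9).

Definition path_average N1 N2 (gam : 'M[R]_(N1, N2)) (p1 : 'I_N1 -> R -> R)
    (p2 : 'I_N2 -> R -> R) s : R :=
  coupled_average R N1 N2 gam (fun i j => torus_dist (torus_pi (p1 i s)) (torus_pi (p2 j s))).

Lemma path_average_ge0 N1 N2 (gam : 'M[R]_(N1, N2)) p1 p2 s : (0 < N1)%N -> coupling gam ->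
  0 <= path_average N1 N2 gam p1 p2 s.
Proof. by move=> ? ?; apply: coupled_average_ge0 => // i j; exact: torus_dist_ge0. Qed.

Lemma continuous_coupled_average N1 N2 (gam : 'M[R]_(N1, N2)) (f : 'I_N1 -> 'I_N2 -> R -> R) :
  (forall i j, continuous (f i j)) ->
  continuous (fun s => coupled_average R N1 N2 gam (fun i j => f i j s)).
Proof.
move=> cf; apply: continuous_sum => i; apply: continuous_sum => j s.
by apply: cvgM; [exact: cf|exact: cvg_cst].
Qed.

Lemma continuous_path_average N1 N2 (gam : 'M[R]_(N1, N2)) p1 p2 :
  (forall i, continuous (p1 i)) -> (forall i, continuous (p2 i)) ->
  continuous (path_average N1 N2 gam p1 p2).
Proof.
by move=> c1 c2; apply: continuous_coupled_average => i j; exact: continuous_torus_dist.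
Qed.

Lemma coupled_average_Rintegral N1 N2 (gam : 'M[R]_(N1, N2)) (f : 'I_N1 -> 'I_N2 -> R -> R) a b :
  (forall i j, continuous (f i j)) ->
  coupled_average R N1 N2 gam (fun i j => II a b (f i j))
  = II a b (fun s => coupled_average R N1 N2 gam (fun i j => f i j s)).
Proof.
move=> cf; rewrite Rintegral_itv_sum; last first.
  move=> i; apply: continuous_sum => j s.
  by apply: cvgM; [exact: cf|exact: cvg_cst].
apply: eq_bigr => i _; rewrite Rintegral_itv_sum; last first.
  by move=> j s; apply: cvgM; [exact: cf|exact: cvg_cst].
apply: eq_bigr => j _; rewrite mulrC -Rintegral_itvZ//.
by apply: eq_Rintegral => s _; rewrite mulrC.
Qed.

Local Notation iter w x b := (picard_iter R mu sigma nu _ w x b).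

(** The constant of [drift_stability] blows up as its additive error tends to 0, so
    that Gronwall's inequality would be useless; along a fixed number of iterations
    the additive errors can be chosen one after the other. *)
Lemma picard_stability k (t : R) : 0 <= t -> forall eta, 0 < eta -> exists2 K, 0 <= K &
  forall N1 N2 (w1 : 'M[R]_N1) (w2 : 'M[R]_N2) (gam : 'M[R]_(N1, N2)) kap
    (x1 : 'I_N1 -> R) (x2 : 'I_N2 -> R) (b1 : 'I_N1 -> R -> R) (b2 : 'I_N2 -> R -> R) (s : R),
  (0 < N1)%N -> (0 < N2)%N -> 0 <= kap ->
  (forall i j, `|w1 i j| <= C) -> (forall i j, `|w2 i j| <= C) -> coupling gam ->
  opb (commut R N1 N2 w1 w2 gam) kap -> opb (commut R N2 N1 w2 w1 gam^T) kap ->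
  (forall i, continuous (b1 i)) -> (forall i, continuous (b2 i)) ->
  0 <= s -> s <= t ->
  path_average N1 N2 gam (iter w1 x1 b1 k) (iter w2 x2 b2 k) s
  <= eta + K * (coupled_average R N1 N2 gam
                  (fun i j => torus_dist (torus_pi (x1 i)) (torus_pi (x2 j)))
    + kap + path_average N1 N2 gam (fun i s => nu * b1 i s) (fun j s => nu * b2 j s) s
    + II 0 t (path_average N1 N2 gam (fun i s => nu * b1 i s) (fun j s => nu * b2 j s))).
Proof.
move=> t0; elim: k => [|k IH] eta eta0.
  exists 1 => // N1 N2 w1 w2 gam kap x1 x2 b1 b2 s N10 N20 kap0 _ _ cg _ _ _ _ s0 st.
  set NN := path_average N1 N2 gam (fun i s => nu * b1 i s) _.
  have I0 : 0 <= II 0 t NN by apply: Rintegral_itv_ge0 => u _ _; exact: path_average_ge0.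
  rewrite mul1r; apply: (@le_trans _ _ (coupled_average R N1 N2 gam
      (fun i j => torus_dist (torus_pi (x1 i)) (torus_pi (x2 j))) + NN s)); last by lra.
  rewrite -coupled_averageD; apply: coupled_average_le => // i j /=.
  by rewrite !torus_piD; exact: torus_distD.
pose e1 := eta / 2 / (t + 1); have t1 : 0 < t + 1 by lra.
have e10 : 0 < e1 by rewrite !divr_gt0.
have [K1 K10 h1] := drift_stability R mu sigma Lm Ls C Lm0 Ls0 C0 muL sigmaL e1 e10.
pose e2 := eta / 2 / (K1 * t + 1); have t2 : 0 < K1 * t + 1 by rewrite ltr_wpDl// mulr_ge0.
have e20 : 0 < e2 by rewrite !divr_gt0.
have [K2 K20 h2] := IH e2 e20.
exists (1 + K1 * t + K1 * K2 * (t + 1)).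
  by rewrite !addr_ge0// !mulr_ge0// ltW.
move=> N1 N2 w1 w2 gam kap x1 x2 b1 b2 s N10 N20 kap0 w1C w2C cg k1 k2 cb1 cb2 s0 st.
set NN := path_average N1 N2 gam (fun i s => nu * b1 i s) _.
set D0 := coupled_average _ _ _ _ _.
have NN0 u : 0 <= NN u by exact: path_average_ge0.
have I0 : 0 <= II 0 t NN by exact: Rintegral_itv_ge0.
have cNN : continuous NN.
  by apply: continuous_path_average => i u; apply: cvgM; try exact: cvg_cst; [exact: cb1|exact: cb2].
have D00 : 0 <= D0 by apply: coupled_average_ge0 => // i j; exact: torus_dist_ge0.
pose Y1 := torus_path R N1 (iter w1 x1 b1 k); pose Y2 := torus_path R N2 (iter w2 x2 b2 k).
have cY1 i : continuous (Y1 i).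
  exact/continuous_torus_path/(continuous_picard_iter R mu sigma nu N1 w1 mu_cont sigma_cont).
have cY2 i : continuous (Y2 i).
  exact/continuous_torus_path/(continuous_picard_iter R mu sigma nu N2 w2 mu_cont sigma_cont).
pose d1 i u := @drift R mu sigma N1 w1 (fun j => Y1 j u) i.
pose d2 i u := @drift R mu sigma N2 w2 (fun j => Y2 j u) i.
have cd1 i : continuous (d1 i) by exact: continuous_drift.
have cd2 i : continuous (d2 i) by exact: continuous_drift.
have cdd i j : continuous (fun u => `|d1 i u - d2 j u|).
  by apply: continuous_normr => u; apply: cvgB; [exact: cd1|exact: cd2].
pose A u := coupled_average R N1 N2 gam (fun i j => `|d1 i u - d2 j u|).
have hA : path_average N1 N2 gam (iter w1 x1 b1 k.+1) (iter w2 x2 b2 k.+1) s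
    <= D0 + NN s + II 0 s A.
  rewrite -coupled_average_Rintegral// -!coupled_averageD.
  apply: coupled_average_le => // i j /=; rewrite /picard_map !torus_piD.
  apply: (le_trans (torus_distD _ _ _ _ _)); rewrite -addrA lerD2l addrC.
  apply: (le_trans (torus_distD _ _ _ _ _)); rewrite lerD2r.
  apply: (le_trans (torus_dist_pi _ _ _)); rewrite -Rintegral_itvN; [|exact: cd1|exact: cd2].
  by apply: (Rintegral_itv_norm R (fun u => d1 i u - d2 j u)) => u; apply: cvgB; [exact: cd1|exact: cd2].
apply: (le_trans hA).
pose c := e1 + K1 * (kap + (e2 + K2 * (D0 + kap + II 0 t NN))).
have hI : II 0 s A <= II 0 s (fun u => c + K1 * K2 * NN u).
  apply: Rintegral_itv_le.
  - exact: continuous_coupled_average.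
  - by move=> u; apply: cvgD; [exact: cvg_cst|apply: cvgM; [exact: cvg_cst|exact: cNN]].
  move=> u u0 us; have ut := le_trans us st.
  apply: (le_trans (h1 _ _ w1 w2 gam kap _ _ N10 N20 kap0 w1C w2C cg k1 k2)).
  have := h2 _ _ w1 w2 gam kap x1 x2 b1 b2 u N10 N20 kap0 w1C w2C cg k1 k2 cb1 cb2 u0 ut.
  rewrite -/NN -/D0 => h.
  rewrite /c -addrA lerD2l -[K1 * K2 * NN u]mulrA -mulrDr ler_wpM2l//.
  rewrite -addrA lerD2l; apply: (le_trans h).
  by rewrite -!addrA lerD2l -mulrDr ler_wpM2l// -!addrA !lerD2l [leLHS]addrC.
have eI : II 0 s (fun u => c + K1 * K2 * NN u) = c * s + K1 * K2 * II 0 s NN.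
  rewrite (Rintegral_itvD R (fun _ => c) (fun u => K1 * K2 * NN u)).
  - by rewrite Rintegral_itv_cst// subr0 Rintegral_itvZ.
  - by move=> u; exact: cvg_cst.
  - by move=> u; apply: cvgM; [exact: cvg_cst|exact: cNN].
have hst : II 0 s NN <= II 0 t NN.
  by rewrite (Rintegral_itv_cat R NN 0 s t)// lerDl; exact: Rintegral_itv_ge0.
rewrite eI in hI; apply: (le_trans (lerD (lexx _) hI)).
have KK : 0 <= K1 * K2 by rewrite mulr_ge0.
have c0 : 0 <= c by rewrite !addr_ge0 ?(ltW e10)// mulr_ge0// !addr_ge0 ?(ltW e20)// mulr_ge0// !addr_ge0.
have hc : c * s <= c * t by rewrite ler_wpM2l.
have hK := ler_wpM2l KK hst.
apply: (@le_trans _ _ (D0 + NN s + (c * t + K1 * K2 * II 0 t NN))).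
  by rewrite lerD2l lerD.
have h3 : e1 * t <= eta / 2.
  by rewrite /e1 -mulrA ger_pMr ?divr_gt0// mulrC ler_pdivrMr// mul1r; lra.
have h4 : K1 * t * e2 <= eta / 2.
  by rewrite /e2 mulrCA ger_pMr ?divr_gt0// ler_pdivrMr// mul1r; lra.
have := NN0 s; move=> {hA eI hI hc c0 hK hst}; rewrite /c {c}.
set n := NN s; set J := II 0 t NN in I0 *; move=> n0.
have -> : D0 + n + ((e1 + K1 * (kap + (e2 + K2 * (D0 + kap + J)))) * t + K1 * K2 * J)
  = D0 + n + e1 * t + K1 * t * e2 + K1 * t * kap + K1 * K2 * t * (D0 + kap + J) + K1 * K2 * J.
  by ring.
have a1 : 0 <= K1 * t * (D0 + n + J) by rewrite mulr_ge0 ?mulr_ge0// !addr_ge0.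
have a2 : 0 <= K1 * K2 * t * n by rewrite !mulr_ge0.
have a3 : 0 <= K1 * K2 * (D0 + kap + n) by rewrite mulr_ge0// !addr_ge0.
have -> : (1 + K1 * t + K1 * K2 * (t + 1)) * (D0 + kap + n + J) =
  D0 + kap + n + J + K1 * t * kap + K1 * t * (D0 + n + J) + K1 * K2 * t * (D0 + kap + J)
  + K1 * K2 * t * n + K1 * K2 * J + K1 * K2 * (D0 + kap + n) by ring.
move: (K1 * K2 * t * (D0 + kap + J)) (K1 * K2 * J) => z1 z2.
by move: (K1 * t * kap) => z3; lra.
Qed.
End coupled_picard.

(** * Modulus of continuity and empirical laws of the noise *)

Section gaussian_tail.
Variable R : realType.

Lemma expRN_le (y : R) : 0 < y -> expR (- y) <= y^-1.
Proof.
move=> y0; rewrite expRN lef_pV2 ?posrE ?expR_gt0//.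
by apply: le_trans (expR_ge1Dx y); rewrite lerDr.
Qed.

(** The tail is compared with the one of a Gaussian of twice the variance, which
    spares the computation of a moment. *)
Lemma normal_pdf_le (s a x : R) : 0 < s -> 0 < a -> a < `|x| ->
  normal_pdf 0 s x <= 8 * s ^+ 2 / a ^+ 2 * normal_pdf 0 (Num.sqrt 2 * s) x.
Proof.
move=> s0 a0 ax.
have r2 : 0 < Num.sqrt 2 :> R by rewrite sqrtr_gt0.
have r22 : Num.sqrt 2 ^+ 2 = 2 :> R by rewrite sqr_sqrtr.
have rs0 : 0 < Num.sqrt 2 * s by rewrite mulr_gt0.
rewrite !normal_pdfE ?gt_eqF//.
rewrite /normal_peak /normal_fun !subr0.
have -> : (Num.sqrt 2 * s) ^+ 2 * pi *+ 2 = 2 * (s ^+ 2 * pi *+ 2).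
  by rewrite exprMn r22 -mulrA mulrnAr.
rewrite sqrtrM// (invfM (Num.sqrt 2)).
set c := (Num.sqrt (s ^+ 2 * pi *+ 2))^-1.
have c0 : 0 <= c by rewrite invr_ge0.
have es : s ^+ 2 != 0 by rewrite expf_neq0// gt_eqF.
have -> : - x ^+ 2 / (s ^+ 2 *+ 2) = - x ^+ 2 / ((Num.sqrt 2 * s) ^+ 2 *+ 2)
   + - (x ^+ 2 / (4 * s ^+ 2)).
  by rewrite exprMn r22; field; rewrite gt_eqF.
rewrite expRD.
set E := expR (- x ^+ 2 / _); have E0 : 0 <= E by exact: expR_ge0.
have xa : a ^+ 2 <= x ^+ 2 by rewrite -[x ^+ 2]real_normK ?num_real// lerXn2r ?nnegrE// ltW.
have a2 : 0 < a ^+ 2 by rewrite exprn_gt0.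
have x2 : 0 < x ^+ 2 by apply: lt_le_trans xa.
have s2 : 0 < s ^+ 2 by rewrite exprn_gt0.
have h : expR (- (x ^+ 2 / (4 * s ^+ 2))) <= 4 * s ^+ 2 / a ^+ 2.
  apply: (le_trans (expRN_le _ _)); first by rewrite divr_gt0// mulr_gt0.
  rewrite invf_div ler_wpM2l ?lef_pV2 ?posrE//; by rewrite mulr_ge0// ltW.
have r2le : 1 <= 2 * (Num.sqrt 2)^-1 :> R.
  rewrite ler_pdivlMr// mul1r -[leRHS]ger0_norm// -sqrtr_sqr ler_wsqrtr//.
  by rewrite expr2; lra.
apply: (@le_trans _ _ (c * (E * (4 * s ^+ 2 / a ^+ 2)))).
  by rewrite ler_wpM2l// ler_wpM2l.
have -> : 8 * s ^+ 2 / a ^+ 2 * ((Num.sqrt 2)^-1 * c * E) =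
  (2 * (Num.sqrt 2)^-1) * (c * (E * (4 * s ^+ 2 / a ^+ 2))) by ring.
by rewrite ler_peMl// !mulr_ge0// ?invr_ge0 ltW.
Qed.

Lemma normal_tail (s a : R) : 0 < s -> 0 < a ->
  (normal_prob 0 s [set x | (a < `|x|)%R] <= (8 * s ^+ 2 / a ^+ 2)%:E)%E.
Proof.
move=> s0 a0; set k := 8 * s ^+ 2 / a ^+ 2.
have k0 : 0 <= k by rewrite divr_ge0 ?mulr_ge0 ?exprn_ge0// ltW.
have r0 : Num.sqrt 2 * s != 0 by rewrite mulf_neq0 ?gt_eqF// sqrtr_gt0.
have mS : measurable ([set x | a < `|x|] : set (measurableTypeR R)).
  apply: open_measurable.
  have /continuousP/(_ _ (@open_gt R a)) := @norm_continuous R R.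
  exact.
rewrite /normal_prob.
apply: (@le_trans _ _ (\int[lebesgue_measure]_(x in [set x | (a < `|x|)%R])
   (k%:E * (normal_pdf 0 (Num.sqrt 2 * s) x)%:E))%E).
  apply: ge0_le_integral => //=.
  - by move=> x _; rewrite lee_fin normal_pdf_ge0.
  - by apply/measurable_EFinP; apply: measurable_funTS; exact: measurable_normal_pdf.
  - apply/measurable_EFinP; apply: measurable_funTS; apply: measurable_funM => //.
    exact: measurable_normal_pdf.
  - by move=> x ax; rewrite -EFinM lee_fin normal_pdf_le.
rewrite ge0_integralZl//; last 2 first.
- by apply/measurable_EFinP; apply: measurable_funTS; exact: measurable_normal_pdf.
- by move=> x _; rewrite lee_fin normal_pdf_ge0.
rewrite -[leRHS]mule1 lee_wpmul2l ?lee_fin//.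
exact: (probability_le1 (normal_prob 0 (Num.sqrt 2 * s)) mS).
Qed.
End gaussian_tail.

Section bounded_expectation.
Context (R : realType) (d : measure_display) (Omega : measurableType d).
Variable P : probability Omega R.

Definition bounded_rv (f : Omega -> R) :=
  measurable_fun setT f /\ exists M, forall om, `|f om| <= M.

Definition mean (f : Omega -> R) : R := \int[P]_om f om.

Lemma bounded_rv_integrable f : bounded_rv f -> P.-integrable setT (EFin \o f).
Proof.
move=> [mf [M fM]]; apply: measurable_bounded_integrable => //.
  by apply: (le_lt_trans (probability_le1 P measurableT)); exact: ltry.
exists M; split; first exact: num_real.
by move=> r Mr om _ /=; apply: (le_trans (fM om)); exact: ltW.
Qed.

Lemma bounded_rv_cst c : bounded_rv (fun _ => c).
Proof. by split; [exact: measurable_cst|exists `|c|]. Qed.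

Lemma bounded_rvD f g : bounded_rv f -> bounded_rv g -> bounded_rv (fun om => f om + g om).
Proof.
move=> [mf [M fM]] [mg [L gL]]; split; first exact: measurable_funD.
by exists (M + L) => om; apply: (le_trans (ler_normD _ _)); exact: lerD.
Qed.

Lemma bounded_rvM f g : bounded_rv f -> bounded_rv g -> bounded_rv (fun om => f om * g om).
Proof.
move=> [mf [M fM]] [mg [L gL]]; split; first exact: measurable_funM.
by exists (M * L) => om; rewrite normrM ler_pM.
Qed.

Lemma bounded_rvZ c f : bounded_rv f -> bounded_rv (fun om => c * f om).
Proof. by move=> bf; apply: bounded_rvM => //; exact: bounded_rv_cst. Qed.

Lemma bounded_rv_sum (I : Type) (r : seq I) (f : I -> Omega -> R) :
  (forall i, bounded_rv (f i)) -> bounded_rv (fun om => \sum_(i <- r) f i om).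
Proof.
move=> bf; elim: r => [|i r IH].
  under eq_fun do rewrite big_nil; exact: bounded_rv_cst.
by under eq_fun do rewrite big_cons; apply: bounded_rvD.
Qed.

Lemma bounded_rv_norm f : bounded_rv f -> bounded_rv (fun om => `|f om|).
Proof.
move=> [mf [M fM]]; split; last by exists M => om; rewrite normr_id.
by apply: measurableT_comp => //; exact: measurable_normr.
Qed.

Lemma bounded_rv_indic A : measurable A -> bounded_rv (\1_A).
Proof.
move=> mA; split; first exact: measurable_indic.
by exists 1 => om; rewrite indicE; case: (_ \in _); rewrite ?normr1 ?normr0.
Qed.

Lemma meanD f g : bounded_rv f -> bounded_rv g ->
  mean (fun om => f om + g om) = mean f + mean g.
Proof. by move=> bf bg; apply: RintegralD => //; exact: bounded_rv_integrable. Qed.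

Lemma meanZ c f : bounded_rv f -> mean (fun om => c * f om) = c * mean f.
Proof. by move=> bf; apply: RintegralZl => //; exact: bounded_rv_integrable. Qed.

Lemma mean_cst c : mean (fun _ => c) = c.
Proof.
rewrite /mean Rintegral_cst//.
by have -> : fine (P setT) = 1; [rewrite probability_setT|rewrite mulr1].
Qed.

Lemma mean_sum (I : Type) (r : seq I) (f : I -> Omega -> R) :
  (forall i, bounded_rv (f i)) ->
  mean (fun om => \sum_(i <- r) f i om) = \sum_(i <- r) mean (f i).
Proof.
move=> bf; elim: r => [|i r IH].
  by under eq_fun do rewrite big_nil; rewrite big_nil mean_cst.
under eq_fun do rewrite big_cons.
by rewrite big_cons meanD// ?IH//; exact: bounded_rv_sum.
Qed.

Lemma mean_le f g : bounded_rv f -> bounded_rv g -> (forall om, f om <= g om) ->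
  mean f <= mean g.
Proof. by move=> bf bg fg; apply: le_Rintegral => //; exact: bounded_rv_integrable. Qed.

Lemma mean_indic A : measurable A -> mean (\1_A) = fine (P A).
Proof. by move=> mA; rewrite /mean /Rintegral integral_indic// setIT. Qed.

Lemma mean_EFin f : bounded_rv f -> (\int[P]_om (f om)%:E)%E = (mean f)%:E.
Proof.
move=> bf; rewrite /mean /Rintegral fineK//.
exact: (integrable_fin_num _ (bounded_rv_integrable _ bf)).
Qed.

(** The integral of a nonnegative function is monotone without measurability,
    being a supremum over simple functions. *)
Lemma integral_ge0_le (f g : Omega -> \bar R) : (forall om, 0 <= f om)%E ->
  (forall om, f om <= g om)%E -> (\int[P]_om f om <= \int[P]_om g om)%E.
Proof.
move=> f0 fg; rewrite !ge0_integralTE//; last by move=> om; apply: le_trans (fg om).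
apply: le_ereal_sup => _ /= [h hf <-]; exists h => // om.
exact: le_trans (fg om).
Qed.

(** No measurability is asked of [f], which will be an infimum over uncountably many
    couplings. *)
Lemma expectation_le_mean (f g : Omega -> R) : (forall om, 0 <= f om) -> bounded_rv g ->
  {ae P, forall om, f om <= g om} -> ('E_P[f] <= (mean g)%:E)%E.
Proof.
move=> f0 bg [Z [mZ PZ hZ]]; rewrite unlock.
pose g' om : \bar R := if om \in Z then +oo%E else (Num.max (g om) 0)%:E.
have g'g : (\int[P]_om g' om = \int[P]_om (g om)%:E)%E.
  have [mg _] := bg; apply: ae_eq_integral => //.
  - apply: measurable_fun_ifT.
    + apply: (measurable_fun_bool true).
      rewrite setTI (_ : _ @^-1` _ = Z)//; apply/seteqP; split=> om /=; first exact: set_mem.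
      exact: mem_set.
    + exact: measurable_cst.
    + by apply/measurable_EFinP; apply: measurable_maxr.
  - exact/measurable_EFinP.
  exists Z; split=> // om /= hom; apply: contrapT => nZ; apply: hom => _.
  rewrite /g' memNset// max_l//; apply: (le_trans (f0 om)).
  by apply: contrapT => h; apply: nZ; apply: hZ.
rewrite -mean_EFin// -g'g; apply: integral_ge0_le => om; first by rewrite lee_fin.
rewrite /g'; case: ifPn => [_|]; first exact: leey.
rewrite notin_setE => nZ; rewrite lee_fin le_max; apply/orP; left.
by apply: contrapT => h; apply: nZ; apply: hZ.
Qed.
End bounded_expectation.

Lemma cvg_seq_le (R : realType) (u : nat -> R) l M : u n @[n --> \oo] --> l ->
  (forall n, u n <= M) -> l <= M.
Proof.
move=> ul uM; rewrite -(cvg_lim _ ul)//; apply: limr_le; last exact: nearW.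
exact: (cvgP _ ul).
Qed.

Section time_integral_mean.
Context (R : realType) (d : measure_display) (Omega : measurableType d).
Variable P : probability Omega R.
Local Notation mean := (mean R d Omega P).
Local Notation bounded_rv := (bounded_rv R d Omega).

Lemma mean_cvg (f_ : nat -> Omega -> R) (f : Omega -> R) M :
  (forall n, measurable_fun setT (f_ n)) ->
  (forall n om, `|f_ n om| <= M) -> (forall om, f_ n om @[n --> \oo] --> f om) ->
  bounded_rv f /\ mean (f_ n) @[n --> \oo] --> mean f.
Proof.
move=> mf fM cf.
have bf : bounded_rv f.
  split; first by apply: (@measurable_fun_cvg _ _ _ _ f_) => // om _.
  exists M => om; apply: (cvg_seq_le _ (fun n => `|f_ n om|)) => //.
  by apply: cvg_norm; exact: cf.
split=> //.
have bfn n : bounded_rv (f_ n) by split=> //; exists M.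
have h : (fun n => \int[P]_om (f_ n om)%:E)%E @ \oo --> (\int[P]_om (f om)%:E)%E.
  apply: (@dominated_cvg _ _ _ P setT measurableT (fun n om => (f_ n om)%:E)
    (fun om => (f om)%:E) (fun _ => M%:E)) => //.
  - by move=> n; exact/measurable_EFinP.
  - by move=> om _; apply: cvg_EFin; [exact: nearW|exact: cf].
  - by apply: (bounded_rv_integrable R d Omega P (fun _ => M)); exact: bounded_rv_cst.
  - by move=> n om _; rewrite /= lee_fin.
rewrite mean_EFin// in h.
exact: (fine_cvg h).
Qed.

(** Riemann sums reduce the claim to fixed times, so that no joint measurability in time
    and chance is needed. *)
Lemma mean_Rintegral_le (F : R -> Omega -> R) (a c M e : R) : a <= c ->
  (forall om, continuous (fun s => F s om)) ->
  (forall s, a <= s <= c -> measurable_fun setT (F s)) ->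
  (forall s om, `|F s om| <= M) -> (forall s, a <= s <= c -> mean (F s) <= e) ->
  let I om := \int[@lebesgue_measure R]_(s in `[a, c]) F s om in
  bounded_rv I /\ mean I <= (c - a) * e.
Proof.
move=> ac cF mF FM Fe I.
have grid n (j : 'I_n.+1) : a <= a + j%:R * ((c - a) / n.+1%:R) <= c.
  have n0 : 0 < n.+1%:R :> R by rewrite ltr0n.
  have h0 : 0 <= (c - a) / n.+1%:R by rewrite divr_ge0 ?subr_ge0.
  have eq : (c - a) / n.+1%:R * n.+1%:R = c - a by rewrite divfK// gt_eqF.
  rewrite lerDl mulr_ge0//=.
  have : j%:R * ((c - a) / n.+1%:R) <= n.+1%:R * ((c - a) / n.+1%:R).
    by rewrite ler_wpM2r// ler_nat; apply: ltnW.
  by rewrite (mulrC n.+1%:R) eq -lerBrDl.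
pose f_ n om := riemann_sum R (fun s => F s om) a c n.
have bF s : a <= s <= c -> bounded_rv (F s) by move=> hs; split; [exact: mF|exists M].
have bS n : bounded_rv (fun om => \sum_(j < n.+1) F (a + j%:R * ((c - a) / n.+1%:R)) om).
  by apply: bounded_rv_sum => j; exact/bF/grid.
have [] := mean_cvg f_ I ((c - a) * M).
- by move=> n; have [] := bounded_rvZ _ _ _ ((c - a) / n.+1%:R) _ (bS n).
- move=> n om; rewrite /f_ /riemann_sum normrM.
  have n0 : 0 < n.+1%:R :> R by rewrite ltr0n.
  rewrite ger0_norm ?divr_ge0 ?subr_ge0// -mulrA ler_wpM2l ?subr_ge0//.
  rewrite ler_pdivrMl//; apply: (le_trans (ler_norm_sum _ _ _)).
  apply: (@le_trans _ _ (\sum_(j < n.+1) M)); first by apply: ler_sum.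
  by rewrite sumr_const card_ord -[leLHS]mulr_natl.
- by move=> om; apply: cvg_riemann_sum.
move=> bI cI; split=> //.
apply: (cvg_seq_le _ _ _ _ cI) => n; rewrite /= /f_ /riemann_sum meanZ//.
have n0 : 0 < n.+1%:R :> R by rewrite ltr0n.
rewrite -mulrA ler_wpM2l ?subr_ge0// ler_pdivrMl// mean_sum; last first.
  by move=> j; exact/bF/grid.
apply: (@le_trans _ _ (\sum_(j < n.+1) e)); first by apply: ler_sum => j _; exact/Fe/grid.
by rewrite sumr_const card_ord -[leLHS]mulr_natl.
Qed.

(** Weak law of large numbers: only the covariances enter, so that pairwise
    independence is enough. *)
Lemma mean_empirical_deviation (N : nat) (A : 'I_N -> set Omega) (p : R) (a : 'I_N -> R) th :
  (0 < N)%N -> 0 < th -> (forall i, measurable (A i)) -> (forall i, 0 <= a i <= 1) ->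
  (forall i, P (A i) = p%:E) -> (forall i j, i != j -> P (A i `&` A j) = (p * p)%:E) ->
  mean (fun om => `|N%:R^-1 * \sum_i a i * (p - \1_(A i) om)|) <= th + (th * N%:R)^-1.
Proof.
move=> N0 th0 mA a01 PA PAA.
have n0 : 0 < N%:R :> R by rewrite ltr0n.
pose X i om : R := p - \1_(A i) om.
have b1 i : bounded_rv (\1_(A i)) by exact: bounded_rv_indic.
have bX i : bounded_rv (X i).
  apply: bounded_rvD; first exact: bounded_rv_cst.
  by under eq_fun do rewrite -mulN1r; exact: bounded_rvZ.
have p01 (i : 'I_N) : 0 <= p <= 1.
  have h1 : (P (A i) <= 1)%E := probability_le1 P (mA i).
  have h0 : (0 <= P (A i))%E := measure_ge0 P (A i).
  by rewrite PA lee_fin in h0; rewrite PA lee_fin in h1; rewrite h0.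
have bY : bounded_rv (fun om => N%:R^-1 * \sum_i a i * X i om).
  by apply: bounded_rvZ; apply: bounded_rv_sum => i; exact: bounded_rvZ.
have m1 i : mean (\1_(A i)) = p by rewrite mean_indic// PA.
have cov i j : mean (fun om => X i om * X j om) <= (i == j)%:R.
  have -> : (fun om => X i om * X j om)
      = (fun om => p * p + (- p * (\1_(A i) om + \1_(A j) om) + \1_(A i `&` A j) om)).
    by apply/funext => om; rewrite /X indicI/=; ring.
  have bI : bounded_rv (\1_(A i `&` A j)) by apply: bounded_rv_indic; exact: measurableI.
  have bD : bounded_rv (fun om => \1_(A i) om + \1_(A j) om) by exact: bounded_rvD.
  rewrite meanD; [|exact: bounded_rv_cst|by apply: bounded_rvD => //; exact: bounded_rvZ].
  rewrite mean_cst meanD//; last exact: bounded_rvZ.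
  rewrite meanZ// meanD// !m1 mean_indic; last exact: measurableI.
  have [<-|ij] := eqVneq i j; last first.
    by rewrite PAA//= (_ : _ + _ = 0)//; ring.
  rewrite setIid PA/=; have /andP[q0 q1] := p01 i.
  have -> : p * p + (- p * (p + p) + p) = p * (1 - p) by ring.
  by rewrite mulr_ile1// ?subr_ge0// gerBl.
apply: (@le_trans _ _ (mean (fun om => th + th^-1 * ((N%:R^-1 * \sum_i a i * X i om)
   * (N%:R^-1 * \sum_i a i * X i om))))).
  apply: mean_le.
  - exact: bounded_rv_norm.
  - by apply: bounded_rvD; [exact: bounded_rv_cst|apply: bounded_rvZ; exact: bounded_rvM].
  move=> om; rewrite -/(X _ om); set y := _ * _.
  have -> : y * y = `|y| * `|y| by rewrite -normrM ger0_norm// -expr2 sqr_ge0.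
  have := normr_ge0 y; move: `|y| => z z0.
  have [zt|tz] := leP z th; first by rewrite ler_wpDr// mulr_ge0 ?invr_ge0 ?(ltW th0)// mulr_ge0.
  apply: ler_wpDl; first exact: ltW.
  by rewrite ler_pdivlMl// ler_wpM2r// ltW.
rewrite meanD; [|exact: bounded_rv_cst|by apply: bounded_rvZ; exact: bounded_rvM].
rewrite mean_cst lerD2l meanZ; last exact: bounded_rvM.
rewrite invfM ler_wpM2l ?invr_ge0 ?(ltW th0)//.
have -> : (fun om => N%:R^-1 * (\sum_i a i * X i om) * (N%:R^-1 * \sum_i a i * X i om))
    = (fun om => (N%:R^-1 * N%:R^-1) * \sum_i \sum_j (a i * a j) * (X i om * X j om)).
  apply/funext => om; rewrite mulrACA; congr (_ * _).
  rewrite mulr_suml; apply: eq_bigr => i _; rewrite mulr_sumr; apply: eq_bigr => j _.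
  by rewrite mulrACA.
have bXX i j : bounded_rv (fun om => a i * a j * (X i om * X j om)).
  by apply: bounded_rvZ; exact: bounded_rvM.
rewrite meanZ; last by apply: bounded_rv_sum => i; exact: bounded_rv_sum.
rewrite -mulrA ger_pMr ?invr_gt0// ler_pdivrMl// mulr1.
rewrite mean_sum; last by move=> i; exact: bounded_rv_sum.
apply: (@le_trans _ _ (\sum_(i < N) 1)); last by rewrite sumr_const card_ord.
apply: ler_sum => i _; rewrite mean_sum//.
apply: (@le_trans _ _ (\sum_j a i * a j * (i == j)%:R)).
  apply: ler_sum => j _; rewrite meanZ; last exact: bounded_rvM.
  by rewrite ler_wpM2l// mulr_ge0//; [case/andP: (a01 i)|case/andP: (a01 j)].
rewrite (bigD1 i)//= big1 ?addr0; last first.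
  by move=> j ji; rewrite eq_sym (negbTE ji) mulr0.
by rewrite eqxx mulr1; have /andP[q0 q1] := a01 i; rewrite mulr_ile1.
Qed.
End time_integral_mean.

Section noise_labels.
Context (R : realType) (d : measure_display) (Omega : measurableType d).
Variable P : probability Omega R.
Variables (nu h : R) (m K : nat).
Hypothesis h0 : 0 < h.
Local Notation mean := (mean R d Omega P).
Local Notation bounded_rv := (bounded_rv R d Omega).
Local Notation T := {ffun 'I_m -> 'I_K.+1}.

Definition increment (W : R -> Omega -> R) (k : nat) om : R :=
  W (k.+1%:R * h) om - W (k%:R * h) om.

(** Particles with equal labels receive nearly the same noise at all times of the grid,
    as elements of the torus, while the labels are finitely many, independent and
    equally distributed, in a way that depends neither on the particle nor on the size
    of the system. *)
Definition noise_label (W : R -> Omega -> R) om : T :=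
  [ffun k : 'I_m => torus_cell R K (torus_pi (nu * increment W k om))].

Definition cell_set (c : 'I_K.+1) : set (measurableTypeR R) :=
  [set x | torus_cell R K (torus_pi (nu * x)) = c].

Definition noise_law (l : T) : R := \prod_k fine (normal_prob 0 (Num.sqrt h) (cell_set (l k))).

Lemma measurable_cell_set c : measurable (cell_set c).
Proof.
have := @measurable_funM _ _ R setT (cst nu) id (measurable_cst _) (@measurable_id _ _ setT).
move=> /(_ measurableT _ (measurable_torus_cell R K c)).
by rewrite setTI.
Qed.

Lemma fine_normal_prob c : normal_prob 0 (Num.sqrt h) (cell_set c)
  = (fine (normal_prob 0 (Num.sqrt h) (cell_set c)))%:E.
Proof.
rewrite fineK//; apply: fin_num_measure; exact: measurable_cell_set.
Qed.

Lemma noise_law_ge0 l : 0 <= noise_law l.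
Proof. by apply: prodr_ge0 => k _; rewrite fine_ge0// measure_ge0. Qed.

Lemma noise_label_event W l : [set om | noise_label W om = l]
  = \bigcap_(k in [set` [set: 'I_m]%SET]) (increment W k @^-1` cell_set (l k)).
Proof.
apply/seteqP; split=> [om <- k _|om hom] /=; first by rewrite /cell_set /= ffunE.
by apply/ffunP => k; rewrite ffunE; apply: hom => /=; rewrite inE.
Qed.

Lemma grid_ge0 k : 0 <= k%:R * h.
Proof. by rewrite mulr_ge0// ltW. Qed.

Lemma noise_label_law W : brownian_motion P W -> forall l,
  P [set om | noise_label W om = l] = (noise_law l)%:E.
Proof.
move=> bW l; rewrite noise_label_event.
have hmono : {homo (fun k => k%:R * h) : i j / (i <= j)%N >-> i <= j}.
  by move=> i j ij; rewrite ler_wpM2r ?(ltW h0)// ler_nat.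
have := bm_independent_increments bW (k := m) (grid_ge0 0) hmono.
move=> /(_ [set: 'I_m]%SET (fun k : 'I_m => increment W k @^-1` cell_set (l k))) ->; last first.
  move=> k _; exists (cell_set (l k)); first exact: measurable_cell_set.
  by rewrite setTI.
rewrite /noise_law -prodEFin; apply: eq_big => [k|k _]; first by rewrite inE.
rewrite -fine_normal_prob.
have lt : k%:R * h < k.+1%:R * h by rewrite ltr_pM2r// ltr_nat.
rewrite (bm_increments bW (grid_ge0 k) lt (measurable_cell_set (l k))).
by have -> : k.+1%:R * h - k%:R * h = h by rewrite -natr1 mulrDl mul1r addrC addKr.
Qed.

Lemma noise_label_process_event W l : process_events W [set om | noise_label W om = l].
Proof.
pose G := \bigcup_(t in [set t : R | 0 <= t]) rv_events (W t).
have mW t : 0 <= t -> measurable_fun setT (W t : g_sigma_algebraType G -> R).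
  move=> t0 _ U mU; apply: sub_gen_smallest; exists t => //.
  by exists U.
have -> : process_events W = @measurable _ (g_sigma_algebraType G) by [].
rewrite noise_label_event; apply: fin_bigcap_measurable; first exact: finite_finset.
move=> k _; rewrite -[X in measurable X]setTI.
have mi : measurable_fun setT (increment W k : g_sigma_algebraType G -> R).
  by apply: measurable_funB; apply: mW; exact: grid_ge0.
exact: (mi measurableT _ (measurable_cell_set (l k))).
Qed.

Lemma measurable_noise_label W l : brownian_motion P W ->
  measurable [set om | noise_label W om = l].
Proof.
move=> bW; rewrite noise_label_event.
apply: fin_bigcap_measurable; first exact: finite_finset.
move=> k _; rewrite -[X in measurable X]setTI.
have mi : measurable_fun setT (increment W k).
  by apply: measurable_funB; apply: (bm_measurable bW); exact: grid_ge0.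
exact: (mi measurableT _ (measurable_cell_set (l k))).
Qed.

Lemma indic_noise_label W l om :
  \1_[set om | noise_label W om = l] om = (noise_label W om == l)%:R :> R.
Proof.
rewrite indicE; congr (nat_of_bool _)%:R; apply/idP/eqP => [|e]; first by rewrite inE.
by rewrite inE.
Qed.

Lemma noise_law_sum W : brownian_motion P W -> \sum_l noise_law l = 1.
Proof.
move=> bW; have b l : bounded_rv (\1_[set om | noise_label W om = l]).
  by apply: bounded_rv_indic; exact: measurable_noise_label.
rewrite -(mean_cst R d Omega P 1).
have -> : (fun _ : Omega => 1) = (fun om => \sum_l \1_[set om | noise_label W om = l] om) :> (_ -> R).
  apply/funext => om; rewrite (bigD1 (noise_label W om))//= indic_noise_label eqxx.
  by rewrite big1 ?addr0// => l /negbTE ne; rewrite indic_noise_label eq_sym ne.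
rewrite mean_sum//; apply: eq_bigr => l _; rewrite mean_indic; last exact: measurable_noise_label.
by rewrite noise_label_law.
Qed.

Section family.
Variables (N : nat) (B : 'I_N -> R -> Omega -> R).
Hypothesis N0 : (0 < N)%N.
Hypothesis indB : independent_brownian_motions P B.

Lemma noise_label_pair i j l : i != j ->
  P ([set om | noise_label (B i) om = l] `&` [set om | noise_label (B j) om = l])
  = (noise_law l * noise_law l)%:E.
Proof.
move=> ij; have [bB hind] := indB.
have := hind [set i; j]%SET (fun k => [set om | noise_label (B k) om = l]).
move=> /(_ (fun k _ => noise_label_process_event (B k) l)).
rewrite (_ : \bigcap_(k in _) _ = [set om | noise_label (B i) om = l]
    `&` [set om | noise_label (B j) om = l]); last first.
  apply/seteqP; split=> [om hom|om [h1 h2] k /=].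
    by split; apply: hom; rewrite /= !inE eqxx ?orbT.
  by rewrite !inE => /orP[] /eqP ->.
move=> ->; rewrite big_setU1 ?inE//= big_set1.
by rewrite !noise_label_law.
Qed.

Definition label_deviation (S : finType) (t : 'I_N -> S) om : R :=
  \sum_(l : S * T) `|label_freq t l.1 * noise_law l.2
    - label_freq (fun i => (t i, noise_label (B i) om)) l|.

Lemma label_deviationE (S : finType) (t : 'I_N -> S) om :
  label_deviation S t om = \sum_(l : S * T) `|N%:R^-1 * \sum_i (t i == l.1)%:R *
    (noise_law l.2 - \1_[set om | noise_label (B i) om = l.2] om)|.
Proof.
apply: eq_bigr => -[s x] _; rewrite /label_freq /= -mulrA -mulrBr; congr `|_ * _|.
rewrite mulr_suml -sumrB; apply: eq_bigr => i _.
by rewrite indic_noise_label mulrBr xpair_eqE -natrM mulnb.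
Qed.

Lemma label_deviation_ge0 (S : finType) (t : 'I_N -> S) om : 0 <= label_deviation S t om.
Proof. by apply: sumr_ge0. Qed.

Lemma mean_label_deviation (S : finType) (t : 'I_N -> S) th : 0 < th ->
  bounded_rv (label_deviation S t) /\
  mean (label_deviation S t) <= #|{: S * T}|%:R * (th + (th * N%:R)^-1).
Proof.
move=> th0; have [bB _] := indB.
have b i l : bounded_rv (\1_[set om | noise_label (B i) om = l]).
  by apply: bounded_rv_indic; exact: measurable_noise_label.
have bD (l : S * T) : bounded_rv (fun om => `|N%:R^-1 * \sum_i (t i == l.1)%:R *
    (noise_law l.2 - \1_[set om | noise_label (B i) om = l.2] om)|).
  apply: bounded_rv_norm; apply: bounded_rvZ; apply: bounded_rv_sum => i; apply: bounded_rvZ.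
  apply: bounded_rvD; first exact: bounded_rv_cst.
  by under eq_fun do rewrite -mulN1r; exact: bounded_rvZ.
have -> : label_deviation S t = (fun om => \sum_(l : S * T) `|N%:R^-1 * \sum_i (t i == l.1)%:R *
    (noise_law l.2 - \1_[set om | noise_label (B i) om = l.2] om)|).
  by apply/funext => om; exact: label_deviationE.
split; first exact: bounded_rv_sum.
rewrite mean_sum//.
apply: (@le_trans _ _ (\sum_(l : S * T) (th + (th * N%:R)^-1))); last first.
  by rewrite sumr_const -[leLHS]mulr_natl.
apply: ler_sum => l _.
apply: (mean_empirical_deviation R d Omega P N (fun i => [set om | noise_label (B i) om = l.2])
  (noise_law l.2) (fun i => (t i == l.1)%:R)) => //.
- by move=> i; exact: measurable_noise_label.
- by move=> i; case: (_ == _); rewrite ?lexx ?ler01.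
- by move=> i; exact: noise_label_law.
- by move=> i j ij; exact: noise_label_pair.
Qed.
End family.
End noise_labels.

Section grid_paths.
Variable R : realType.
Variables (h : R) (m : nat).
Hypothesis h0 : 0 < h.
Local Notation "'II' a b f" := (\int[@lebesgue_measure R]_(x in `[a, b]) f x)
  (at level 10, a, b, f at level 9).

Lemma Rintegral_grid (f : R -> R) : continuous f ->
  II 0 (m%:R * h) f = \sum_(k < m) II (k%:R * h) (k.+1%:R * h) f.
Proof.
move=> cf; elim: m => [|n IH]; first by rewrite mul0r Rintegral_itv1 big_ord0.
rewrite big_ord_recr/= -IH; apply: Rintegral_itv_cat => //.
  by rewrite mulr_ge0// ltW.
by rewrite ler_wpM2r ?(ltW h0)// ler_nat.
Qed.

(** The errors made on the increments add up, whence the factor [m]. *)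
Lemma grid_dist K (p1 p2 : R -> R) : p1 0 = p2 0 ->
  (forall k, (k < m)%N ->
     torus_cell R K (torus_pi (p1 (k.+1%:R * h) - p1 (k%:R * h)))
     = torus_cell R K (torus_pi (p2 (k.+1%:R * h) - p2 (k%:R * h)))) ->
  forall k, (k <= m)%N ->
    torus_dist (torus_pi (p1 (k%:R * h))) (torus_pi (p2 (k%:R * h))) <= m%:R / K.+1%:R.
Proof.
move=> p0 hcell k km; apply: (@le_trans _ _ (k%:R / K.+1%:R)); last first.
  by rewrite ler_wpM2r ?invr_ge0// ler_nat.
elim: k km => [|k IH] km; first by rewrite !mul0r p0 torus_distxx.
have e (p : R -> R) : torus_pi (p (k.+1%:R * h))
    = torus_pi (p (k%:R * h)) + torus_pi (p (k.+1%:R * h) - p (k%:R * h)).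
  by rewrite -torus_piD addrC subrK.
rewrite (e p1) (e p2); apply: (le_trans (torus_distD _ _ _ _ _)).
have -> : k.+1%:R / K.+1%:R = k%:R / K.+1%:R + K.+1%:R^-1 :> R.
  by rewrite -[k.+1%:R]natr1 mulrDl mul1r.
apply: lerD; first by apply: IH; exact: ltnW.
by apply: torus_cell_dist; exact: hcell.
Qed.

Definition oscillation (p : R -> R) : R := \sum_(k < m)
  II (k%:R * h) (k.+1%:R * h) (fun s => torus_dist (torus_pi (p s)) (torus_pi (p (k%:R * h)))).

Lemma continuous_osc (p : R -> R) s0 : continuous p ->
  continuous (fun s => torus_dist (torus_pi (p s)) (torus_pi (p s0))).
Proof. by move=> cp; apply: (continuous_torus_dist R p (fun _ => p s0)) => // s; exact: cvg_cst. Qed.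

Section matched.
Variables (N1 N2 : nat) (gam : 'M[R]_(N1, N2)) (p1 : 'I_N1 -> R -> R) (p2 : 'I_N2 -> R -> R).
Variables (T : Type) (r1 : 'I_N1 -> T) (r2 : 'I_N2 -> T) (Th : R) (K : nat).
Hypothesis cp1 : forall i, continuous (p1 i).
Hypothesis cp2 : forall i, continuous (p2 i).
Hypothesis match_grid : forall i j, r1 i = r2 j -> forall k, (k <= m)%N ->
  torus_dist (torus_pi (p1 i (k%:R * h))) (torus_pi (p2 j (k%:R * h))) <= m%:R / K.+1%:R.
Hypothesis average_le : forall (f : 'I_N1 -> 'I_N2 -> R) c J1 J2,
  (forall i j, f i j <= 1) -> 0 <= c -> (forall i, 0 <= J1 i) -> (forall j, 0 <= J2 j) ->
  (forall i j, r1 i = r2 j -> f i j <= c + J1 i + J2 j) ->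
  coupled_average R N1 N2 gam f <= Th + c + N1%:R^-1 * \sum_i J1 i + N2%:R^-1 * \sum_j J2 j.
Local Notation NN := (path_average R N1 N2 gam p1 p2).

Lemma matched_end : NN (m%:R * h) <= Th + m%:R / K.+1%:R.
Proof.
have := average_le (fun i j => torus_dist (torus_pi (p1 i (m%:R * h))) (torus_pi (p2 j (m%:R * h))))
  (m%:R / K.+1%:R) (fun _ => 0) (fun _ => 0).
rewrite !big1// !mulr0 !addr0; apply=> //.
- by move=> i j; exact: torus_dist_le1.
- by move=> i j rij; rewrite /= ?addr0; exact: match_grid.
Qed.

Lemma matched_integral : II 0 (m%:R * h) NN <= m%:R * h * (Th + m%:R / K.+1%:R)
  + N1%:R^-1 * \sum_i oscillation (p1 i) + N2%:R^-1 * \sum_j oscillation (p2 j).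
Proof.
have cNN : continuous NN by exact: continuous_path_average.
rewrite Rintegral_grid//.
pose e := m%:R / K.+1%:R : R.
pose o1 k i s := torus_dist (torus_pi (p1 i s)) (torus_pi (p1 i (k%:R * h))).
pose o2 k i s := torus_dist (torus_pi (p2 i s)) (torus_pi (p2 i (k%:R * h))).
have co1 k i : continuous (o1 k i) by exact: continuous_osc.
have co2 k i : continuous (o2 k i) by exact: continuous_osc.
have step (k : 'I_m) : II (k%:R * h) (k.+1%:R * h) NN <= h * (Th + e)
    + N1%:R^-1 * \sum_i II (k%:R * h) (k.+1%:R * h) (o1 k i)
    + N2%:R^-1 * \sum_j II (k%:R * h) (k.+1%:R * h) (o2 k j).
  have kk : k%:R * h <= k.+1%:R * h by rewrite ler_wpM2r ?(ltW h0)// ler_nat.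
  have cs1 : continuous (fun s => N1%:R^-1 * \sum_i o1 k i s).
    by move=> s; apply: cvgM; [exact: cvg_cst|apply: continuous_sum => i; exact: co1].
  have cs2 : continuous (fun s => N2%:R^-1 * \sum_i o2 k i s).
    by move=> s; apply: cvgM; [exact: cvg_cst|apply: continuous_sum => i; exact: co2].
  have cc : continuous (fun _ : R => Th + e) by move=> s; exact: cvg_cst.
  have c12 : continuous (fun s => Th + e + N1%:R^-1 * \sum_i o1 k i s).
    by move=> s; apply: cvgD; [exact: cc|exact: cs1].
  apply: (@le_trans _ _ (II (k%:R * h) (k.+1%:R * h)
    (fun s => Th + e + N1%:R^-1 * \sum_i o1 k i s + N2%:R^-1 * \sum_j o2 k j s))).
    apply: Rintegral_itv_le => //.
      by move=> s; apply: cvgD; [exact: c12|exact: cs2].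
    move=> s _ _; apply: average_le => //.
    - by move=> i j; exact: torus_dist_le1.
    - by rewrite divr_ge0.
    - by move=> i; exact: torus_dist_ge0.
    - by move=> i; exact: torus_dist_ge0.
    move=> i j rij; have hk := match_grid i j rij k (ltnW (ltn_ord k)).
    apply: (le_trans (torus_dist_triangle _ (torus_pi (p1 i (k%:R * h))) _ _)).
    have := torus_dist_triangle _ (torus_pi (p2 j (k%:R * h))) (torus_pi (p1 i (k%:R * h)))
      (torus_pi (p2 j s)).
    rewrite (torus_distC _ (torus_pi (p2 j (k%:R * h))) (torus_pi (p2 j s))).
    by rewrite -/(o1 k i s) -/(o2 k j s) -/e in hk *; lra.
  rewrite (Rintegral_itvD R _ _ _ _ c12 cs2) (Rintegral_itvD R _ _ _ _ cc cs1).
  rewrite Rintegral_itv_cst// !Rintegral_itvZ ?Rintegral_itv_sum//.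
  - by rewrite (_ : k.+1%:R * h - k%:R * h = h) 1?mulrC// -natr1; ring.
  - by apply: continuous_sum => i; exact: co2.
  - by apply: continuous_sum => i; exact: co1.
apply: (le_trans (ler_sum _ (fun k _ => step k))).
rewrite !big_split/= sumr_const card_ord -[_ *+ m]mulr_natl mulrA.
rewrite -!mulr_sumr /oscillation [X in _ + _ * X + _]exchange_big/=.
by rewrite [X in _ + _ * X <= _]exchange_big.
Qed.
End matched.
End grid_paths.

Section noise_oscillation.
Context (R : realType) (d : measure_display) (Omega : measurableType d).
Variable P : probability Omega R.
Variables (nu : R) (N : nat) (B : 'I_N -> R -> Omega -> R).
Hypothesis nu0 : 0 <= nu.
Hypothesis bmB : forall i, brownian_motion P (B i).
Variable Z : set Omega.
Hypothesis mZ : measurable Z.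
Hypothesis PZ : P Z = 0%E.
Hypothesis hZ : forall om, ~ Z om -> forall i, B i 0 om = 0 /\
    {within `[0, +oo[, continuous (fun t => B i t om)}.
Local Notation b := (regular_noise R d Omega N B Z).
Local Notation mean := (mean R d Omega P).
Local Notation bounded_rv := (bounded_rv R d Omega).
Local Notation dist i s u om :=
  (torus_dist (torus_pi (nu * b i s om)) (torus_pi (nu * b i u om))).

Lemma bounded_noise_dist i s u : 0 <= s -> 0 <= u -> bounded_rv (fun om => dist i s u om).
Proof.
move=> s0 u0; split; last first.
  by exists 1 => om; rewrite ger0_norm ?torus_dist_ge0// torus_dist_le1.
have mb v : 0 <= v -> measurable_fun setT (b i v) by exact: measurable_regular_noise.
have e om : dist i s u om = torus_dist (torus_pi (nu * (b i s om - b i u om))) 0.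
  by rewrite mulrBr torus_piB torus_distB.
under eq_fun do rewrite e.
apply: (@measurableT_comp _ _ _ _ _ _ (fun x : R => torus_dist (torus_pi x) 0)).
  apply: continuous_measurable_fun; rewrite -(torus_pi0 R).
  by apply: (continuous_torus_dist R id (fun _ => 0)) => v; [exact: cvg_id|exact: cvg_cst].
by apply: measurable_funM; [exact: measurable_cst|apply: measurable_funB; exact: mb].
Qed.

(** The distance is at most [nu * a] as long as the increment of the noise is below [a],
    and at most 1 on the event that it exceeds [a], to which [normal_tail] applies. *)
Lemma mean_noise_dist i s u a hh : 0 < a -> 0 <= u -> u <= s -> s <= u + hh ->
  mean (fun om => dist i s u om) <= nu * a + 8 * hh / a ^+ 2.
Proof.
move=> a0 u0; rewrite le_eqVlt => /predU1P[->|us] sh.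
  under eq_fun do rewrite torus_distxx.
  rewrite mean_cst; apply: addr_ge0; first by rewrite mulr_ge0// ltW.
  by rewrite divr_ge0 ?exprn_ge0 ?(ltW a0)// mulr_ge0//; rewrite lerDl in sh.
have s0 : 0 <= s by apply: le_trans (ltW us).
have mB v : 0 <= v -> measurable_fun setT (B i v) by exact: (bm_measurable (bmB i)).
pose U : set (measurableTypeR R) := [set x | a < `|x|].
have mU : measurable U.
  apply: open_measurable.
  have /continuousP/(_ _ (@open_gt R a)) := @norm_continuous R R.
  exact.
pose A := (fun om => B i s om - B i u om) @^-1` U.
have mA : measurable A.
  rewrite -[A]setTI; have mi : measurable_fun setT (fun om => B i s om - B i u om).
    by apply: measurable_funB; exact: mB.
  exact: (mi measurableT _ mU).
have bA := bounded_rv_indic R d Omega A mA.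
apply: (@le_trans _ _ (mean (fun om => nu * a + \1_A om))).
  apply: mean_le; first exact: bounded_noise_dist.
    by apply: bounded_rvD => //; exact: bounded_rv_cst.
  move=> om; have [zom|zom] := pselect (Z om).
    have e v : b i v om = 0 by rewrite /regular_noise; case: asboolP.
    by rewrite !e torus_distxx addr_ge0// ?mulr_ge0 ?(ltW a0).
  rewrite !regular_noiseE//.
  have [aom|aom] := ltP a `|B i s om - B i u om|.
    have -> : \1_A om = 1 :> R by rewrite indicE mem_set.
    apply: (le_trans (torus_dist_le1 _ _ _)); rewrite lerDr mulr_ge0//; exact: ltW.
  apply: (le_trans (torus_dist_pi _ _ _)); rewrite -mulrBr normrM (ger0_norm nu0).
  by apply: ler_wpDr; [rewrite indicE|rewrite ler_wpM2l].
rewrite meanD//; last exact: bounded_rv_cst.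
rewrite mean_cst lerD2l mean_indic//.
have h : (P A <= (8 * Num.sqrt (s - u) ^+ 2 / a ^+ 2)%:E)%E.
  rewrite (bm_increments (bmB i) u0 us mU); apply: normal_tail => //.
  by rewrite sqrtr_gt0 subr_gt0.
rewrite sqr_sqrtr ?subr_ge0 ?(ltW us)// in h.
apply: (@le_trans _ _ (8 * (s - u) / a ^+ 2)).
  by rewrite -lee_fin fineK// fin_num_measure.
rewrite ler_wpM2r ?invr_ge0 ?exprn_ge0 ?(ltW a0)//.
by rewrite ler_wpM2l// lerBlDl.
Qed.

Lemma mean_oscillation hh m i a : 0 < hh -> 0 < a ->
  let osc om := oscillation R hh m (fun s => nu * b i s om) in
  bounded_rv osc /\ mean osc <= m%:R * hh * (nu * a + 8 * hh / a ^+ 2).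
Proof.
move=> hh0 a0 osc.
have hk (k : 'I_m) := mean_Rintegral_le R d Omega P (fun s om => dist i s (k%:R * hh) om)
  (k%:R * hh) (k.+1%:R * hh) 1 (nu * a + 8 * hh / a ^+ 2).
have k0 (k : 'I_m) : 0 <= k%:R * hh by rewrite mulr_ge0// ltW.
have kk (k : 'I_m) : k.+1%:R * hh = k%:R * hh + hh by rewrite -natr1 mulrDl mul1r.
have {}hk (k : 'I_m) : bounded_rv (fun om => \int[@lebesgue_measure R]_(s in `[k%:R * hh, k.+1%:R * hh])
      dist i s (k%:R * hh) om) /\
    mean (fun om => \int[@lebesgue_measure R]_(s in `[k%:R * hh, k.+1%:R * hh])
      dist i s (k%:R * hh) om) <= hh * (nu * a + 8 * hh / a ^+ 2).
  have e : k.+1%:R * hh - k%:R * hh = hh by rewrite kk addrC addKr.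
  have := hk k; rewrite e /=; apply.
  - by rewrite kk lerDl ltW.
  - move=> om; apply: continuous_osc => s; apply: cvgM; first exact: cvg_cst.
    exact: (continuous_regular_noise _ _ _ N B Z hZ).
  - move=> s /andP[ks _].
    by case: (bounded_noise_dist i s (k%:R * hh) (le_trans (k0 k) ks) (k0 k)).
  - by move=> s om; rewrite ger0_norm ?torus_dist_ge0// torus_dist_le1.
  - move=> s /andP[ks sk]; apply: mean_noise_dist => //.
    by rewrite -kk.
split; first by apply: bounded_rv_sum => k; case: (hk k).
rewrite mean_sum; last by move=> k; case: (hk k).
apply: (@le_trans _ _ (\sum_(k < m) (hh * (nu * a + 8 * hh / a ^+ 2)))).
  by apply: ler_sum => k _; case: (hk k).
by rewrite sumr_const card_ord -[leLHS]mulr_natl mulrA.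
Qed.
End noise_oscillation.

(** * Stability in expectation *)

Section pathwise.
Variable R : realType.
Variables (mu : torus R -> R) (sigma : torus R * torus R -> R) (nu : R).
Variables (h : R) (m K : nat).
Hypothesis h0 : 0 < h.
Local Notation T := {ffun 'I_m -> 'I_K.+1}.
Local Notation "'II' a b f" := (\int[@lebesgue_measure R]_(x in `[a, b]) f x)
  (at level 10, a, b, f at level 9).
Local Notation t := (m%:R * h).
Local Notation dlt := (m%:R / K.+1%:R : R).

Definition path_label (b : R -> R) : T :=
  [ffun k : 'I_m => torus_cell R K (torus_pi (nu * (b (k.+1%:R * h) - b (k%:R * h))))].

Lemma path_label_grid (b1 b2 : R -> R) : b1 0 = 0 -> b2 0 = 0 ->
  path_label b1 = path_label b2 -> forall k, (k <= m)%N ->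
  torus_dist (torus_pi (nu * b1 (k%:R * h))) (torus_pi (nu * b2 (k%:R * h))) <= dlt.
Proof.
move=> b10 b20 /ffunP e k km.
apply: (grid_dist R h m K (fun s => nu * b1 s) (fun s => nu * b2 s)) => //.
  by rewrite b10 b20.
by move=> j jm; have := e (Ordinal jm); rewrite !ffunE/= !mulrBr.
Qed.

Variables (N1 N2 : nat) (S : finType) (t1 : 'I_N1 -> S) (t2 : 'I_N2 -> S).
Variables (w1 : 'M[R]_N1) (w2 : 'M[R]_N2) (gam0 : 'M[R]_(N1, N2)).
Variables (a1 a2 : S -> S -> R) (M e c : R) (p : T -> R) (F : S -> S -> R).
Variables (x1 : 'I_N1 -> R) (x2 : 'I_N2 -> R) (b1 : 'I_N1 -> R -> R) (b2 : 'I_N2 -> R -> R).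
Variables (k : nat) (eta Kp err : R) (Y1 : 'I_N1 -> torus R) (Y2 : 'I_N2 -> torus R).
Hypothesis N10 : (0 < N1)%N.
Hypothesis N20 : (0 < N2)%N.
Hypothesis cgam0 : coupling gam0.
Hypothesis p0 : forall x, 0 <= p x.
Hypothesis p1 : \sum_x p x = 1.
Hypothesis M0 : 0 <= M.
Hypothesis a1M : forall s s', `|a1 s s'| <= M.
Hypothesis a2M : forall s s', `|a2 s s'| <= M.
Hypothesis e0 : 0 <= e.
Hypothesis c0 : 0 <= c.
Hypothesis hw1 : opb (kernop R N1 (w1 - stepmx R N1 S t1 a1)) e.
Hypothesis hw2 : opb (kernop R N2 (w2 - stepmx R N2 S t2 a2)) e.
Hypothesis hc : opb (commut R N1 N2 w1 w2 gam0) c.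
Hypothesis hc' : opb (commut R N2 N1 w2 w1 gam0^T) c.
Hypothesis cb1 : forall i, continuous (b1 i).
Hypothesis cb2 : forall i, continuous (b2 i).
Hypothesis b10 : forall i, b1 i 0 = 0.
Hypothesis b20 : forall i, b2 i 0 = 0.
Hypothesis F0 : forall s s', 0 <= F s s'.
Hypothesis FX : forall i j, torus_dist (torus_pi (x1 i)) (torus_pi (x2 j)) <= F (t1 i) (t2 j).
Hypothesis Kp0 : 0 <= Kp.
Local Notation iter w x b := (picard_iter R mu sigma nu _ w x b k).
Local Notation q1 := (fun i s => nu * b1 i s).
Local Notation q2 := (fun i s => nu * b2 i s).
Hypothesis Y1err : forall i, torus_dist (Y1 i) (torus_pi (iter w1 x1 b1 i t)) <= err.
Hypothesis Y2err : forall i, torus_dist (Y2 i) (torus_pi (iter w2 x2 b2 i t)) <= err.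
Hypothesis hK : forall (gam : 'M[R]_(N1, N2)) kap, 0 <= kap -> coupling gam ->
  opb (commut R N1 N2 w1 w2 gam) kap -> opb (commut R N2 N1 w2 w1 gam^T) kap ->
  path_average R N1 N2 gam (iter w1 x1 b1) (iter w2 x2 b2) t
  <= eta + Kp * (coupled_average R N1 N2 gam
                  (fun i j => torus_dist (torus_pi (x1 i)) (torus_pi (x2 j)))
    + kap + path_average R N1 N2 gam q1 q2 t + II 0 t (path_average R N1 N2 gam q1 q2)).

Let Th := \sum_l `|label_freq t1 l.1 * p l.2 - label_freq (fun i => (t1 i, path_label (b1 i))) l|
  + \sum_l `|label_freq t2 l.1 * p l.2 - label_freq (fun i => (t2 i, path_label (b2 i))) l|.

(** Everything takes place on one sample path. The coupling of [relabelled_coupling]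
    matches the noise labels, so that the noises are close on average under it, and
    [hK], which stands for [picard_stability], turns this into closeness of the
    solutions. *)
Lemma pathwise_stability (kap : R) : kap = 4 * e + 4 * M * Num.sqrt Th + c ->
  bicoupling_dist w1 Y1 w2 Y2 <= 2 * err + eta + 2 * kap
  + Kp * (Th + \sum_i \sum_j gam0 i j * F (t1 i) (t2 j) + kap + (Th + dlt)
      + (t * (Th + dlt) + N1%:R^-1 * \sum_i oscillation R h m (q1 i)
                        + N2%:R^-1 * \sum_j oscillation R h m (q2 j))).
Proof.
move=> kapE.
have Th0 : 0 <= Th by rewrite addr_ge0// sumr_ge0.
have kap0 : 0 <= kap by rewrite kapE !addr_ge0// mulr_ge0// mulr_ge0.
have [gam [cg g1 g2 hf]] := relabelled_coupling R N1 N2 S S T t1 t2 (fun i => path_label (b1 i))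
  (fun i => path_label (b2 i)) p w1 w2 gam0 a1 a2 M e c N10 N20 cgam0 p0 p1 M0 a1M a2M e0 c0
  hw1 hw2 hc hc'.
rewrite -/Th -kapE in g1 g2 hf.
apply: (le_trans (bicoupling_dist_le _ _ _ w1 Y1 w2 Y2 gam kap kap N10 N20 cg kap0 kap0 g1 g2)).
have av_le (f : 'I_N1 -> 'I_N2 -> R) (c' : R) (J1 : 'I_N1 -> R) (J2 : 'I_N2 -> R) :
  (forall i j, f i j <= 1) -> 0 <= c' -> (forall i, 0 <= J1 i) -> (forall j, 0 <= J2 j) ->
  (forall i j, path_label (b1 i) = path_label (b2 j) -> f i j <= c' + J1 i + J2 j) ->
  coupled_average R N1 N2 gam f <= Th + c' + N1%:R^-1 * \sum_i J1 i + N2%:R^-1 * \sum_j J2 j.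
  move=> f1 c'0 J10 J20 fJ; have := hf f (fun _ _ => c') J1 J2 f1 (fun _ _ => c'0) J10 J20 fJ.
  rewrite (_ : \sum_i \sum_j gam0 i j * c' = c')//.
  under eq_bigr do rewrite -mulr_suml.
  by rewrite -mulr_suml coupling_mass// mul1r.
have h1 : \sum_i \sum_j torus_dist (Y1 i) (Y2 j) * gam i j
    <= 2 * err + path_average R N1 N2 gam (iter w1 x1 b1) (iter w2 x2 b2) t.
  rewrite -[2 * err](coupled_average_cst R N1 N2 gam N10 cg) -coupled_averageD.
  apply: coupled_average_le => // i j /=.
  apply: (le_trans (torus_dist_triangle _ (torus_pi (iter w1 x1 b1 i t)) _ _)).
  have := torus_dist_triangle _ (torus_pi (iter w2 x2 b2 j t)) (torus_pi (iter w1 x1 b1 i t)) (Y2 j).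
  have := Y1err i; have := Y2err j; rewrite (torus_distC _ (Y2 j)).
  by move=> u1 u2 u3; lra.
have h2 : coupled_average R N1 N2 gam (fun i j => torus_dist (torus_pi (x1 i)) (torus_pi (x2 j)))
    <= Th + \sum_i \sum_j gam0 i j * F (t1 i) (t2 j).
  have := hf (fun i j => torus_dist (torus_pi (x1 i)) (torus_pi (x2 j))) F (fun _ => 0) (fun _ => 0).
  rewrite !big1_eq !mulr0 !addr0; apply=> //.
  - by move=> i j; exact: torus_dist_le1.
  - by move=> i j _; rewrite /= ?addr0.
have mg i j : path_label (b1 i) = path_label (b2 j) -> forall k, (k <= m)%N ->
    torus_dist (torus_pi (q1 i (k%:R * h))) (torus_pi (q2 j (k%:R * h))) <= dlt.
  by move=> e'; apply: path_label_grid.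
have cq1 i : continuous (q1 i) by move=> s; apply: cvgM; [exact: cvg_cst|exact: cb1].
have cq2 i : continuous (q2 i) by move=> s; apply: cvgM; [exact: cvg_cst|exact: cb2].
have h3 := matched_end R h m N1 N2 gam q1 q2 _ _ _ Th K mg av_le.
have h4 := matched_integral R h m h0 N1 N2 gam q1 q2 _ _ _ Th K cq1 cq2 mg av_le.
have h5 := hK gam kap kap0 cg g1 g2.
apply: (le_trans (lerD (le_trans h1 (lerD (lexx _) h5)) (lexx _))).
rewrite -/(coupled_average _ _ _ _ _).
set u1 := coupled_average _ _ _ _ _ in h2 *.
set u3 := path_average _ _ _ _ _ _ _ in h3 *.
set u4 := II 0 _ _ in h4 *.
rewrite (_ : kap + kap = 2 * kap); last by ring.
have -> : forall a b c d : R, a + (b + c) + d = a + b + d + c by move=> *; ring.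
rewrite lerD2l; apply: ler_wpM2l => //.
by apply: lerD h4; apply: lerD h3; rewrite lerD2r.
Qed.
End pathwise.

(** Makes the bound of [pathwise_stability] affine in the deviation of the empirical
    laws, of which only the mean is controlled. *)
Lemma sqrt_le_linear (R : realType) (y th : R) : 0 <= y -> 0 < th -> Num.sqrt y <= th + y / th.
Proof.
move=> y0 th0; have e : y = Num.sqrt y * Num.sqrt y by rewrite -expr2 sqr_sqrtr.
have := sqrtr_ge0 y; rewrite {3}e; move: (Num.sqrt y) => s s0.
have [st|ts] := leP s th; first by rewrite ler_wpDr// divr_ge0 ?mulr_ge0// ltW.
by apply: ler_wpDl; [exact: ltW|rewrite ler_pdivlMr// ler_wpM2l// ltW].
Qed.

Section pair_expectation.
Context (R : realType) (d : measure_display) (Omega : measurableType d).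
Variable P : probability Omega R.
Variables (mu : torus R -> R) (sigma : torus R * torus R -> R) (nu : R).
Variables (Lm Ls C : R) (N : nat -> nat) (w : forall n, 'M[R]_(N n)).
Variables (X0 : forall n, 'I_(N n) -> torus R) (B : forall n, 'I_(N n) -> R -> Omega -> R).
Variable X : forall n, 'I_(N n) -> R -> Omega -> torus R.
Arguments X0 : clear implicits. Arguments B : clear implicits. Arguments X : clear implicits.
Hypothesis mu_cont : continuous mu.
Hypothesis sigma_cont : continuous sigma.
Hypothesis Lm0 : 0 <= Lm.
Hypothesis Ls0 : 0 <= Ls.
Hypothesis C0 : 0 <= C.
Hypothesis nu0 : 0 <= nu.
Hypothesis N_gt0 : forall n, (0 < N n)%N.
Hypothesis muL : forall x y, `|mu x - mu y| <= Lm * torus_dist x y.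
Hypothesis sigmaL : forall x x' y y',
  `|sigma (x, y) - sigma (x', y')| <= Ls * (torus_dist x x' + torus_dist y y').
Hypothesis wC : forall n i j, `|w n i j| <= C.
Hypothesis B_brownian : forall n, independent_brownian_motions P (B n).
Hypothesis X_sol : forall n, is_solution P mu sigma nu (w n) (B n) (X0 n) (X n).
Local Notation mean := (mean R d Omega P).
Local Notation bounded_rv := (bounded_rv R d Omega).

Variables (h : R) (m K K0 : nat).
Hypothesis h0 : 0 < h.
Local Notation T := {ffun 'I_m -> 'I_K.+1}.
Local Notation t := (m%:R * h).
Local Notation dlt := (m%:R / K.+1%:R : R).
Variables (S : finType) (M e : R) (tau : forall n, 'I_(N n) -> S) (a : nat -> S -> S -> R).
Arguments tau : clear implicits.
Hypothesis aM : forall n s s', `|a n s s'| <= M.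
Hypothesis M0 : 0 <= M.
Hypothesis e0 : 0 <= e.
Hypothesis hw : forall n,
  opb ((N n)%:R^-1 *: (w n - \matrix_(i, j) a n (tau n i) (tau n j))) e.

Let lab n i : S * 'I_K0.+1 := (tau n i, torus_cell R K0 (X0 n i)).
Let alab n (s s' : S * 'I_K0.+1) := a n s.1 s'.1.
Let F (s s' : S * 'I_K0.+1) : R :=
  torus_dist (cell_point R K0 s.2) (cell_point R K0 s'.2) + 2 * K0.+1%:R^-1.
Let Th n := label_deviation R d Omega nu h m K (N n) (B n) _ (lab n).

Variables (k : nat) (eta Kp err : R).
Hypothesis Kp0 : 0 <= Kp.
Hypothesis err_le : picard_err R mu sigma Lm Ls C k t <= err.
Hypothesis hK : forall N1 N2 (w1 : 'M[R]_N1) (w2 : 'M[R]_N2) (gam : 'M[R]_(N1, N2)) kap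
    (x1 : 'I_N1 -> R) (x2 : 'I_N2 -> R) (b1 : 'I_N1 -> R -> R) (b2 : 'I_N2 -> R -> R) (s : R),
  (0 < N1)%N -> (0 < N2)%N -> 0 <= kap ->
  (forall i j, `|w1 i j| <= C) -> (forall i j, `|w2 i j| <= C) -> coupling gam ->
  opb (commut R N1 N2 w1 w2 gam) kap -> opb (commut R N2 N1 w2 w1 gam^T) kap ->
  (forall i, continuous (b1 i)) -> (forall i, continuous (b2 i)) ->
  0 <= s -> s <= t ->
  path_average R N1 N2 gam (picard_iter R mu sigma nu _ w1 x1 b1 k)
    (picard_iter R mu sigma nu _ w2 x2 b2 k) s
  <= eta + Kp * (coupled_average R N1 N2 gam
                  (fun i j => torus_dist (torus_pi (x1 i)) (torus_pi (x2 j)))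
    + kap + path_average R N1 N2 gam (fun i s => nu * b1 i s) (fun j s => nu * b2 j s) s
    + \int[@lebesgue_measure R]_(u in `[0, t])
        path_average R N1 N2 gam (fun i s => nu * b1 i s) (fun j s => nu * b2 j s) u).

Variables (n1 n2 : nat) (c th theta aa : R) (gam0 : 'M[R]_(N n1, N n2)).
Hypothesis c0 : 0 <= c.
Hypothesis th0 : 0 < th.
Hypothesis theta0 : 0 < theta.
Hypothesis aa0 : 0 < aa.
Hypothesis cgam0 : coupling gam0.
Hypothesis transport0 :
  \sum_i \sum_j torus_dist (X0 n1 i) (X0 n2 j) * gam0 i j <= c.
Hypothesis hc : opb (commut R (N n1) (N n2) (w n1) (w n2) gam0) c.
Hypothesis hc' : opb (commut R (N n2) (N n1) (w n2) (w n1) gam0^T) c.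

Definition constant_error : R :=
  2 * err + eta + (2 + Kp) * (4 * e + 4 * M * theta + c)
  + Kp * (c + 4 * K0.+1%:R^-1 + dlt * (1 + t)).

Definition deviation_factor : R := (2 + Kp) * (4 * M / theta) + Kp * (2 + t).

(** The types of [pathwise_stability] are those of the step kernels refined by a cell of
    the initial position, which makes the initial transport cost a function of the
    types up to the size of a cell. *)
Lemma cell_transport i j : torus_dist (X0 n1 i) (X0 n2 j) <= F (lab n1 i) (lab n2 j).
Proof.
apply: (le_trans (torus_dist_triangle _ (cell_point R K0 (lab n1 i).2) _ _)).
have := torus_dist_triangle _ (cell_point R K0 (lab n2 j).2) (cell_point R K0 (lab n1 i).2) (X0 n2 j).
have h1 := cell_point_dist R K0 (X0 n1 i); have h2 := cell_point_dist R K0 (X0 n2 j).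
rewrite torus_distC in h2; rewrite /F /lab /= in h1 h2 *; move: h1 h2.
by move: (K0.+1%:R^-1) => q; lra.
Qed.

Lemma cell_transport_average :
  \sum_i \sum_j gam0 i j * F (lab n1 i) (lab n2 j) <= c + 4 * K0.+1%:R^-1.
Proof.
have -> : \sum_i \sum_j gam0 i j * F (lab n1 i) (lab n2 j)
    = coupled_average R _ _ gam0 (fun i j => F (lab n1 i) (lab n2 j)).
  by apply: eq_bigr => i _; apply: eq_bigr => j _; rewrite mulrC.
apply: (@le_trans _ _ (coupled_average R _ _ gam0
   (fun i j => torus_dist (X0 n1 i) (X0 n2 j) + 4 * K0.+1%:R^-1))); last first.
  by rewrite coupled_averageD coupled_average_cst// lerD2r.
apply: coupled_average_le => // i j.
have h1 := cell_point_dist R K0 (X0 n1 i); have h2 := cell_point_dist R K0 (X0 n2 j).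
have := torus_dist_triangle _ (X0 n1 i) (cell_point R K0 (lab n1 i).2) (cell_point R K0 (lab n2 j).2).
have := torus_dist_triangle _ (X0 n2 j) (X0 n1 i) (cell_point R K0 (lab n2 j).2).
rewrite torus_distC in h1; rewrite /F /lab /= in h1 h2 *; move: h1 h2.
by move: (K0.+1%:R^-1) => q; lra.
Qed.

Variable Z : nat -> set Omega.
Hypothesis mZ : forall n, measurable (Z n).
Hypothesis PZ : forall n, P (Z n) = 0%E.
Hypothesis hZ : forall n om, ~ Z n om -> forall i, B n i 0 om = 0 /\
    {within `[0, +oo[, continuous (fun t => B n i t om)}.
Local Notation b n := (regular_noise R d Omega (N n) (B n) (Z n)).
Let osc n om := (N n)%:R^-1 * \sum_i oscillation R h m (fun s => nu * b n i s om).

Definition random_bound om : R :=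
  constant_error + (deviation_factor * (Th n1 om + Th n2 om) + Kp * (osc n1 om + osc n2 om)).

Lemma random_bound_ae : {ae P, forall om,
  bicoupling_dist (w n1) (fun i => X n1 i t om) (w n2) (fun i => X n2 i t om) <= random_bound om}.
Proof.
have lift n : {x : 'I_(N n) -> R | forall i, torus_pi (x i) = X0 n i}.
  apply: cid; have [f hf] := choice (fun i => torus_pi_surj R (X0 n i)).
  by exists f.
pose x n := sval (lift n).
have xX n i : torus_pi (x n i) = X0 n i := svalP (lift n) i.
have t0 : 0 <= t by rewrite mulr_ge0// ltW.
have ae n := solution_picard_dist R d Omega P mu sigma nu Lm Ls C (N n) (w n) mu_cont sigma_cont
  Lm0 Ls0 C0 (N_gt0 n) muL sigmaL (wC n) (B n) (X0 n) (x n) (xX n) (Z n) (mZ n) (PZ n) (hZ n)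
  (X n) (X_sol n).
have zn n : {ae P, forall om, ~ Z n om} := ae_regular R d Omega P (Z n) (mZ n) (PZ n).
have az n : {ae P, forall om, ~ Z n om /\ forall i, torus_dist (X n i t om)
   (torus_pi (picard_iter R mu sigma nu _ (w n) (x n) (fun i s => b n i s om) k i t)) <= err}.
  apply: filterS2 (ae n) (zn n) => om hom nz; split=> // i.
  by apply: le_trans err_le; exact: hom.
apply: filterS2 (az n1) (az n2) => om [nz1 y1] [nz2 y2].
have cb n i : continuous (fun s => b n i s om).
  exact: (continuous_regular_noise R d Omega (N n) (B n) (Z n) (hZ n)).
have b00 n i : b n i 0 om = 0 by exact: (regular_noise0 R d Omega (N n) (B n) (Z n) (hZ n)).
have el n (i : 'I_(N n)) : ~ Z n om ->
    path_label R nu h m K (fun s => b n i s om) = noise_label R d Omega nu h m K (B n i) om.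
  move=> nz; apply/ffunP => j; rewrite !ffunE /increment.
  by rewrite !regular_noiseE// mulr_ge0// ltW.
have Wp : brownian_motion P (B n1 (Ordinal (N_gt0 n1))) by case: (B_brownian n1).
pose thv := Th n1 om + Th n2 om.
have thv0 : 0 <= thv by rewrite addr_ge0// label_deviation_ge0.
have F0 s s' : 0 <= F s s' by rewrite addr_ge0 ?torus_dist_ge0// mulr_ge0.
have FX i j : torus_dist (torus_pi (x n1 i)) (torus_pi (x n2 j)) <= F (lab n1 i) (lab n2 j).
  by rewrite !xX; exact: cell_transport.
have main := pathwise_stability R mu sigma nu h m K h0 (N n1) (N n2) _ (lab n1) (lab n2)
  (w n1) (w n2) gam0 (alab n1) (alab n2) M e c (noise_law R nu h m K) F (x n1) (x n2)
  (fun i s => b n1 i s om) (fun i s => b n2 i s om) k eta Kp err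
  (fun i => X n1 i t om) (fun i => X n2 i t om) (N_gt0 n1) (N_gt0 n2) cgam0
  (noise_law_ge0 R nu h m K) (noise_law_sum R d Omega P nu h m K h0 _ Wp) M0
  (fun s s' => aM n1 s.1 s'.1) (fun s s' => aM n2 s.1 s'.1) e0 c0 (hw n1) (hw n2) hc hc'
  (cb n1) (cb n2) (b00 n1) (b00 n2) F0 FX Kp0 y1 y2
  (fun gam kap kap0 cg g1 g2 => hK _ _ _ _ gam kap (x n1) (x n2) _ _ t (N_gt0 n1) (N_gt0 n2)
     kap0 (wC n1) (wC n2) cg g1 g2 (cb n1) (cb n2) t0 (lexx t)) _ erefl.
apply: (le_trans main).
have e1 : (fun i => (lab n1 i, path_label R nu h m K (fun s => b n1 i s om)))
    = (fun i => (lab n1 i, noise_label R d Omega nu h m K (B n1 i) om)).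
  by apply/funext => i; rewrite el.
have e2 : (fun i => (lab n2 i, path_label R nu h m K (fun s => b n2 i s om)))
    = (fun i => (lab n2 i, noise_label R d Omega nu h m K (B n2 i) om)).
  by apply/funext => i; rewrite el.
rewrite e1 e2 -/(label_deviation R d Omega nu h m K (N n1) (B n1) _ (lab n1) om).
rewrite -/(label_deviation R d Omega nu h m K (N n2) (B n2) _ (lab n2) om).
rewrite -/(Th n1 om) -/(Th n2 om) -/thv -/(osc n1 om) -/(osc n2 om).
have hs := sqrt_le_linear R thv theta thv0 theta0.
have hF := cell_transport_average.
rewrite /random_bound /constant_error /deviation_factor -/thv.
move: (osc n1 om) (osc n2 om) => o1 o2.
set q := 4 * K0.+1%:R^-1 in hF *; set D := dlt.
set f := \sum_i _ in hF *; set kap := 4 * e + 4 * M * Num.sqrt thv + c.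
pose kap' := 4 * e + 4 * M * theta + c + 4 * M / theta * thv.
have hkap : kap <= kap'.
  have -> : kap' = 4 * e + 4 * M * (theta + thv / theta) + c by rewrite /kap'; ring.
  by rewrite lerD2r lerD2l ler_wpM2l// mulr_ge0.
have hk1 : (2 + Kp) * kap <= (2 + Kp) * kap' by rewrite ler_wpM2l// addr_ge0.
have hk2 : Kp * f <= Kp * (c + q) by rewrite ler_wpM2l.
have -> : 2 * err + eta + 2 * kap + Kp * (thv + f + kap + (thv + D) + (t * (thv + D) + o1 + o2))
  = 2 * err + eta + (2 + Kp) * kap + Kp * f + (Kp * (2 + t) * thv + Kp * D * (1 + t) + Kp * (o1 + o2)).
  by ring.
have -> : 2 * err + eta + (2 + Kp) * (4 * e + 4 * M * theta + c) + Kp * (c + q + D * (1 + t)) +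
  (((2 + Kp) * (4 * M / theta) + Kp * (2 + t)) * thv + Kp * (o1 + o2))
  = 2 * err + eta + (2 + Kp) * kap' + Kp * (c + q)
    + (Kp * (2 + t) * thv + Kp * D * (1 + t) + Kp * (o1 + o2)).
  by rewrite /kap'; ring.
by rewrite lerD2r lerD// lerD2l.
Qed.

Lemma mean_random_bound (Nmin : R) : 0 < Nmin -> Nmin <= (N n1)%:R -> Nmin <= (N n2)%:R ->
  bounded_rv random_bound /\
  mean random_bound <= constant_error
    + (deviation_factor * (2 * (#|{: (S * 'I_K0.+1) * T}|%:R * (th + (th * Nmin)^-1)))
    + Kp * (2 * (t * (nu * aa + 8 * h / aa ^+ 2)))).
Proof.
move=> Nm0 Nm1 Nm2; have t0 : 0 <= t by rewrite mulr_ge0// ltW.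
have df0 : 0 <= deviation_factor.
  by apply: addr_ge0; apply: mulr_ge0; rewrite ?addr_ge0// ?divr_ge0 ?mulr_ge0// ltW.
have bT n : bounded_rv (Th n).
  by case: (mean_label_deviation R d Omega P nu h m K h0 (N n) (B n) (N_gt0 n) (B_brownian n)
    _ (lab n) th th0).
have mT n : Nmin <= (N n)%:R -> mean (Th n) <= #|{: (S * 'I_K0.+1) * T}|%:R * (th + (th * Nmin)^-1).
  move=> Nmn; have [_ ] := mean_label_deviation R d Omega P nu h m K h0 (N n) (B n) (N_gt0 n)
    (B_brownian n) _ (lab n) th th0.
  move=> /le_trans; apply; rewrite ler_wpM2l// lerD2l lef_pV2 ?posrE ?mulr_gt0//.
    by rewrite ler_wpM2l// ltW.
  by rewrite ltr0n.
have mo n i := mean_oscillation R d Omega P nu (N n) (B n) nu0 (proj1 (B_brownian n)) (Z n)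
  (mZ n) (hZ n) h m i aa h0 aa0.
have bs n : bounded_rv (fun om => \sum_i oscillation R h m (fun s => nu * b n i s om)).
  by apply: bounded_rv_sum => i; case: (mo n i).
have bo n : bounded_rv (osc n) by exact: bounded_rvZ.
have mo' n : mean (osc n) <= t * (nu * aa + 8 * h / aa ^+ 2).
  have n0 : 0 < (N n)%:R :> R by rewrite ltr0n.
  rewrite /osc meanZ// ler_pdivrMl// mean_sum; last by move=> i; case: (mo n i).
  apply: (@le_trans _ _ (\sum_(i < N n) (t * (nu * aa + 8 * h / aa ^+ 2)))).
    by apply: ler_sum => i _; case: (mo n i).
  by rewrite sumr_const card_ord -[leLHS]mulr_natl.
have bTT : bounded_rv (fun om => Th n1 om + Th n2 om) by exact: bounded_rvD.
have boo : bounded_rv (fun om => osc n1 om + osc n2 om) by exact: bounded_rvD.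
have b1 : bounded_rv (fun om => deviation_factor * (Th n1 om + Th n2 om)) by exact: bounded_rvZ.
have b2 : bounded_rv (fun om => Kp * (osc n1 om + osc n2 om)) by exact: bounded_rvZ.
have b12 : bounded_rv (fun om => deviation_factor * (Th n1 om + Th n2 om)
   + Kp * (osc n1 om + osc n2 om)) by exact: bounded_rvD.
split; first by apply: bounded_rvD => //; exact: bounded_rv_cst.
rewrite /random_bound meanD//; last exact: bounded_rv_cst.
rewrite mean_cst lerD2l meanD// !meanZ// !meanD//.
apply: lerD; apply: ler_wpM2l => //; rewrite [2]mulr2n mulrDl !mul1r; apply: lerD => //; exact: mT.
Qed.

Lemma pair_expectation (Nmin : R) : 0 < Nmin -> Nmin <= (N n1)%:R -> Nmin <= (N n2)%:R ->
  ('E_P[fun om => bicoupling_dist (w n1) (fun i => X n1 i t om) (w n2) (fun i => X n2 i t om)]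
  <= (constant_error
    + (deviation_factor * (2 * (#|{: (S * 'I_K0.+1) * T}|%:R * (th + (th * Nmin)^-1)))
    + Kp * (2 * (t * (nu * aa + 8 * h / aa ^+ 2)))))%:E)%E.
Proof.
move=> Nm0 Nm1 Nm2; have [bG mG] := mean_random_bound Nmin Nm0 Nm1 Nm2.
apply: le_trans (_ : ((mean random_bound)%:E <= _)%E); last by rewrite lee_fin.
apply: expectation_le_mean => //; last exact: random_bound_ae.
by move=> om; apply: bicoupling_dist_ge0.
Qed.
End pair_expectation.

Lemma small_factor (R : realType) (A ep : R) : 0 <= A -> 0 < ep ->
  exists2 x, 0 < x & A * x <= ep.
Proof.
move=> A0 ep0; have A1 : 0 < A + 1 by rewrite ltr_wpDl.
exists (ep / (A + 1)); first by rewrite divr_gt0.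
by rewrite mulrA ler_pdivrMr// mulrC ler_wpM2l ?lerDl// ltW.
Qed.

Lemma small_nat_factor (R : realType) (A ep : R) : 0 < ep ->
  exists n : nat, A / n.+1%:R <= ep.
Proof.
move=> ep0; exists (Num.truncn (A / ep)).
have := truncnS_gt (A / ep); rewrite ltr_pdivrMr// => h.
by rewrite ler_pdivrMr ?ltr0n// mulrC ltW.
Qed.

(** Each constant is chosen in terms of the previous ones: the number [k] of Picard
    iterations, the constant [Kp] of their stability, the accuracy [e] of the step
    kernels and hence the number of types, the distance [c] of the initial systems, the
    grids in time and space, and last the size [Nmin] from which on the law of large
    numbers is effective. *)
Lemma stability (R : realType) (d : measure_display) (Omega : measurableType d)
    (P : probability Omega R) (mu : torus R -> R) (sigma : torus R * torus R -> R) (nu : R)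
    (Lm Ls C : R) (N : nat -> nat) (w : forall n, 'M[R]_(N n))
    (X0 : forall n, 'I_(N n) -> torus R) (B : forall n, 'I_(N n) -> R -> Omega -> R)
    (X : forall n, 'I_(N n) -> R -> Omega -> torus R) :
  continuous mu -> continuous sigma -> 0 <= Lm -> 0 <= Ls -> 0 <= C -> 0 <= nu ->
  (forall n, (0 < N n)%N) -> N n @[n --> \oo] --> \oo ->
  (forall x y, `|mu x - mu y| <= Lm * torus_dist x y) ->
  (forall x x' y y',
    `|sigma (x, y) - sigma (x', y')| <= Ls * (torus_dist x x' + torus_dist y y')) ->
  (forall n i j, `|w n i j| <= C) ->
  (forall n, independent_brownian_motions P (B n)) ->
  (forall n, is_solution P mu sigma nu (w n) (B n) (X0 n) (X n)) ->
  bicoupling_cauchy w X0 -> forall t : R, 0 < t -> forall ep : R, 0 < ep ->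
  exists n0, forall p, (n0 <= p.1)%N -> (n0 <= p.2)%N ->
    ('E_P[fun om => bicoupling_dist (w p.1) (fun i => X p.1 i t om)
                                   (w p.2) (fun i => X p.2 i t om)] <= ep%:E)%E.
Proof.
move=> mu_cont sigma_cont Lm0 Ls0 C0 nu0 N_gt0 N_cvg muL sigmaL wC B_brownian X_sol X0_cauchy
  t t0 ep ep0.
pose ep' := ep / 16; have ep'0 : 0 < ep' by rewrite divr_gt0.
(* The final bound is a sum of at most twelve terms, each of them at most ep'. *)
have e3 : 3 * ep' + (ep' + ep' + ep' + ep' + ep' + ep' + ep' + ep' + ep') <= ep.
  by rewrite /ep'; lra.
have t0' := ltW t0.
have [k hk] := picard_err_cvg R mu sigma Lm Ls C Lm0 Ls0 C0 t _ ep'0.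
have {}hk := hk k (leqnn k).
have [Kp Kp0 hK] := picard_stability R mu sigma nu Lm Ls C mu_cont sigma_cont Lm0 Ls0 C0
  muL sigmaL k t t0' _ ep'0.
have A0 : 0 <= 2 + Kp by rewrite addr_ge0.
have [e e0 he] : exists2 e, 0 < e & (2 + Kp) * 4 * e <= ep' by apply: small_factor => //; rewrite mulr_ge0.
have [S [M0 hS]] := weak_regularity R C e C0 e0.
pose M := `|M0|.
have [theta theta0 htheta] : exists2 x, 0 < x & (2 + Kp) * (4 * M) * x <= ep'.
  by apply: small_factor => //; apply: mulr_ge0 => //; apply: mulr_ge0 => //; exact: normr_ge0.
have [c c0 hc] : exists2 x, 0 < x & (2 + Kp + Kp) * x <= ep'.
  by apply: small_factor => //; rewrite addr_ge0.
have [K0 hK0] := small_nat_factor R (Kp * 4) ep' ep'0.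
have [aa aa0 haa] : exists2 x, 0 < x & Kp * 2 * t * nu * x <= ep'.
  by apply: small_factor => //; rewrite !mulr_ge0.
have [m hm] := small_nat_factor R (Kp * 16 * t * t / aa ^+ 2) ep' ep'0.
have [K hKK] := small_nat_factor R (Kp * m.+1%:R * (1 + t)) ep' ep'0.
pose h := t / m.+1%:R; have h0 : 0 < h by rewrite divr_gt0// ltr0n.
have th_eq : m.+1%:R * h = t by rewrite /h mulrC divfK// pnatr_eq0.
pose card : R := #|{: (S * 'I_K0.+1) * {ffun 'I_m.+1 -> 'I_K.+1}}|%:R.
pose dev := (2 + Kp) * (4 * M / theta) + Kp * (2 + t).
have dev0 : 0 <= dev.
  apply: addr_ge0; apply: mulr_ge0 => //; last exact: addr_ge0.
  by apply: divr_ge0; [apply: mulr_ge0 => //; exact: normr_ge0|exact: ltW].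
have Q0 : 0 <= dev * (2 * card) by rewrite mulr_ge0// mulr_ge0// ler0n.
have [th th0 hth] := small_factor R _ ep' Q0 ep'0.
have [y y0 hy] : exists2 x, 0 < x & dev * (2 * card) / th * x <= ep'.
  by apply: small_factor => //; rewrite divr_ge0// ltW.
pose Nmin := y^-1; have Nmin0 : 0 < Nmin by rewrite invr_gt0.
have [n1 hn1] : exists n1, forall n, (n1 <= n)%N -> Nmin <= (N n)%:R.
  have : nbhs \oo [set k | (Num.truncn Nmin < k)%N] by exact: nbhs_infty_gt.
  move=> /N_cvg[n1 _ hn1]; exists n1 => n n1n; have := hn1 n n1n.
  move=> /= hN; apply: ltW; apply: lt_le_trans (truncnS_gt Nmin) _.
  by rewrite ler_nat.
have [n2 hn2] := tail_sup_cvg0P R (fun p => bicoupling_dist (w p.1) (X0 p.1) (w p.2) (X0 p.2))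
  (fun p => bicoupling_dist_ge0 _ _ _ _ _ _ _ (N_gt0 p.1) (N_gt0 p.2)) X0_cauchy c c0.
have hta n : {ta : ('I_(N n) -> S) * (S -> S -> R) | (forall s s', `|ta.2 s s'| <= M0) /\
    opb ((N n)%:R^-1 *: (w n - \matrix_(i, j) ta.2 (ta.1 i) (ta.1 j))) e}.
  apply: cid; have [tau [a ha]] := hS (N n) (w n) (N_gt0 n) (wC n).
  by exists (tau, a).
pose tau n := (sval (hta n)).1; pose a n := (sval (hta n)).2.
have aM n s s' : `|a n s s'| <= M.
  by have [h1 _] := svalP (hta n); apply: le_trans (ler_norm M0); exact: h1.
have aE n : opb ((N n)%:R^-1 *: (w n - \matrix_(i, j) a n (tau n i) (tau n j))) e.
  by case: (svalP (hta n)).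
have hZ n : {Z : set Omega | [/\ measurable Z, P Z = 0%E &
    forall om, ~ Z om -> forall i, B n i 0 om = 0 /\
    {within `[0, +oo[, continuous (fun t => B n i t om)}]}.
  by apply: cid; apply: noise_exceptional; case: (B_brownian n).
exists (maxn n1 n2) => -[p q] /=; rewrite !geq_max => /andP[p1 p2] /andP[q1 q2].
have [gam0 [cg tr g1 g2]] := bicoupling_dist_adherent R _ _ _ _ _ _ _ (N_gt0 p) (N_gt0 q)
  (hn2 (p, q) p2 q2).
rewrite -th_eq in hk hK.
have := pair_expectation R d Omega P mu sigma nu Lm Ls C N w X0 B X mu_cont sigma_cont Lm0 Ls0 C0
  nu0 N_gt0 muL sigmaL wC B_brownian X_sol h m.+1 K K0 h0 S M e tau a aM (normr_ge0 _) (ltW e0) aE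
  k ep' Kp ep' Kp0 hk hK p q c th theta aa gam0 (ltW c0) th0 theta0 aa0 cg tr g1 g2
  (fun n => sval (hZ n)) _ _ _ Nmin Nmin0 (hn1 p p1) (hn1 q q1).
rewrite th_eq -/card /deviation_factor /constant_error th_eq -/dev => hE.
apply: (le_trans (hE _ _ _)).
- by move=> n; case: (svalP (hZ n)).
- by move=> n; case: (svalP (hZ n)).
- by move=> n; case: (svalP (hZ n)).
rewrite lee_fin.
have h1 : Kp * (4 * K0.+1%:R^-1) <= ep' by rewrite mulrA.
have h2 : Kp * (m.+1%:R / K.+1%:R * (1 + t)) <= ep'.
  apply: le_trans hKK; rewrite le_eqVlt; apply/orP; left; apply/eqP.
  by move: (K.+1%:R^-1) => z; ring.
have h3 : Kp * (2 * (t * (8 * h / aa ^+ 2))) <= ep'.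
  apply: le_trans hm; rewrite le_eqVlt; apply/orP; left; apply/eqP; rewrite /h.
  by move: (m.+1%:R^-1) (aa ^- 2) => z z'; ring.
have h4 : dev * (2 * (card * th)) <= ep' by rewrite !mulrA in hth *.
have h5 : dev * (2 * (card * (th * Nmin)^-1)) <= ep'.
  apply: le_trans hy; rewrite le_eqVlt; apply/orP; left; apply/eqP; rewrite /Nmin invfM invrK.
  by move: (th^-1) => z; ring.
have -> : 2 * ep' + ep' + (2 + Kp) * (4 * e + 4 * M * theta + c) +
    Kp * (c + 4 * K0.+1%:R^-1 + m.+1%:R / K.+1%:R * (1 + t)) +
    (dev * (2 * (card * (th + (th * Nmin)^-1))) + Kp * (2 * (t * (nu * aa + 8 * h / aa ^+ 2))))
  = 3 * ep' + (2 + Kp) * 4 * e + (2 + Kp) * (4 * M) * theta + (2 + Kp + Kp) * c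
    + Kp * (4 * K0.+1%:R^-1) + Kp * (m.+1%:R / K.+1%:R * (1 + t)) + dev * (2 * (card * th))
    + dev * (2 * (card * (th * Nmin)^-1)) + Kp * 2 * t * nu * aa
    + Kp * (2 * (t * (8 * h / aa ^+ 2))).
  by move: (aa ^- 2) ((th * Nmin)^-1) (K0.+1%:R^-1) (K.+1%:R^-1) => z1 z2 z3 z4; ring.
apply: le_trans e3; rewrite !addrA.
by rewrite !lerD.
Qed.

Theorem theorem1p2 (R : realType) (d : measure_display)
    (Omega : measurableType d) (P : probability Omega R)
    (mu : torus R -> R) (sigma : torus R * torus R -> R) (nu : R)
    (N : nat -> nat) (w : forall n, 'M[R]_(N n))
    (X0 : forall n, 'I_(N n) -> torus R)
    (B : forall n, 'I_(N n) -> R -> Omega -> R)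
    (mu_cont : continuous mu) (mu_W1oo : in_Wkoo_torus 1 mu)
    (sigma_cont : continuous sigma) (sigma_W2oo : in_Wkoo_torus2 2 sigma)
    (nu_ge0 : 0 <= nu)
    (N_gt0 : forall n, (0 < N n)%N) (N_cvg : N n @[n --> \oo] --> \oo)
    (w_bounded : exists C : R, forall n i j, `|w n i j| <= C)
    (B_brownian : forall n, independent_brownian_motions P (B n)) :
  [/\ (* well-posedness *)
      forall n, exists X : 'I_(N n) -> R -> Omega -> torus R,
        [/\ is_solution P mu sigma nu (w n) (B n) (X0 n) X,
            adapted P (B n) X
          & forall Y, is_solution P mu sigma nu (w n) (B n) (X0 n) Y ->
              indistinguishable P X Y],
      (* compactness *)
      exists2 phi : nat -> nat, {homo phi : m n / (m < n)%N} &
        bicoupling_cauchy (fun n => w (phi n)) (fun n => X0 (phi n))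
    & (* stability *)
      forall X : forall n, 'I_(N n) -> R -> Omega -> torus R,
        (forall n, is_solution P mu sigma nu (w n) (B n) (X0 n) (X n)) ->
        bicoupling_cauchy w X0 ->
        forall t : R, 0 < t ->
          (fun n => ereal_sup
             [set ('E_P[fun omega =>
                          bicoupling_dist
                            (w p.1) (fun i => X p.1 i t omega)
                            (w p.2) (fun i => X p.2 i t omega)])%E
                | p in [set p : nat * nat | (n <= p.1)%N /\ (n <= p.2)%N]])
            @ \oo --> 0%E].
Proof.
have [C' hC'] := w_bounded; pose C := `|C'|.
have C0 : 0 <= C by exact: normr_ge0.
have wC n i j : `|w n i j| <= C by apply: (le_trans (hC' n i j)); exact: ler_norm.
have [Lm Lm0 muL] := W1oo_lipschitz R mu mu_cont mu_W1oo.
have [Ls Ls0 sigmaL] := W2oo_lipschitz R sigma sigma_cont sigma_W2oo.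
split.
- move=> n; have bB : forall i, brownian_motion P (B n i) by case: (B_brownian n).
  have [Z [mZ PZ hZ]] := noise_exceptional R d Omega P (N n) (B n) bB.
  have [x0 x0X] := choice (fun i => torus_pi_surj R (X0 n i)).
  exists (strong_solution R d Omega mu sigma nu (N n) (w n) (B n) x0 Z); split.
  + by apply: (strong_solutionP R d Omega P mu sigma nu Lm Ls C) => //; case: sigma_W2oo.
  + by apply: (strong_solution_adapted R d Omega P mu sigma nu Lm Ls C) => //; case: sigma_W2oo.
  + by move=> Y; apply: (strong_solution_unique R d Omega P mu sigma nu Lm Ls C).
- exact: (cauchy_subsequence R N w X0 C).
- move=> X X_sol X0_cauchy t t0.
  apply: (tail_sup_cvg0 R (fun p => 'E_P[fun omega => bicoupling_dist
      (w p.1) (fun i => X p.1 i t omega) (w p.2) (fun i => X p.2 i t omega)]%E)).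
    by move=> p; rewrite unlock; apply: integral_ge0 => om _; rewrite lee_fin bicoupling_dist_ge0.
  by move=> ep ep0; apply: (stability R d Omega P mu sigma nu Lm Ls C N w X0 B X).
Qed.
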